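(* Every Artin monoid $\Gamma_M$ of finite type, with its standard generator system $G$ and with possibly finitely many exceptions, which are of types $A_l$, $B_l$ or $D_l$, is simple accumulating, that is, $\#\Omega(\Gamma_M,G)=1$. The limit partition function, i.e. the unique element $\omega_{\Gamma_M,G}$ of $\Omega(\Gamma_M,G)$, is given by $$\omega_{\Gamma_M,G}=Z_{\Gamma_M,G}(r_{\Gamma_M,G})=\sum_{S\in \mathrm{Conf}_0(\Gamma_M,G)}\varphi(S)\; r_{\Gamma_M,G}^{\,L(S)},$$ where $r_{\Gamma_M,G}$ is the smallest real root in the interval $(0,1)$ of the polynomial $$N_M(t)=\sum_{J\subset G}(-1)^{\#J}\,t^{\deg(\Delta_J)}.$$
   Context: Artin monoids. A Coxeter matrix over a finite nonempty set $G$ is $M=(m_{\alpha,\beta})_{\alpha,\beta\in G}$ with $m_{\alpha,\alpha}=1$ and $m_{\alpha,\beta}=m_{\beta,\alpha}\in\mathbb{Z}_{\ge2}\cup\{\infty\}$ for $\alpha\ne\beta$. The Artin monoid $\Gamma_M$ is the monoid generated by $G$ with relations $\alpha\beta\alpha\cdots=\beta\alpha\beta\cdots$ (alternating words of length $m_{\alpha,\beta}$ on both sides) for $\alpha\neq\beta$ with $m_{\alpha,\beta}<\infty$; $G$ is its standard generator system. $M$ (or $\Gamma_M$) is of finite type if the associated Coxeter group, obtained by adding the relations $\alpha^2=1$ for $\alpha\in G$, is finite; $M$ is not required to be indecomposable. The indecomposable Artin monoids of finite type are classified into the types $A_l\,(l\ge1)$, $B_l\,(l\ge2)$, $D_l\,(l\ge4)$,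 $E_6,E_7,E_8,F_4,G_2,H_3,H_4$, $I_2(p)\,(p\ge3)$. In $N_M(t)$ the sum is over all subsets $J\subset G$ such that $(m_{\alpha,\beta})_{\alpha,\beta\in J}$ is of finite type, and $\deg(\Delta_J)$ is the length of the longest element of the Coxeter group associated with that submatrix ($\deg(\Delta_\emptyset)=0$). General setting. Write $\Gamma=\Gamma_M$; it is an infinite cancellative monoid. The length is $l(g)=\min\{n\mid g=g_1\cdots g_n,\ g_i\in G\}$, which is additive here. The colored Cayley graph $(\Gamma,G)$ has vertex set $\Gamma$, with an oriented edge labelled $\alpha\in G$ from $u$ to $u\alpha$. A (full) subgraph is identified with its set of vertices; an isomorphism of subgraphs $\mathbb{S}\to\mathbb{T}$ is a bijection $\psi$ of vertices such that for $x,y\in\mathbb{S}$, $\alpha\in G$: $x\alpha=y$ iff $\psi(x)\alpha=\psi(y)$. $\mathrm{Conf}(\Gamma,G)$ is the set of isomorphism classes $[\mathbb{S}]$ of finite subgraphs, a commutative monoid under disjoint union with unit $[\emptyset]$, generated by $\mathrm{Conf}_0(\Gamma,G)$, the classes of (nonempty) connected finite subgraphs. $A(S,T)$ is the number of subgraphs of a representative of $T$ isomorphic to $S$. The ball $\Gamma_n=\{g\mid l(g)\le n\}$ is identified with its class in $\mathrm{Conf}_0(\Gamma,G)$. The configuration algebra $\mathbb{R}[[\mathrm{Conf}(\Gamma,G)]]$ is the completion of the monoid ring $\mathbb{R}\cdot\mathrm{Conf}(\Gamma,G)$ for the grading $\deg(S)=\#S$ (number of vertices); it also carries the classical topology, i.e.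 that of coefficientwise convergence in $\mathbb{R}$. Put $\mathcal{A}(T)=\sum_S A(S,T)S$ (constant term $1$) and $\mathcal{M}(T)=\log\mathcal{A}(T)$. The elements $\varphi(S)$, $S\in\mathrm{Conf}_0(\Gamma,G)$, are the unique elements with $\mathcal{M}(T)=\sum_{S\in\mathrm{Conf}_0(\Gamma,G)}\varphi(S)A(S,T)$ for all $T\in\mathrm{Conf}_0(\Gamma,G)$ (a unitriangular system); $\varphi(S)$ has only terms of degree $\ge\deg S$, so infinite sums $\sum_S\varphi(S)a_S$ with $a_S\in\mathbb{R}$ make sense, and the $a_S$ are uniquely determined by the sum. $\Omega(\Gamma,G)$ is the set of all limits, in the classical topology of $\mathbb{R}[[\mathrm{Conf}(\Gamma,G)]]$, of convergent subsequences of the sequence $\mathcal{M}(\Gamma_n)/\#\Gamma_n$, $n\ge0$. The growth partition function is $Z_{\Gamma,G}(t)=\big(\sum_{n\ge0}\mathcal{M}(\Gamma_n)t^n\big)/\big(\sum_{n\ge0}\#\Gamma_n\,t^n\big)$, regarded as a (possibly infinite) sum $\sum_{S}\varphi(S)Z(S,t)$ over $S\in\mathrm{Conf}_0(\Gamma,G)$ with $Z(S,t)\in\mathbb{Z}[[t]]$; its value at a number $r$ is obtained by evaluating each coefficient $Z(S,t)$ at $t=r$. The invariant $L$: for a finite nonempty $X\subset\Gamma$ let $\gcd_l(X)$ be its greatest common left divisor ($w$ left-divides $u$ if $u\in w\Gamma$); it exists in $\Gamma_M$. For $\Gamma_M$ of finite type, each $S\in\mathrm{Conf}_0(\Gamma,G)$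 has a unique representative subgraph $\mathbb{S}_0$ with $[\mathbb{S}_0]=S$ and $\gcd_l(\mathbb{S}_0)=e$, where $e$ is the unit of $\Gamma$, and $L(S)=\max\{l(u)\mid u\in\mathbb{S}_0\}$.
   Formalization: For products A_1 x ... x A_1 (all generators commuting), where N_M(t) = (1-t)^l has no root in the interval (0,1), r is taken to be 1, the only root of N_M; for all other M it is the smallest root in (0,1) as stated. *)

(* Defs.v *)
From HB Require Import structures.
From mathcomp Require Import all_boot all_order all_algebra finmap.
From mathcomp Require Import all_classical all_reals all_analysis.
Set Implicit Arguments.
Unset Strict Implicit.
Unset Printing Implicit Defensive.
Import Order.TTheory GRing.Theory Num.Theory numFieldNormedType.Exports.
Local Open Scope classical_set_scope.
Local Open Scope ring_scope.
Local Open Scope quotient_scope.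

Section Presentation.
Variables (G : choiceType) (rel : seq G -> seq G -> Prop).

(* the smallest congruence on words containing [rel] *)
Inductive pres_eq : seq G -> seq G -> Prop :=
| pres_rel u v of rel u v : pres_eq u v
| pres_refl u : pres_eq u u
| pres_sym u v of pres_eq u v : pres_eq v u
| pres_trans u v w of pres_eq u v & pres_eq v w : pres_eq u w
| pres_cat u u' v v' of pres_eq u u' & pres_eq v v' :
    pres_eq (u ++ v) (u' ++ v').

Definition pres_eqb (u v : seq G) : bool := `[< pres_eq u v >].

Lemma pres_eqb_refl : reflexive pres_eqb.
Proof. by move=> u; apply/asboolP; exact: pres_refl. Qed.

Lemma pres_eqb_sym : symmetric pres_eqb.
Proof.
by move=> u v; apply/idP/idP => /asboolP uv; apply/asboolP; exact: pres_sym.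
Qed.

Lemma pres_eqb_trans : transitive pres_eqb.
Proof.
move=> v u w /asboolP uv /asboolP vw.
by apply/asboolP; exact: pres_trans uv vw.
Qed.

Canonical pres_equiv := EquivRel pres_eqb pres_eqb_refl pres_eqb_sym
  pres_eqb_trans.

Definition presMonoid : Type := {eq_quot pres_equiv}.
HB.instance Definition _ := Choice.on presMonoid.
HB.instance Definition _ := EqQuotient.on presMonoid.

Definition pres_word (w : seq G) : presMonoid := \pi_presMonoid w.
Definition pres_one : presMonoid := pres_word [::].
Definition pres_mul (x y : presMonoid) : presMonoid :=
  pres_word (repr x ++ repr y).
Definition pres_gen (a : G) : presMonoid := pres_word [:: a].

Lemma pres_wordP u v : pres_word u = pres_word v <-> pres_eq u v.
Proof.
split => [/eqquotP /asboolP //|uv].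
by apply/eqquotP/asboolP.
Qed.

Lemma pres_wordK (x : presMonoid) : pres_word (repr x) = x.
Proof. exact: reprK. Qed.

Lemma pres_wordM u v : pres_mul (pres_word u) (pres_word v) = pres_word (u ++ v).
Proof.
apply/pres_wordP; apply: pres_cat; apply/pres_wordP; exact: pres_wordK.
Qed.

Lemma pres_mulA : associative pres_mul.
Proof.
move=> x y z.
by rewrite -[x]pres_wordK -[y]pres_wordK -[z]pres_wordK !pres_wordM catA.
Qed.

Lemma pres_mul1 : left_id pres_one pres_mul.
Proof. by move=> x; rewrite -[x]pres_wordK pres_wordM. Qed.

Lemma pres_mulr1 : right_id pres_one pres_mul.
Proof. by move=> x; rewrite -[x]pres_wordK pres_wordM cats0. Qed.

HB.instance Definition _ :=
  isMonoid.Build presMonoid pres_mulA pres_mul1 pres_mulr1.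

End Presentation.

Section Configuration.
Variables (X : monoidType) (G : finType) (gen : G -> X).

Definition nat_min (P : set nat) : nat :=
  xget 0%N [set n | P n /\ forall k, P k -> (n <= k)%N].

Definition len (g : X) : nat :=
  nat_min [set n | exists w : seq G, size w = n /\ g = (\prod_(a <- w) gen a)%g].

Definition cayley_ball (n : nat) : {fset X} := fset_set [set g | (len g <= n)%N].

(* A finite full subgraph of the Cayley graph is its vertex set. *)
Definition subgraph_isob (S T : {fset X}) : bool :=
  `[< exists f : S -> T, bijective f /\
      forall (x y : S) (a : G),
        (val x * gen a)%g = val y <-> (val (f x) * gen a)%g = val (f y) >].

Lemma subgraph_isob_refl : reflexive subgraph_isob.
Proof. by move=> S; apply/asboolP; exists id; split => //; exists id. Qed.

Lemma subgraph_isob_sym : symmetric subgraph_isob.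
Proof.
suff H S T : subgraph_isob S T -> subgraph_isob T S.
  by move=> S T; apply/idP/idP; exact: H.
move=> /asboolP[f [[g fK gK] iso]]; apply/asboolP; exists g; split.
  by exists f.
by move=> x y a; rewrite iso !gK.
Qed.

Lemma subgraph_isob_trans : transitive subgraph_isob.
Proof.
move=> T S U /asboolP[f [bf fiso]] /asboolP[g [bg giso]].
apply/asboolP; exists (g \o f); split; first exact: bij_comp.
by move=> x y a; rewrite fiso giso.
Qed.

Canonical subgraph_equiv := EquivRel subgraph_isob subgraph_isob_refl
  subgraph_isob_sym subgraph_isob_trans.

Definition conf : Type := {eq_quot subgraph_equiv}.
HB.instance Definition _ := Choice.on conf.
HB.instance Definition _ := EqQuotient.on conf.

Definition conf_of (S : {fset X}) : conf := \pi_conf S.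

Definition edge (x y : X) : bool := [exists a, (x * gen a)%g == y].

Definition connected_subgraph (S : {fset X}) : Prop :=
  S != fset0 /\
  forall x y : S,
    connect [rel u v : S | edge (val u) (val v) || edge (val v) (val u)] x y.

Definition conf0 : set conf := [set S | connected_subgraph (repr S)].

Definition conf_deg (S : conf) : nat := #|` repr S|.

(* [T] is the class of a disjoint union (with no edge between the two parts)
   of a subgraph of class [S1] and a subgraph of class [S2]; this is the graph
   of the product of the monoid of configurations. *)
Definition conf_prod (S1 S2 T : conf) : Prop :=
  exists Y1 Y2 : {fset X},
    [/\ conf_of Y1 = S1, conf_of Y2 = S2, [disjoint Y1 & Y2]%fset,
        forall x y, x \in Y1 -> y \in Y2 -> ~~ edge x y && ~~ edge y x &
        conf_of (Y1 `|` Y2)%fset = T].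

Definition subgraph_count (S T : conf) : nat :=
  #|` [fset Y in fpowerset (repr T) | conf_of Y == S]%fset|.

Section Algebra.
Variable R : realType.

(* An element of the completed monoid ring is its family of coefficients.
   There are finitely many configurations of each degree, so the completion
   imposes no condition on the family. *)
Definition confAlg : Type := conf -> R.

Definition conf_one : confAlg := fun T => (T == conf_of fset0)%:R.

Definition conf_mul (f g : confAlg) : confAlg := fun T =>
  \sum_(p \in [set p : conf * conf | conf_prod p.1 p.2 T]) f p.1 * g p.2.

Definition conf_pow (f : confAlg) (k : nat) : confAlg :=
  iter k (conf_mul f) conf_one.

(* logarithm of an element of constant term 1: (f - 1)^k has no term of degree
   less than k, so that only k <= deg T contributes to the coefficient of T *)
Definition conf_log (f : confAlg) : confAlg := fun T =>
  \sum_(1 <= k < (conf_deg T).+1)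
    (-1) ^+ k.+1 / k%:R * conf_pow (fun U => f U - conf_one U) k T.

Definition calA (T : conf) : confAlg := fun S => (subgraph_count S T)%:R.

Definition calM (T : conf) : confAlg := conf_log (calA T).

(* the infinite sum \sum_S c_S a_S over connected S, which is coefficientwise
   finite when c_S has only terms of degree at least deg S *)
Definition conf_sum (c : conf -> confAlg) (a : conf -> R) : confAlg := fun U =>
  \sum_(S \in conf0) c S U * a S.

Definition phi_system (p : conf -> confAlg) : Prop :=
  forall T, conf0 T -> calM T = conf_sum p (fun S => (subgraph_count S T)%:R).

(* The system is unitriangular (for the order by degree), hence determines its
   solution on [conf0]; only these values are used. *)
Definition phi : conf -> confAlg := xget (fun _ _ => 0) [set p | phi_system p].

Definition ball_card (n : nat) : R := #|` cayley_ball n|%:R.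

Definition ball_average (n : nat) : confAlg := fun U =>
  calM (conf_of (cayley_ball n)) U / ball_card n.

(* limits, for coefficientwise convergence, of subsequences *)
Definition Omega : set confAlg :=
  [set w | exists s : nat -> nat, {homo s : m n / (m < n)%N} /\
     forall U, (fun k => ball_average (s k) U) @ \oo --> w U].

(* [z S] is the sequence of coefficients of a power series Z(S,t); the
   condition reads, coefficient by coefficient in t,
     \sum_n calM(cayley_ball n) t^n
       = (\sum_n #(cayley_ball n) t^n) * \sum_S phi(S) Z(S,t). *)
Definition growth_quotient (z : conf -> nat -> int) : Prop :=
  forall n U, calM (conf_of (cayley_ball n)) U =
    \sum_(k < n.+1) ball_card (n - k) * conf_sum phi (fun S => (z S k)%:~R) U.

(* As #(ball 0) = 1 and the sums \sum_S phi(S) a_S determine the a_S, the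
   condition determines the coefficients of Z(S,t) for S in [conf0]. *)
Definition Zcoef : conf -> nat -> int :=
  xget (fun _ _ => 0) [set z | growth_quotient z].

Definition Zseries (S : conf) (r : R) : nat -> R :=
  series (fun n => (Zcoef S n)%:~R * r ^+ n).

Definition growth_partition (r : R) : confAlg :=
  conf_sum phi (fun S => limn (Zseries S r)).

End Algebra.

Definition left_divides (w u : X) : Prop := exists v, u = (w * v)%g.

Definition is_left_gcd (Y : {fset X}) (w : X) : Prop :=
  (forall u, u \in Y -> left_divides w u) /\
  (forall w', (forall u, u \in Y -> left_divides w' u) -> left_divides w' w).

Definition based_repr (S : conf) : {fset X} :=
  xget fset0 [set Y | conf_of Y = S /\ is_left_gcd Y 1%g].

Definition Linv (S : conf) : nat := \max_(u <- based_repr S) len u.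

End Configuration.

Arguments conf0 {X G} gen.
Arguments conf_sum {X G gen R} c a.
Arguments phi {X G} gen R.
Arguments Omega {X G} gen R.
Arguments growth_partition {X G} gen {R} r.
Arguments Zseries {X G gen R} S r.
Arguments Linv {X G gen} S.

(* [None] stands for the label infinity *)
Record coxeterMatrix (G : finType) := CoxeterMatrix {
  cox_label :> G -> G -> option nat;
  cox_diag : forall a, cox_label a a = Some 1%N;
  cox_sym : forall a b, cox_label a b = cox_label b a;
  cox_ge2 : forall a b n, a != b -> cox_label a b = Some n -> (2 <= n)%N }.

Section Artin.
Variables (G : finType) (M : coxeterMatrix G).

Definition alternating (a b : G) (n : nat) : seq G :=
  mkseq (fun i => if odd i then b else a) n.

Definition braid_rel (u v : seq G) : Prop :=
  exists a b n, [/\ a != b, M a b = Some n,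
                    u = alternating a b n & v = alternating b a n].

Definition cox_rel (u v : seq G) : Prop :=
  braid_rel u v \/ exists a, u = [:: a; a] /\ v = [::].

Definition artin : monoidType := presMonoid braid_rel.
Definition artin_gen : G -> artin := @pres_gen G braid_rel.

(* The relations a^2 = 1 make this monoid a group. *)
Definition coxeter_group : monoidType := presMonoid cox_rel.
Definition coxeter_gen : G -> coxeter_group := @pres_gen G cox_rel.

Definition finite_type : Prop := finite_set [set: coxeter_group].

(* for a finite Coxeter group: length of the longest element *)
Definition longest_length : nat :=
  \big[maxn/0%N]_(w \in [set: coxeter_group]) len coxeter_gen w.

End Artin.

Section SubMatrix.
Variables (G : finType) (M : coxeterMatrix G) (J : {set G}).

Definition sub_label (a b : {x : G | x \in J}) := M (val a) (val b).

Lemma sub_ge2 a b n : a != b -> sub_label a b = Some n -> (2 <= n)%N.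
Proof. by move=> neq_ab; apply: cox_ge2; rewrite (inj_eq val_inj). Qed.

Definition cox_sub : coxeterMatrix {x : G | x \in J} :=
  @CoxeterMatrix _ sub_label (fun a => cox_diag M (val a))
    (fun a b => cox_sym M (val a) (val b)) sub_ge2.

End SubMatrix.

Definition Npoly (R : realType) (G : finType) (M : coxeterMatrix G) : {poly R} :=
  \sum_(J : {set G} | `[< finite_type (cox_sub M J) >])
    (-1) ^+ #|J| *: 'X^(longest_length (cox_sub M J)).

(* type A_1 x ... x A_1 *)
Definition all_commuting (G : finType) (M : coxeterMatrix G) : Prop :=
  forall a b, a != b -> M a b = Some 2%N.

Definition smallest_root_in01 (R : realType) (p : {poly R}) (r : R) : Prop :=
  [/\ 0 < r < 1, root p r & forall s, 0 < s < 1 -> root p s -> r <= s].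

(* For type A_1 x ... x A_1 the polynomial is (1 - t)^l, which has no root in
   the open interval (0,1); its only root is then used. *)
Definition growth_root (R : realType) (G : finType) (M : coxeterMatrix G)
    (r : R) : Prop :=
  (~ all_commuting M /\ smallest_root_in01 (Npoly R M) r) \/
  (all_commuting M /\ r = 1).

Inductive abd_type := TypeA of nat | TypeB of nat | TypeD of nat.

Definition abd_rank (t : abd_type) : nat :=
  match t with TypeA l | TypeB l | TypeD l => l end.

Definition abd_valid (t : abd_type) : bool :=
  match t with
  | TypeA l => (1 <= l)%N
  | TypeB l => (2 <= l)%N
  | TypeD l => (4 <= l)%N
  end.

(* Label of the vertices i < j of the Coxeter graph. A_l and B_l are the path
   0 - 1 - ... - (l-1), whose last edge has label 4 for B_l; D_l is the path
   0 - 1 - ... - (l-2), with l-1 attached to l-3. *)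
Definition abd_label (t : abd_type) (i j : nat) : nat :=
  match t with
  | TypeA _ => if j == i.+1 then 3 else 2
  | TypeB l => if j == i.+1 then if j == l.-1 then 4 else 3 else 2
  | TypeD l => if j == l.-1 then if i == (l - 3)%N then 3 else 2
               else if j == i.+1 then 3 else 2
  end.

Definition has_type (G : finType) (M : coxeterMatrix G) (t : abd_type) : Prop :=
  exists f : G -> 'I_(abd_rank t), bijective f /\
    forall a b, (f a < f b)%N -> M a b = Some (abd_label t (f a) (f b)).

(* Main.v *)
Require Import Defs.
From HB Require Import structures.
From mathcomp Require Import all_boot all_order all_algebra finmap.
From mathcomp Require Import all_classical all_reals all_analysis.
From mathcomp Require Import algC cyclotomic.
From mathcomp Require Import zify ring lra.
Set Implicit Arguments.
Unset Strict Implicit.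
Unset Printing Implicit Defensive.
Import Order.TTheory GRing.Theory Num.Theory numFieldNormedType.Exports.
Local Open Scope classical_set_scope.
Local Open Scope ring_scope.
Local Notation alternating := Defs.alternating.

(** Moebius inversion over the subsets of [T] writes [log A(T)] as the sum of
    coefficients [nu(Y)], [Y] ranging over the subsets of [T], which depend on
    the class of [Y] only. The logarithm is additive on disjoint unions without
    edges, so [nu] vanishes on disconnected [Y]; in a connected degree [U] only
    the linear term of the logarithm survives, so [nu(Y)_U] is 1 if [Y] has
    class [U] and 0 otherwise. Hence [phi(S) = nu(S)], and the sums
    [\sum_S phi(S) a_S] determine the [a_S].

    An Artin monoid of finite type is cancellative and has left gcds and common
    multiples, so a connected class [S] has a single representative of left gcd
    1 and its other representatives are the left translates of that one. Thus
    [A(S, ball n)] is the cardinality of [ball (n - L(S))], and everything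
    reduces to the convergence of [#ball n / #ball (n + 1)].

    By left normal forms the numbers of elements of length [n] with prescribed
    left descents satisfy a linear recurrence with nonnegative coefficients. In
    each component of the Coxeter graph this recurrence is strongly connected
    and contains a loop of delay 1 (the powers of one generator), which makes
    the ratios of successive terms contract. Parabolic factorizations express
    the growth of the monoid as a convolution of such sequences, and the limit
    [r] of the ratios exists in all types: the exceptional set is empty. The
    identity [\sum_J (-1)^#J p(n - deg Delta_J) = 0] for [n > 0] shows that
    [r] is a root of [N_M], and that there is no smaller one. *)

(** * Coxeter groups *)

(** A direct proof of convergence would study the zeros of smallest modulus of [N_M]. They are never
    located here: the contraction of ratios needs only positivity, strong connection and a loop, and
    so it avoids the classification of finite types. For decomposable [M] strong connection fails,
    since a normal form can lose a component for good. Hence the recurrence is started at elements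
    whose left descents lie in a singleton [{a}], and the remaining elements are recovered one
    generator at a time. The limits of two convolved sequences may coincide; submultiplicativity of
    the counts then supplies the lower bound that makes boundary terms negligible. The structure
    theory is derived from the presentations. The numbers game, over the algebraic numbers, shows
    that [s a * s b] has order exactly [M a b]; the parity of reflections gives the exchange
    property, and Matsumoto's theorem lifts the Coxeter group into the monoid. *)

Section PresentedMonoid.
Local Open Scope nat_scope.
Local Open Scope group_scope.
Variables (G : finType) (rel : seq G -> seq G -> Prop).
Local Notation P := (presMonoid rel).
Local Notation w_ := (pres_word rel).
Local Notation l := (len (@pres_gen G rel)).

Lemma pres_word_cat (u v : seq G) : w_ (u ++ v) = w_ u * w_ v.
Proof. by rewrite -pres_wordM. Qed.

Lemma pres_word_cons (a : G) (v : seq G) : w_ (a :: v) = pres_gen rel a * w_ v.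
Proof. exact: (pres_word_cat [:: a]). Qed.

Lemma prod_pres_gen (w : seq G) : \prod_(a <- w) pres_gen rel a = w_ w.
Proof. by elim: w => [|a w IH]; rewrite ?big_nil ?big_cons ?IH -?pres_word_cons. Qed.

Lemma nat_min_mem (S : set nat) n : S n -> S (nat_min S).
Proof.
move=> Sn; rewrite /nat_min; case: xgetP => [m _ [] //|none].
have ex : exists n, `[< S n >] by exists n; apply/asboolP.
case: (ex_minnP ex) => m /asboolP Sm mmin.
by case: (none m); split => // k Sk; apply: mmin; apply/asboolP.
Qed.

Lemma nat_min_le (S : set nat) n : S n -> nat_min S <= n.
Proof.
move=> Sn; rewrite /nat_min; case: xgetP => [m _ [_]|none]; first exact.
have ex : exists n, `[< S n >] by exists n; apply/asboolP.
case: (ex_minnP ex) => m /asboolP Sm mmin.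
by case: (none m); split => // k Sk; apply: mmin; apply/asboolP.
Qed.

Lemma len_word_le (w : seq G) : l (w_ w) <= size w.
Proof. by apply: nat_min_le; exists w; rewrite prod_pres_gen. Qed.

Lemma len_wordP x : exists2 w : seq G, size w = l x & x = w_ w.
Proof.
have [w [sw xw]] : exists w : seq G, size w = l x /\ x = \prod_(a <- w) pres_gen rel a.
  apply: (@nat_min_mem (fun n => exists w : seq G, size w = n /\
    x = \prod_(a <- w) pres_gen rel a) (size (repr x))).
  by exists (repr x); rewrite prod_pres_gen pres_wordK.
by exists w => //; rewrite -prod_pres_gen.
Qed.

Lemma len_mul_le (x y : P) : l (x * y : P) <= l x + l y.
Proof.
have [u <- ->] := len_wordP x; have [v <- ->] := len_wordP y.
by rewrite -pres_word_cat -size_cat; exact: len_word_le.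
Qed.

Lemma len1 : l 1 = 0%N.
Proof. by apply/eqP; rewrite -leqn0; exact: (len_word_le [::]). Qed.

Lemma len0 x : l x = 0%N -> x = 1.
Proof. by have [[|a u] <- ->] := len_wordP x. Qed.

Definition rword (x : P) : seq G :=
  xget [::] [set w : seq G | size w = l x /\ x = w_ w].

Lemma rwordP x : size (rword x) = l x /\ x = w_ (rword x).
Proof.
rewrite /rword; case: xgetP => [w _ //|none].
by have [w sw xw] := len_wordP x; case: (none w).
Qed.

Lemma size_rword x : size (rword x) = l x. Proof. by have [] := rwordP x. Qed.
Lemma rwordK x : w_ (rword x) = x. Proof. by have [_ <-] := rwordP x. Qed.

End PresentedMonoid.

(** * Reflections of words and descents in a Coxeter group *)

Section CoxeterGroup.
Local Open Scope nat_scope.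
Local Open Scope group_scope.
Variables (G : finType) (M : coxeterMatrix G).

Local Notation W := (presMonoid (cox_rel M)).
Local Notation c_ := (pres_word (cox_rel M)).
Local Notation s := (pres_gen (cox_rel M)).

Lemma pres_eq_cons2 a : pres_eq (cox_rel M) [:: a; a] [::].
Proof. by apply: pres_rel; right; exists a. Qed.

Definition cox_inv (x : W) : W := c_ (rev (repr x)).

Fact cox_rel_rev u : pres_eq (cox_rel M) (rev u ++ u) [::].
Proof.
elim: u => [|a u IH]; first exact: pres_refl.
rewrite rev_cons -cats1 -catA /=.
rewrite -[a :: a :: u]/([:: a; a] ++ u).
apply: (pres_trans (v := rev u ++ [::] ++ u)) => //.
apply: pres_cat; first exact: pres_refl.
by apply: pres_cat; [exact: pres_eq_cons2 | exact: pres_refl].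
Qed.

Fact cox_mulVg : left_inverse 1 cox_inv ( *%g : W -> W -> W).
Proof.
move=> x; rewrite -{2}[x]pres_wordK -pres_word_cat.
by apply/pres_wordP; exact: cox_rel_rev.
Qed.

Fact cox_mulgV : right_inverse 1 cox_inv ( *%g : W -> W -> W).
Proof.
move=> x; rewrite -{1}[x]pres_wordK -pres_word_cat -{1}[repr x]revK.
by apply/pres_wordP; exact: cox_rel_rev.
Qed.

HB.instance Definition _ := hasInv.Build W cox_inv.
HB.instance Definition _ := Monoid_isGroup.Build W cox_mulVg cox_mulgV.

Lemma coxV_word u : (c_ u)^-1 = c_ (rev u).
Proof.
apply: (mulgI (c_ u)); rewrite mulgV -pres_word_cat; apply/esym.
by apply/pres_wordP; rewrite -{1}[u]revK; exact: cox_rel_rev.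
Qed.

Lemma gen_mulgg a : s a * s a = 1.
Proof. by rewrite -pres_word_cons; apply/pres_wordP; exact: pres_eq_cons2. Qed.

Lemma gen_invg a : (s a)^-1 = s a.
Proof. by apply: (mulgI (s a)); rewrite mulgV gen_mulgg. Qed.

Lemma gen_mulKg a x : s a * (s a * x) = x.
Proof. by rewrite mulgA gen_mulgg mul1g. Qed.

Lemma gen_mulgK a x : x * s a * s a = x.
Proof. by rewrite -mulgA gen_mulgg mulg1. Qed.

Lemma alternatingS (a b : G) n :
  alternating a b n.+1 = a :: alternating b a n.
Proof.
rewrite /alternating /mkseq /= -add1n iotaDl -map_comp; congr (_ :: _).
by apply: eq_map => i /=; case: (odd i).
Qed.

Lemma alternatingSr (a b : G) n :
  alternating a b n.+1 = rcons (alternating a b n) (if odd n then b else a).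
Proof. by rewrite /alternating mkseqS. Qed.

Lemma alternatingD (a b : G) m n :
  alternating a b (m + n) =
  alternating a b m ++ (if odd m then alternating b a n else alternating a b n).
Proof.
elim: m a b => [|m IH] a b //; rewrite addSn !alternatingS IH /=.
by case: (odd m).
Qed.

Lemma rev_alternating (a b : G) n :
  rev (alternating a b n) =
  if odd n then alternating a b n else alternating b a n.
Proof.
elim: n a b => [|n IH] a b //.
rewrite [in LHS]alternatingSr rev_rcons IH /=.
by case: (boolP (odd n)) => on; rewrite ?alternatingS // alternatingSr (negbTE on).
Qed.

(** The entry at the i-th letter is the reflection [s_1 ... s_i ... s_1]; for a reduced word these
    are the left inversions of the element. *)
Fixpoint refl (w : seq G) : seq W :=
  if w is a :: v then s a :: [seq s a * t * s a | t <- refl v] else [::].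

Lemma refl_cat (u v : seq G) :
  refl (u ++ v) = refl u ++ [seq c_ u * t * (c_ u)^-1 | t <- refl v].
Proof.
elim: u => [|a u IH] /=.
  by rewrite (eq_map (g := id)) ?map_id // => t; rewrite invg1 mulg1 mul1g.
rewrite IH map_cat -map_comp; congr (_ :: _ ++ _); apply: eq_map => t /=.
by rewrite pres_word_cons invgM gen_invg !mulgA.
Qed.

Lemma refl_alternating a b n :
  refl (alternating a b n) =
  [seq c_ (alternating a b i.*2.+1) | i <- iota 0 n].
Proof.
elim: n a b => [|n IH] a b //; rewrite alternatingS /= IH.
congr (_ :: _); rewrite -[1%N]/(1 + 0)%N iotaDl -!map_comp.
apply: eq_map => i /=.
rewrite add1n doubleS (alternatingSr a b) -cats1 pres_word_cat (alternatingS a b).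
by rewrite pres_word_cons (_ : odd i.*2.+2 = false) //= negbK odd_double.
Qed.

(** Alternating words of odd length are palindromes, hence involutions. The product of the two in
    question is the alternating word of length [2 n], which the braid relation makes trivial. *)
Lemma alternating_inv a b i j n : (i + j).+1 = n ->
  c_ (alternating a b n) = c_ (alternating b a n) ->
  c_ (alternating a b i.*2.+1) = c_ (alternating b a j.*2.+1).
Proof.
move=> ijn ab.
have pal c d k : (c_ (alternating c d k.*2.+1))^-1 = c_ (alternating c d k.*2.+1).
  by rewrite coxV_word rev_alternating /= odd_double.
apply/esym; rewrite -pal; apply: mulg1_eq.
have -> : c_ (alternating b a j.*2.+1) * c_ (alternating a b i.*2.+1) =
          c_ (alternating b a (n + n)).
  have -> : (n + n = j.*2.+1 + i.*2.+1)%N by lia.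
  by rewrite (alternatingD b a j.*2.+1) [odd _]/= odd_double pres_word_cat.
rewrite alternatingD pres_word_cat -ab.
case: (boolP (odd n)) => on.
  by apply: (mulgI (c_ (alternating a b n))^-1);
    rewrite mulKg mulg1 coxV_word rev_alternating on.
by apply: (mulgI (c_ (alternating a b n))^-1);
  rewrite mulKg mulg1 coxV_word rev_alternating (negbTE on).
Qed.

(** The two sides of a braid relation have the same reflections in opposite orders, and the word
    [a a] contributes [s a] twice. The position inside a longer word only conjugates the
    reflections. *)
Lemma refl_odd (u v : seq G) : pres_eq (cox_rel M) u v ->
  forall t, odd (count_mem t (refl u)) = odd (count_mem t (refl v)).
Proof.
elim=> {u v} // [u v [[a [b [n [ab mab -> ->]]]] | [a [-> ->]]] t | |].
- have ab' : c_ (alternating a b n) = c_ (alternating b a n).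
    by apply/pres_wordP; apply: pres_rel; left; exists a, b, n.
  rewrite !refl_alternating -[in RHS](revK [seq _ | i <- _]) count_rev.
  congr (odd (count_mem t _)); apply: (@eq_from_nth _ 1).
    by rewrite size_rev !size_map.
  move=> i; rewrite size_map size_iota => ltin.
  rewrite nth_rev ?size_map ?size_iota // !(nth_map 0%N) ?size_iota ?nth_iota //; try lia.
  by apply: (alternating_inv (n := n)) => //; lia.
- by rewrite /= gen_mulgg mul1g addn0 addnn odd_double.
- by move=> u v w _ IH1 _ IH2 t; rewrite IH1.
move=> u u' v v' uu' IH1 _ IH2 t.
rewrite !refl_cat !count_cat !oddD IH1 !count_map; congr (_ (+) _).
have -> : c_ u' = c_ u by apply/esym/pres_wordP.
have E w : count (preim (fun t0 => c_ u * t0 * (c_ u)^-1) (pred1 t)) w =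
  count_mem ((c_ u)^-1 * t * c_ u) w.
  apply: eq_count => x /=; apply/eqP/eqP => [<-|->].
    by rewrite !mulgA mulVg mul1g mulgVK.
  by rewrite !mulgA mulgV mul1g mulgK.
by rewrite !E IH2.
Qed.

Local Notation l := (len s).

Lemma len_gen_le a x : l (s a * x : W) <= (l x).+1.
Proof.
have [u <- ->] := len_wordP x; rewrite -pres_word_cons; exact: len_word_le.
Qed.

(** This is the sign character of the group. *)
Lemma pres_eq_odd_size (u v : seq G) : pres_eq (cox_rel M) u v ->
  odd (size u) = odd (size v).
Proof.
elim=> {u v} // [u v [[a [b [n [ab mab -> ->]]]] | [a [-> ->]]] | |] //.
- by rewrite !size_mkseq.
- by move=> u v w _ -> _ ->.
by move=> u u' v v' _ IH1 _ IH2; rewrite !size_cat !oddD IH1 IH2.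
Qed.

Lemma odd_len (u : seq G) : odd (l (c_ u)) = odd (size u).
Proof.
have [v <- uv] := len_wordP (c_ u).
by apply: pres_eq_odd_size; apply/pres_wordP.
Qed.

Lemma len_gen a x : l (s a * x : W) = (l x).+1 \/ l x = (l (s a * x : W)).+1.
Proof.
have H1 := len_gen_le a x; have := len_gen_le a (s a * x).
rewrite gen_mulKg => H2.
have : odd (l (s a * x)) = ~~ odd (l x).
  by rewrite -[x]pres_wordK -pres_word_cons !odd_len.
by lia.
Qed.

Lemma lenV x : l x^-1 = l x.
Proof.
suff H y : l y^-1 <= l y by apply/eqP; rewrite eqn_leq H -{1}[x]invgK H.
have [u <- ->] := len_wordP y; rewrite coxV_word -(size_rev u).
exact: len_word_le.
Qed.

Definition reduced (u : seq G) := l (c_ u) == size u.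

Lemma reduced_cons (a : G) (u : seq G) : reduced (a :: u) -> reduced u.
Proof.
rewrite /reduced pres_word_cons /= => /eqP H.
by have := len_gen_le a (c_ u); have := len_word_le (cox_rel M) u; lia.
Qed.

Lemma mem_refl t (w : seq G) : t \in refl w ->
  exists (w1 : seq G) c w2, w = w1 ++ c :: w2 /\ t * c_ w1 = c_ w1 * s c.
Proof.
elim: w t => [//|a v IH] t; rewrite inE => /orP[/eqP->|/mapP[x /IH]].
  by exists [::], a, v; split => //; rewrite mulg1 mul1g.
move=> [w1 [c [w2 [-> E]]]] ->; exists (a :: w1), c, w2; split => //.
by rewrite pres_word_cons -!mulgA gen_mulKg E.
Qed.

(** Left multiplication by the reflection attached to a letter deletes that letter. *)
Lemma refl_del t (w : seq G) : t \in refl w ->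
  exists w' : seq G, (size w').+1 = size w /\ t * c_ w = c_ w'.
Proof.
move=> /mem_refl[w1 [c [w2 [-> E]]]]; exists (w1 ++ w2).
rewrite !size_cat /= addnS; split => //.
by rewrite !pres_word_cat pres_word_cons mulgA E -mulgA gen_mulKg.
Qed.

(* Parity of the multiplicity of [s a] among the reflections of a word depends
   only on the element, and it is odd for a reduced word beginning with [a]. *)
Lemma descent_refl (a : G) (w : seq G) : l (s a * c_ w) < l (c_ w) -> s a \in refl w.
Proof.
move=> lt; have [v sv vE] := len_wordP (s a * c_ w).
have wE : c_ w = c_ (a :: v) by rewrite pres_word_cons -vE gen_mulKg.
have red : reduced (a :: v).
  by rewrite /reduced -wE /= sv; case: (len_gen a (c_ w)) => H; lia.
have odda : odd (count_mem (s a) (refl (a :: v))).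
  rewrite /= eqxx add1n /= count_map.
  have -> : count (preim (fun t => s a * t * s a) (pred1 (s a))) (refl v) = 0%N.
    apply/eqP; rewrite -leqn0 leqNgt -has_count; apply/negP => /hasP[t tv /= /eqP tE].
    have ta : t = s a.
      by rewrite -[t](gen_mulKg a) -[s a * t](gen_mulgK a) tE gen_mulgg mulg1.
    have [w' [sw' E]] := refl_del tv; rewrite ta -pres_word_cons in E.
    move: red; rewrite /reduced E => /eqP H.
    by have := len_word_le (cox_rel M) w'; rewrite H /= -sw'; lia.
  by [].
have : odd (count_mem (s a) (refl w)).
  by rewrite (refl_odd (v := a :: v)) //; apply/pres_wordP.
by rewrite -has_pred1 has_count; case: count.
Qed.

End CoxeterGroup.

(** * The numbers game as an action of the Coxeter group *)

Section NumbersGame.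
Variables (G : finType) (A : G -> G -> algC).
Hypotheses (A_diag : forall a, A a a = 2%:R) (A_sym : forall a b, A a b = A b a).

(* Mozes' numbers game: firing [a] subtracts [A a d * f a] from the number at
   each node [d]; this is the dual of the geometric representation. *)
Definition fire (f : {ffun G -> algC}) (a : G) : {ffun G -> algC} :=
  [ffun d => f d - A a d * f a].

(** [chebS c n] is the Chebyshev polynomial of the second kind [U_(n-1)] at [c / 2], that is
    [sin (n t) / sin t] for [c = 2 cos t]. *)
Fixpoint cheb (c : algC) (n : nat) : algC * algC :=
  if n is k.+1 then let p := cheb c k in (p.2, c * p.2 - p.1) else (0, 1).
Definition chebS c n := (cheb c n).1.

Lemma chebS0 c : chebS c 0 = 0. Proof. by []. Qed.
Lemma chebS1 c : chebS c 1 = 1. Proof. by []. Qed.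
Lemma chebSS c n : chebS c n.+2 = c * chebS c n.+1 - chebS c n.
Proof. by []. Qed.

(** The number found at the node fired at step [k], when two nodes with numbers [x] and [y] are
    fired alternately beginning with the first; [c] is the opposite of their entry in [A]. *)
Definition fired c (x y : algC) k := x * chebS c k.+1 + y * chebS c k.

Lemma firedSS c x y k : fired c x y k.+2 = c * fired c x y k.+1 - fired c x y k.
Proof. by rewrite /fired !chebSS; ring. Qed.

(** The total fired at one of the two nodes: [false] is the node fired first, [true] the other. *)
Definition fired_sum c x y (b : bool) n := \sum_(k < n | odd k == b) fired c x y k.

Lemma fired_sumS c x y b n :
  fired_sum c x y b n.+1 = fired_sum c x y b n + (if odd n == b then fired c x y n else 0).
Proof. by rewrite /fired_sum big_mkcond big_ord_recr /= -big_mkcond. Qed.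

Lemma fired_sumE c x y n :
  fired c x y n = (if odd n then y + c * fired_sum c x y false n - 2%:R * fired_sum c x y true n
     else x - 2%:R * fired_sum c x y false n + c * fired_sum c x y true n).
Proof.
elim/ltn_ind: n => -[|[|n]] IH.
- by rewrite /fired /fired_sum !big_ord0 /= chebS0 chebS1; ring.
- rewrite !fired_sumS /= /fired_sum !big_ord0 /fired chebSS chebS1 chebS0; ring.
rewrite firedSS !fired_sumS /= negbK.
have := IH n (ltnW (ltnSn _)); case: (odd n) => /= ->; ring.
Qed.

Lemma fire_alternating a b f n d : let c := - A a b in
  foldl fire f (alternating a b n) d =
  f d - A a d * fired_sum c (f a) (f b) false n - A b d * fired_sum c (f a) (f b) true n.
Proof.
move=> c; elim: n d => [|n IH] d.
  by rewrite /fired_sum !big_ord0 /=; ring.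
rewrite alternatingSr foldl_rcons ffunE !fired_sumS.
have -> : foldl fire f (alternating a b n) (if odd n then b else a) =
          fired c (f a) (f b) n.
  rewrite IH fired_sumE; case: (odd n); rewrite A_diag ?[A b a]A_sym /c; ring.
by rewrite IH; case: (odd n) => /=; ring.
Qed.

Lemma fire2 a f : foldl fire f [:: a; a] = f.
Proof. by apply/ffunP => d; rewrite /= !ffunE A_diag; ring. Qed.

Lemma fired_rev c m x y k :
  (forall k, (k <= m)%N -> chebS c (m - k) = chebS c k) -> (k < m)%N ->
  fired c x y (m - k.+1) = fired c y x k.
Proof.
move=> Hrev ltkm; rewrite /fired Hrev // subnSK // Hrev; last exact: ltnW.
by rewrite addrC.
Qed.

(** After the zero term of index [m] is added, the reversal [k -> m - k] changes the sign of each
    term because [m] is odd; so the sum is its own opposite. *)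
Lemma cheb_altsum c m : odd m -> (forall k, (k <= m)%N -> chebS c (m - k) = chebS c k) ->
  \sum_(k < m) (-1) ^+ k * chebS c k = 0.
Proof.
move=> om Hrev.
have H : \sum_(k < m.+1) (-1) ^+ k * chebS c k = \sum_(k < m) (-1) ^+ k * chebS c k.
  by rewrite big_ord_recr /= -[m in chebS c m]subn0 Hrev // chebS0 mulr0 addr0.
rewrite -H; set s := \sum_(k < _) _.
have E : s = - s.
  rewrite {1}/s (reindex_inj rev_ord_inj) /= -sumrN; apply: eq_bigr => k _.
  rewrite subSS Hrev -1?ltnS // -mulNr; congr (_ * _).
  rewrite -signr_odd oddB -1?ltnS // om /= -[in RHS]signr_odd.
  by case: (odd k); rewrite /= ?expr0 ?expr1 ?opprK.
have : s + s = 0 by rewrite {1}E addNr.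
by rewrite -mulr2n => /eqP; rewrite mulrn_eq0 /= => /eqP.
Qed.

(** The numbers fired along one word are those fired along the other read backwards. For even [m]
    this matches the totals node by node. For odd [m] it matches them crosswise, and the totals at
    the two nodes agree because their difference is an alternating sum of Chebyshev values. *)
Lemma fire_braid a b m : let c := - A a b in
  (forall k, (k <= m)%N -> chebS c (m - k) = chebS c k) ->
  forall f, foldl fire f (alternating a b m) = foldl fire f (alternating b a m).
Proof.
move=> c Hrev f; apply/ffunP => d; rewrite !fire_alternating [A b a]A_sym -/c.
have Hs x y e : fired_sum c x y e m = fired_sum c y x (odd m (+) e (+) true) m.
  rewrite /fired_sum (reindex_inj rev_ord_inj) /=; apply: eq_big => k.
    by rewrite oddB //= ; case: (odd m); case: (odd k); case: e.
  by move=> _; rewrite fired_rev.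
case: (boolP (odd m)) => om; last first.
  by rewrite ![fired_sum c (f b) _ _ _]Hs (negbTE om) /=; ring.
have Heo x y : fired_sum c x y false m = fired_sum c x y true m.
  apply/eqP; rewrite -subr_eq0; apply/eqP.
  transitivity (\sum_(k < m) (-1) ^+ k * fired c x y k).
    rewrite /fired_sum [RHS](bigID (fun k : 'I_m => odd k == false)) /=.
    congr (_ + _); last rewrite -sumrN.
      by apply: eq_bigr => k /eqP ok; rewrite -signr_odd ok expr0 mul1r.
    apply: eq_big => k; first by case: (odd k).
    by move=> /eqP ok; rewrite -signr_odd ok expr1 mulN1r.
  have S1 : \sum_(k < m) (-1) ^+ k * chebS c k.+1 = 0.
    have := cheb_altsum om Hrev; rewrite -(prednK (odd_gt0 om)).
    rewrite big_ord_recl /= chebS0 mulr0 add0r => H0.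
    rewrite big_ord_recr /= prednK ?odd_gt0 // -[m in chebS c m]subn0 Hrev // chebS0 mulr0 addr0.
    apply/eqP; rewrite -oppr_eq0 -sumrN; apply/eqP; rewrite -[RHS]H0.
    by apply: eq_bigr => k _; rewrite /bump /= add1n exprS; ring.
  under eq_bigr => k _ do rewrite /fired mulrDr mulrCA [_ * (y * _)]mulrCA.
  by rewrite big_split /= -!mulr_sumr S1 cheb_altsum // !mulr0 addr0.
rewrite !Heo ![fired_sum c (f b) _ _ _]Hs om /= -!Heo; ring.
Qed.

(** The initial numbers at [a] and [b] are arbitrary, so that the fixed point equation at [a] can be
    read off coefficient by coefficient. *)
Lemma fire_order a b n : a != b ->
  (forall f, foldl fire f (alternating a b n.*2) = f) ->
  chebS (- A a b) n.*2 = 0 /\ chebS (- A a b) n.*2.+1 = 1.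
Proof.
move=> neq_ab H.
have E x y : fired (- A a b) x y n.*2 = x.
  have := H [ffun d => if d == a then x else if d == b then y else 0].
  set f := finfun _ => Hf.
  have fa : f a = x by rewrite ffunE eqxx.
  have fb : f b = y by rewrite ffunE eq_sym (negbTE neq_ab) eqxx.
  have := congr1 (fun g : {ffun G -> algC} => g a) Hf.
  rewrite fire_alternating fa fb A_diag [A b a]A_sym => Ex.
  by rewrite fired_sumE odd_double -[RHS]Ex; ring.
have := E 0 1; have := E 1 0.
by rewrite /fired !mul0r !mul1r add0r addr0.
Qed.

End NumbersGame.

(** * Chebyshev values at sums of inverse roots of unity *)

Section ChebyshevRoot.
Variables (m : nat) (z : algC).
Hypotheses (m_ge2 : (2 <= m)%N) (z_prim : (m.*2).-primitive_root z).
Local Notation c := (z + z^-1).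

Lemma prim_neq0 : z != 0.
Proof.
apply/eqP => z0; have := prim_expr_order z_prim.
by rewrite z0 expr0n; case: m m_ge2 => //= k _ /eqP; rewrite eq_sym oner_eq0.
Qed.

Lemma prim_half : z ^+ m = -1.
Proof.
have : (z ^+ m) ^+ 2 = 1 by rewrite -exprM muln2 prim_expr_order.
move/eqP; rewrite sqrf_eq1 => /orP[|/eqP //].
by rewrite -(prim_order_dvd z_prim) => /dvdn_leq; lia.
Qed.

Lemma prim_sub_neq0 : z - z^-1 != 0.
Proof.
rewrite subr_eq0; apply/eqP => E.
have : z ^+ 2 == 1 by rewrite expr2 {2}E divff // prim_neq0.
by rewrite -(prim_order_dvd z_prim) => /dvdn_leq; lia.
Qed.

Lemma chebS_root k : chebS c k * (z - z^-1) = z ^+ k - z ^- k.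
Proof.
elim/ltn_ind: k => -[|[|k]] IH.
- by rewrite chebS0 expr0 invr1 subrr mul0r.
- by rewrite chebS1 mul1r expr1.
rewrite chebSS mulrBl -mulrA !IH //.
have z0 := prim_neq0; rewrite !exprS; field.
by rewrite expf_neq0 z0.
Qed.

Lemma chebS_rev k : (k <= m)%N -> chebS c (m - k) = chebS c k.
Proof.
move=> lekm; apply: (mulIf prim_sub_neq0); rewrite !chebS_root.
have z0 := prim_neq0.
rewrite expfB_cond ?(negbTE z0) ?add0n // prim_half; field.
by rewrite expf_neq0.
Qed.

(** Vanishing at [2 j] forces [m] to divide [2 j], hence [2 j = m]; but the value at [m + 1] is
    -1. *)
Lemma chebS_order j : (0 < j < m)%N -> ~ (chebS c j.*2 = 0 /\ chebS c j.*2.+1 = 1).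
Proof.
move=> /andP[j0 jm] [S0 S1].
have z0 := prim_neq0.
have := chebS_root j.*2; rewrite S0 mul0r => /esym/eqP; rewrite subr_eq0 => /eqP E.
have : z ^+ (j.*2 + j.*2) == 1 by rewrite exprD {2}E divff // expf_neq0.
rewrite -(prim_order_dvd z_prim) => dv.
have jE : j.*2 = m.
  have := dv; rewrite addnn -!muln2 dvdn_pmul2r // => /dvdnP[q qE].
  by case: q qE => [|[|q]]; nia.
have := chebS_root j.*2.+1; rewrite S1 jE exprS prim_half mul1r => /eqP.
rewrite mulrN1 invrN opprK -subr_eq0.
have -> : z - z^-1 - (- z + z^-1) = (z - z^-1) *+ 2 by rewrite mulr2n; ring.
by rewrite mulrn_eq0 /= (negbTE prim_sub_neq0).
Qed.

End ChebyshevRoot.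

(** The case of the label infinity: the values never return to 0. *)
Lemma chebS_two k : chebS 2%:R k = k%:R.
Proof.
elim/ltn_ind: k => -[|[|k]] IH //; rewrite chebSS !IH // -[k.+2]addn2 -[k.+1]addn1 !natrD; ring.
Qed.

(** * The weak order, the exchange property and Matsumoto's theorem *)

Section WeakOrder.
Local Open Scope nat_scope.
Local Open Scope group_scope.
Variables (G : finType) (M : coxeterMatrix G).

Local Notation W := (presMonoid (cox_rel M)).
Local Notation c_ := (pres_word (cox_rel M)).
Local Notation s := (pres_gen (cox_rel M)).
Local Notation l := (len s).
Implicit Types (a b : G) (u v : seq G) (x y z w g h : W).

Definition winv x : W := x^-1.

Lemma wmulA x y z : x * (y * z) = x * y * z. Proof. exact: mulgA. Qed.
Lemma wmulg1 x : x * 1 = x. Proof. exact: mulg1. Qed.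
Lemma wmul1g x : 1 * x = x. Proof. exact: mul1g. Qed.
Lemma wmulKg x y : winv x * (x * y) = y. Proof. exact: mulKg. Qed.
Lemma wmulVKg x y : x * (winv x * y) = y. Proof. exact: mulVKg. Qed.
Lemma winvM x y : winv (x * y) = winv y * winv x. Proof. exact: invgM. Qed.
Lemma wmulI x y z : x * y = x * z -> y = z. Proof. exact: mulgI. Qed.
Lemma winv_gen a : winv (s a) = s a. Proof. exact: gen_invg. Qed.

Definition prim_root_of (n : nat) : algC :=
  if n is k.+1 then sval (C_prim_root_exists (ltn0Sn k)) else 0%R.

Lemma prim_root_ofP n : 0 < n -> n.-primitive_root (prim_root_of n).
Proof. by case: n => // n _; rewrite /prim_root_of; case: C_prim_root_exists. Qed.

(** The entry is [- 2 cos (pi / m)] up to Galois conjugation, since the primitive root is an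
    arbitrary one. The argument is purely algebraic and needs no positivity. *)
Definition cartan a b : algC :=
  (if a == b then 2%:R
   else if M a b is Some m
        then - (prim_root_of m.*2 + (prim_root_of m.*2)^-1) else - 2%:R)%R.

Lemma cartan_diag a : cartan a a = 2%:R%R.
Proof. by rewrite /cartan eqxx. Qed.

Lemma cartan_sym a b : cartan a b = cartan b a.
Proof. by rewrite /cartan eq_sym cox_sym. Qed.

Lemma fire_pres_eq u v : pres_eq (cox_rel M) u v ->
  forall f, foldl (fire cartan) f u = foldl (fire cartan) f v.
Proof.
elim=> {u v} // [u v [[a [b [n [ab mab -> ->]]]] | [a [-> ->]]] f | |].
- have nge2 := cox_ge2 ab mab.
  apply: (fire_braid cartan_diag cartan_sym) => k lekn.
  rewrite /cartan (negbTE ab) mab opprK.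
  by apply: chebS_rev => //; apply: prim_root_ofP; lia.
- by rewrite (fire2 cartan_diag).
- by move=> u v w _ IH1 _ IH2 f; rewrite IH1.
by move=> u u' v v' _ IH1 _ IH2 f; rewrite !foldl_cat IH1 IH2.
Qed.

Definition label_gt a b k := if M a b is Some m then k < m else true.

(** With the braid relation this says that [s a * s b] has order exactly [M a b]: otherwise the
    numbers game would return too early. *)
Lemma alternating_neq1 a b j : a != b -> 0 < j -> label_gt a b j ->
  c_ (alternating a b j.*2) <> 1.
Proof.
move=> ab j0 jlt /pres_wordP /fire_pres_eq H.
have := fire_order cartan_diag cartan_sym ab H.
rewrite /cartan (negbTE ab); move: jlt; rewrite /label_gt.
case mab: (M a b) => [m|] jm; rewrite ?opprK.
  have mge2 := cox_ge2 ab mab.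
  by apply: (chebS_order mge2); [apply: prim_root_ofP; lia | rewrite j0].
by rewrite !chebS_two => -[/eqP]; rewrite pnatr_eq0 double_eq0; lia.
Qed.

(** If prepending [a] shortened the word, [s a] would be one of the reflections of
    [alternating b a k], and a power of [s a * s b] below its order would be trivial. *)
Lemma reduced_alternating a b k : a != b ->
  (if M a b is Some m then k <= m else true) -> reduced M (alternating a b k).
Proof.
elim: k a b => [|k IH] a b ab km; first by rewrite /reduced len1.
have redb : reduced M (alternating b a k).
  by apply: IH; rewrite 1?eq_sym // cox_sym; case: (M a b) km => // m /ltnW.
rewrite alternatingS /reduced pres_word_cons.
case: (len_gen a (c_ (alternating b a k))) => [->|H]; first by rewrite (eqP redb).
have := @descent_refl _ M a (alternating b a k).
rewrite H => /(_ (ltnSn _)).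
rewrite refl_alternating => /mapP[i]; rewrite mem_iota add0n => /andP[_ ik] E.
exfalso; apply: (@alternating_neq1 a b i.+1) => //.
  by rewrite /label_gt; case: (M a b) km => // m km; lia.
by rewrite doubleS alternatingS pres_word_cons -E gen_mulgg.
Qed.

Lemma braid_cox u v : pres_eq (braid_rel M) u v -> c_ u = c_ v.
Proof.
move=> H; apply/pres_wordP; elim: H => {u v}.
- by move=> u v uv; apply: pres_rel; left.
- by move=> u; exact: pres_refl.
- by move=> u v _; exact: pres_sym.
- by move=> u v w _ uv _; exact: pres_trans.
by move=> u u' v v' _ H1 _ H2; exact: pres_cat.
Qed.

Lemma alternating_braid a b m : a != b -> M a b = Some m ->
  c_ (alternating a b m) = c_ (alternating b a m).
Proof. by move=> ab mab; apply: braid_cox; apply: pres_rel; exists a, b, m. Qed.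

Definition redp x y := l (x * y : W) == l x + l y.
(** The right weak order: some reduced word of [w] begins with a reduced word of [x]. *)
Definition wle x w := l w == l x + l (winv x * w : W).

Lemma wle_mul x y : wle x (x * y) = redp x y.
Proof. by rewrite /wle wmulKg. Qed.

Lemma wleP x w : reflect (exists2 y, w = x * y & redp x y) (wle x w).
Proof.
apply: (iffP idP) => [xw|[y -> xy]]; last by rewrite wle_mul.
by exists (winv x * w); rewrite ?wmulVKg // -wle_mul wmulVKg.
Qed.

Lemma redp_assoc x y z : redp x (y * z) && redp y z = redp (x * y) z && redp x y.
Proof.
rewrite /redp wmulA.
have := len_mul_le x (y * z : W); have := len_mul_le (x * y : W) z.
have := len_mul_le x y; have := len_mul_le y z; rewrite wmulA.
move=> H1 H2 H3 H4; apply/andP/andP => -[/eqP E1 /eqP E2]; split; apply/eqP; lia.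
Qed.

Lemma redpA x y z : redp x (y * z) -> redp y z -> redp (x * y) z /\ redp x y.
Proof. by move=> H1 H2; apply/andP; rewrite -redp_assoc H1. Qed.

Lemma redpAr x y z : redp (x * y) z -> redp x y -> redp x (y * z) /\ redp y z.
Proof. by move=> H1 H2; apply/andP; rewrite redp_assoc H1. Qed.

Lemma redp1 x : redp x 1.
Proof. by rewrite /redp len1 wmulg1 addn0. Qed.

Lemma redp1l x : redp 1 x.
Proof. by rewrite /redp len1 wmul1g. Qed.

Lemma wle_refl x : wle x x.
Proof. by rewrite -{2}[x]wmulg1 wle_mul redp1. Qed.

Lemma wle1x x : wle 1 x.
Proof. by rewrite -[x]wmul1g wle_mul redp1l. Qed.

Lemma wle_trans y x z : wle x y -> wle y z -> wle x z.
Proof.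
move=> /wleP[p -> xp] /wleP[q -> xpq].
by have [+ _] := redpAr xpq xp; rewrite -wmulA wle_mul.
Qed.

Lemma wle_len x y : wle x y -> l x <= l y.
Proof. by move=> /eqP->; rewrite leq_addr. Qed.

Lemma wle_len_eq x y : wle x y -> l y <= l x -> x = y.
Proof.
move=> /wleP[z ->]; rewrite /redp => /eqP ->.
by rewrite -{2}[l x]addn0 leq_add2l leqn0 => /eqP/len0->; rewrite wmulg1.
Qed.

Lemma wle_anti x y : wle x y -> wle y x -> x = y.
Proof. by move=> xy /wle_len; exact: wle_len_eq. Qed.

Lemma wle1 x : wle x 1 -> x = 1.
Proof. by move=> H; apply: wle_anti; rewrite ?wle1x. Qed.

Lemma wle_mul2l p x y : redp p x -> redp p y -> wle (p * x) (p * y) = wle x y.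
Proof.
rewrite /redp /wle => /eqP -> /eqP ->.
by rewrite winvM -wmulA wmulKg -addnA eqn_add2l.
Qed.

Lemma redp_wle p x y : wle x y -> redp p y -> redp p x.
Proof. by move=> /wleP[z -> xz] H; have [] := redpA H xz. Qed.

Lemma len_s a : l (s a) = 1%N.
Proof.
by case: (len_gen a (1 : W)); rewrite wmulg1 len1 //.
Qed.

Lemma gen_neq1 a : s a != 1.
Proof. by apply/eqP => H; have := len_s a; rewrite H len1. Qed.

Lemma wle_gen a x : wle (s a) x = (l (s a * x) < l x).
Proof.
by rewrite /wle len_s winv_gen; case: (len_gen a x) => H; apply/eqP/idP; lia.
Qed.

Lemma redp_gen a x : redp (s a) x = ~~ wle (s a) x.
Proof.
by rewrite wle_gen /redp len_s; case: (len_gen a x) => H; apply/eqP/idP; lia.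
Qed.

Lemma gen_ex x : x != 1 -> exists a, wle (s a) x.
Proof.
have [[|a u] su xE] := len_wordP x; first by rewrite xE eqxx.
move=> _; exists a; rewrite wle_gen xE pres_word_cons gen_mulKg -pres_word_cons -xE -su.
exact: len_word_le.
Qed.

Lemma wle_gen_eq a b : wle (s a) (s b) -> s a = s b.
Proof. by move=> H; apply: wle_len_eq; rewrite ?len_s. Qed.

Lemma reduced_rword x : reduced M (rword x).
Proof. by rewrite /reduced rwordK size_rword. Qed.

Lemma reduced_cat u v : reduced M u -> reduced M v -> redp (c_ u) (c_ v) ->
  reduced M (u ++ v).
Proof.
by rewrite /reduced /redp pres_word_cat size_cat => /eqP-> /eqP-> .
Qed.

Lemma redp_word u v : reduced M (u ++ v) ->
  [/\ reduced M u, reduced M v & redp (c_ u) (c_ v)].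
Proof.
rewrite /reduced /redp pres_word_cat size_cat => /eqP H.
have := len_mul_le (c_ u) (c_ v); have := len_word_le (cox_rel M) u.
have := len_word_le (cox_rel M) v; rewrite H => H1 H2 H3.
by split; apply/eqP; lia.
Qed.

(** In a reduced word of [w] beginning with one of [x], the reflection [s a] belongs to some letter.
    This letter is not in [x], since [s a * x] is longer than [x]; so it is a later letter that is
    deleted, and [x] stays intact. *)
Lemma exchange a x w : wle (s a) w -> wle x w -> ~~ wle (s a) x ->
  wle (s a * x) w.
Proof.
move=> aw /wleP[z wE xz] ax.
have redax : redp (s a) x by rewrite redp_gen.
have [u su xE] := len_wordP x; have [v sv zE] := len_wordP z.
have : s a \in refl M (u ++ v).
  by apply: descent_refl; rewrite pres_word_cat -xE -zE -wE -wle_gen.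
rewrite refl_cat mem_cat => /orP[/refl_del[u' [su' E]]|/mapP[t tv tE]].
  move: redax; rewrite /redp xE E len_s -xE => /eqP H.
  by have := len_word_le (cox_rel M) u'; lia.
have [v' [sv' E]] := refl_del tv.
have wE' : w = s a * x * c_ v'.
  rewrite -E -wmulA -zE -{1}(gen_mulKg a w) wE; congr (_ * _).
  by rewrite wmulA tE -xE -!mulgA mulKg.
rewrite wE' wle_mul; have : l w = l x + l z by rewrite wE; apply/eqP.
rewrite wE' /redp.
have := len_mul_le (s a * x) (c_ v'); have := len_word_le (cox_rel M) v'.
have : l (s a * x) = (l x).+1 by move: redax; rewrite /redp len_s => /eqP.
by move: sv'; rewrite sv => sv' H1 H2 H3 H4; apply/eqP; lia.
Qed.

(** Repeated exchange prepends [a] and [b] in turn, as long as the alternating word stays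
    reduced. *)
Lemma join_alternating a b w k : a != b -> wle (s a) w -> wle (s b) w ->
  (if M a b is Some m then k <= m else true) -> wle (c_ (alternating a b k)) w.
Proof.
elim: k a b => [|k IH] a b ab aw bw km; first exact: wle1x.
rewrite alternatingS pres_word_cons; apply: exchange => //.
  by apply: IH; rewrite 1?eq_sym // cox_sym; case: (M a b) km => // m /ltnW.
rewrite -redp_gen.
have := reduced_alternating ab km; rewrite alternatingS.
by rewrite -cat1s => /redp_word[].
Qed.

Lemma label_finite (L : nat) a b : (forall x, l x <= L) -> exists m, M a b = Some m.
Proof.
move=> HL; case mab: (M a b) => [m|]; first by exists m.
have ab : a != b by apply/eqP => E; move: mab; rewrite E cox_diag.
have := @reduced_alternating a b L.+1 ab; rewrite mab => /(_ isT) /eqP.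
by move=> H; have := HL (c_ (alternating a b L.+1)); rewrite H size_mkseq ltnn.
Qed.

Lemma redp_gen_word a u : reduced M (a :: u) -> redp (s a) (c_ u).
Proof. by rewrite -cat1s => /redp_word[]. Qed.

(** Matsumoto's theorem. Equal first letters are cancelled. If they differ, the element has the
    longest alternating word in [a] and [b] as a prefix, and each of [u] and [v] is compared by
    induction with the reduced word that begins with the corresponding side of the braid
    relation. *)
Lemma reduced_braid u v : reduced M u -> reduced M v -> c_ u = c_ v ->
  pres_eq (braid_rel M) u v.
Proof.
have [n] := ubnP (size u); elim: n u v => // n IH u v ltn ru rv uv.
have suv : size u = size v by rewrite -(eqP ru) -(eqP rv) uv.
case: u v ltn ru rv uv suv => [|a u] [|b v] //; first by move=> *; exact: pres_refl.
move=> ltn ru rv uv [suv].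
have cons_eq c p q : pres_eq (braid_rel M) p q -> pres_eq (braid_rel M) (c :: p) (c :: q).
  by rewrite -(cat1s c p) -(cat1s c q) => ?; apply: pres_cat => //; exact: pres_refl.
case: (eqVneq a b) => [ab|ab].
  rewrite -ab in uv rv *; apply: cons_eq.
  by apply: IH; [|exact: reduced_cons ru|exact: reduced_cons rv|
    apply: (@wmulI (s a)); rewrite -!pres_word_cons].
set w := c_ (a :: u).
have aw : wle (s a) w by rewrite /w pres_word_cons wle_mul redp_gen_word.
have bw : wle (s b) w by rewrite /w uv pres_word_cons wle_mul redp_gen_word.
case mab: (M a b) => [m|]; last first.
  (* An infinite label would put a reduced alternating word longer than [w] below [w]. *)
  have := @join_alternating a b w (l w).+1 ab aw bw; rewrite mab => /(_ isT)/wle_len.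
  have := @reduced_alternating a b (l w).+1 ab; rewrite mab => /(_ isT)/eqP ->.
  by rewrite size_mkseq ltnn.
have := @join_alternating a b w m ab aw bw; rewrite mab => /(_ (leqnn _)) /wleP[z wE rz].
have mge2 := cox_ge2 ab mab.
have ralt : reduced M (alternating a b m) by apply: reduced_alternating; rewrite ?mab.
have ralt' : reduced M (alternating b a m).
  by apply: reduced_alternating; rewrite 1?eq_sym // cox_sym mab.
have r1 : reduced M (alternating a b m ++ rword z).
  by apply: reduced_cat => //; rewrite ?reduced_rword ?rwordK.
have r2 : reduced M (alternating b a m ++ rword z).
  apply: reduced_cat => //; rewrite ?reduced_rword ?rwordK //.
  by rewrite -(alternating_braid ab mab).
have w1 : w = c_ (alternating a b m ++ rword z) by rewrite pres_word_cat rwordK.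
have w2 : w = c_ (alternating b a m ++ rword z).
  by rewrite pres_word_cat rwordK -(alternating_braid ab mab).
have step c d t : c_ (c :: t) = c_ (alternating c d m ++ rword z) -> size t < n ->
    reduced M (c :: t) -> reduced M (alternating c d m ++ rword z) ->
    pres_eq (braid_rel M) (c :: t) (alternating c d m ++ rword z).
  rewrite -(ltn_predK mge2) alternatingS /= => E st rt ra; apply: cons_eq.
  apply: IH => //; [exact: reduced_cons rt|exact: reduced_cons ra|].
  by apply: (@wmulI (s c)); rewrite -!pres_word_cons.
apply: pres_trans (step a b u w1 ltn ru r1) _.
apply: pres_trans (pres_sym (step b a v _ _ rv r2)); last 2 first.
- by rewrite -uv -w2.
- by rewrite -suv.
by apply: pres_cat; [apply: pres_rel; exists a, b, m | exact: pres_refl].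
Qed.

End WeakOrder.

(** * The weak order of a finite Coxeter group *)

Section FiniteWeakOrder.
Local Open Scope nat_scope.
Local Open Scope group_scope.
Variables (G : finType) (M : coxeterMatrix G).

Local Notation W := (presMonoid (cox_rel M)).
Local Notation c_ := (pres_word (cox_rel M)).
Local Notation s := (pres_gen (cox_rel M)).
Local Notation l := (len s).
Implicit Types (a b : G) (u v : seq G) (x y z w g h : W) (J : {set G}).

Lemma braid_eq_mem u v : pres_eq (braid_rel M) u v -> u =i v.
Proof.
elim=> {u v} //.
- move=> u v [a [b [n [ab mab -> ->]]]] c; have n2 := cox_ge2 ab mab.
  have mem2 d e : (c \in alternating d e n) = (c == d) || (c == e).
    apply/idP/idP => [/mapP[i _ ->]|/orP[]/eqP->].
    - by case: (odd i); rewrite eqxx ?orbT.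
    - by apply/mapP; exists 0%N; rewrite ?mem_iota //; lia.
    by apply/mapP; exists 1%N; rewrite ?mem_iota //; lia.
  by rewrite !mem2 orbC.
- by move=> u v _ H c; rewrite H.
- by move=> u v w _ H1 _ H2 c; rewrite H1.
by move=> u u' v v' _ H1 _ H2 c; rewrite !mem_cat H1 H2.
Qed.

(** Membership in the parabolic subgroup of [J]. The chosen reduced word does not matter, because
    braid relations preserve the set of letters. *)
Definition wsupp J x := all (mem J) (rword x).

Lemma wsupp_word J u : reduced M u -> wsupp J (c_ u) = all (mem J) u.
Proof.
move=> ru; apply: eq_all_r; apply: braid_eq_mem; apply: reduced_braid => //.
  exact: reduced_rword.
by rewrite rwordK.
Qed.

Lemma wsupp_mul J x y : redp x y -> wsupp J (x * y) = wsupp J x && wsupp J y.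
Proof.
move=> xy; rewrite -{1}[x]rwordK -{1}[y]rwordK -pres_word_cat wsupp_word ?all_cat //.
by apply: reduced_cat; rewrite ?reduced_rword ?rwordK.
Qed.

Lemma wsupp_le J x y : wle x y -> wsupp J y -> wsupp J x.
Proof. by move=> /wleP[z -> xz]; rewrite wsupp_mul // => /andP[]. Qed.

Lemma wsupp1 J : wsupp J (1 : W).
Proof. by have := @wsupp_word J [::]; apply; rewrite /reduced len1. Qed.

Lemma wsupp_gen J a : wsupp J (s a) = (a \in J).
Proof. by rewrite (@wsupp_word J [:: a]) /= ?andbT // /reduced len_s. Qed.

Lemma wsuppT x : wsupp [set: G]%SET x.
Proof. by apply/allP => a _; rewrite inE. Qed.

Lemma winvK x : winv (winv x) = x. Proof. exact: invgK. Qed.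

(** By induction on the length of [x], [exchange] prepends the letters of [x] one at a time below
    [w]. *)
Lemma wsupp_wle J w x : (forall a, a \in J -> wle (s a) w) -> wsupp J x -> wle x w.
Proof.
move=> Jw; have [n] := ubnP (l x); elim: n x => // n IH x ltn Jx.
have [->|x1] := eqVneq x 1; first exact: wle1x.
have [a /wleP[y xE ay]] := gen_ex x1.
move: Jx; rewrite xE wsupp_mul // wsupp_gen => /andP[aJ Jy].
apply: exchange; [exact: Jw| |by rewrite -redp_gen].
by apply: IH Jy; move: ltn; rewrite xE (eqP ay) len_s; lia.
Qed.

Definition is_lub x y e :=
  [/\ wle x e, wle y e & forall h, wle x h -> wle y h -> wle e h].

Lemma lub_shift a x y e : redp (s a) x -> redp (s a) y -> redp (s a) e ->
  is_lub x y e -> is_lub (s a * x) (s a * y) (s a * e).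
Proof.
move=> ax ay ae [xe ye elub]; split; rewrite ?wle_mul2l // => h xh yh.
have /wleP[h' hE ah'] : wle (s a) h by apply: wle_trans xh; rewrite wle_mul.
by move: xh yh; rewrite hE !wle_mul2l //; exact: elub.
Qed.

(** Induction on the bound [g]: a first letter common to both elements is cancelled. If [x] and [y]
    begin with distinct [a] and [b], let [d] be the join of these letters. The joins [e1] of [x, d]
    and [e2] of [y, d] exist by the previous case, and both begin with [a], so that they have a join
    as well. *)
Lemma lub_bounded g x y : (exists L, forall z : W, l z <= L) ->
  wle x g -> wle y g -> exists e, is_lub x y e.
Proof.
move=> [L HL]; have [n] := ubnP (l g); elim: n g x y => // n IH g x y ltn.
have shift a p q : wle (s a) p -> wle (s a) q -> wle p g -> wle q g ->
    exists e, is_lub p q e.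
  move=> ap aq pg qg; have ag := wle_trans ap pg.
  move: ap aq ag pg qg ltn.
  move=> /wleP[p' -> ap] /wleP[q' -> aq] /wleP[g' -> ag].
  rewrite !wle_mul2l // (eqP ag) len_s add1n ltnS => pg qg ltn.
  have [e lube] := IH g' p' q' ltn pg qg.
  exists (s a * e); apply: lub_shift => //.
  by apply: redp_wle ag; case: lube => _ _; apply.
move=> xg yg.
have [->|x1] := eqVneq x 1.
  by exists y; split; rewrite ?wle1x ?wle_refl.
have [->|y1] := eqVneq y 1.
  by exists x; split; rewrite ?wle1x ?wle_refl.
have [a ax] := gen_ex x1; have [b b_y] := gen_ex y1.
have [ab|ab] := eqVneq a b; first by rewrite -ab in b_y; exact: (shift a).
have [m mab] := label_finite a b HL.
set d := c_ (alternating a b m).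
have dP h : wle (s a) h -> wle (s b) h -> wle d h.
  by move=> ah bh; apply: join_alternating; rewrite ?mab.
have ag := wle_trans ax xg; have bg := wle_trans b_y yg.
have dg := dP _ ag bg.
have m2 := cox_ge2 ab mab.
have alt_ge c e : c != e -> M c e = Some m -> wle (s c) (c_ (alternating c e m)).
  move=> ce mce; have r : reduced M (alternating c e m).
    by apply: reduced_alternating; rewrite ?mce.
  move: r; rewrite -(ltn_predK m2) alternatingS pres_word_cons wle_mul.
  exact: redp_gen_word.
have ad : wle (s a) d by exact: alt_ge.
have bd : wle (s b) d.
  by rewrite /d (alternating_braid ab mab); apply: alt_ge; rewrite 1?eq_sym // cox_sym.
have [e1 [xe1 de1 lub1]] := shift a x d ax ad xg dg.
have [e2 [ye2 de2 lub2]] := shift b y d b_y bd yg dg.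
have [||||e [e1e e2e lube]] := shift a e1 e2.
- exact: wle_trans ad de1.
- exact: wle_trans ad de2.
- exact: lub1.
- exact: lub2.
exists e; split; [exact: wle_trans xe1 e1e|exact: wle_trans ye2 e2e|move=> h xh yh].
have dh : wle d h by apply: dP; [exact: wle_trans ax xh|exact: wle_trans b_y yh].
by apply: lube; [exact: lub1|exact: lub2].
Qed.

Hypothesis fin : finite_type M.

Lemma len_bounded : exists L, forall z : W, l z <= L.
Proof.
have /finite_seqP[q qE] := fin.
exists (\max_(z <- q) l z) => z.
have zq : z \in q by have : [set` q] z by rewrite -qE.
exact: (@leq_bigmax_seq _ q xpredT (fun z : W => l z) z zq isT).
Qed.

Lemma wmax (P : W -> Prop) x : P x -> exists2 y, P y & forall z, P z -> l z <= l y.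
Proof.
move=> Px; have [L HL] := len_bounded.
pose Q n := `[< exists2 y, P y & l y = n >].
have exQ : exists n, Q n by exists (l x); apply/asboolP; exists x.
have Qle n : Q n -> n <= L by move=> /asboolP[y _ <-].
case: (ex_maxnP exQ Qle) => n /asboolP[y Py <-] ymax; exists y => // z Pz.
by apply: ymax; apply/asboolP; exists z.
Qed.

(** The longest element of the parabolic subgroup; its lift to the Artin monoid is the element
    [Delta_J] of the statement. *)
Definition wJ J : W :=
  xget 1 [set w | wsupp J w /\ forall z, wsupp J z -> l z <= l w].

Lemma wJP J : wsupp J (wJ J) /\ forall z, wsupp J z -> l z <= l (wJ J).
Proof.
rewrite /wJ; case: xgetP => [w _ //|none].
by have [w Jw wmax'] := @wmax (fun z => wsupp J z) _ (wsupp1 J); case: (none w).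
Qed.

Lemma wJ_gen J a : a \in J -> wle (s a) (wJ J).
Proof.
move=> aJ; have [Jw wm] := wJP J; rewrite -[wle _ _]negbK -redp_gen.
apply/negP => aw; have := wm (s a * wJ J).
by rewrite wsupp_mul // wsupp_gen aJ Jw (eqP aw) len_s ltnn => /(_ isT).
Qed.

Lemma wle_wJ J x : wsupp J x -> wle x (wJ J).
Proof. by apply: wsupp_wle => a; exact: wJ_gen. Qed.

Lemma wJ_le J w : (forall a, a \in J -> wle (s a) w) -> wle (wJ J) w.
Proof. by move=> Jw; apply: wsupp_wle Jw _; have [] := wJP J. Qed.

Local Notation w0 := (wJ [set: G]%SET).

Lemma wle_w0 x : wle x w0. Proof. exact: wle_wJ (wsuppT x). Qed.

Lemma lub_exists x y : exists e, is_lub x y e.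
Proof. exact: lub_bounded len_bounded (wle_w0 x) (wle_w0 y). Qed.

(** The elements that extend [x] without loss of length have a greatest one, [winv x * w0]; in
    particular they are closed under joins. *)
Lemma redp_w0 x t : redp x t = wle t (winv x * w0).
Proof.
have /wleP[r w0E xr] := wle_w0 x.
rewrite w0E wmulKg; apply/idP/idP => [xt|tr]; last exact: redp_wle tr xr.
have /wleP[q E rq] := wle_w0 (x * t).
have {}E : r = t * q by apply: (@wmulI _ _ x); rewrite -w0E E wmulA.
by have [_ tq] := redpAr rq xt; rewrite E wle_mul.
Qed.

Definition wrem x y : W :=
  xget 1 [set z | [/\ wle z y, redp x z &
                     forall t, wle t y -> redp x t -> wle t z]].

(** A longest candidate absorbs any other one, since the join of the two is again a candidate. *)
Lemma wremP x y : [/\ wle (wrem x y) y, redp x (wrem x y) &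
  forall t, wle t y -> redp x t -> wle t (wrem x y)].
Proof.
rewrite /wrem; case: xgetP => [w _ //|none].
have [z [zy xz] zmax] : exists2 z, wle z y /\ redp x z &
    forall t, wle t y /\ redp x t -> l t <= l z.
  by apply: (@wmax _ 1); rewrite wle1x redp1.
case: (none z); split => // t ty xt.
have [e [ze te lube]] := lub_exists z t.
have ey : wle e y by exact: lube.
have xe : redp x e by rewrite redp_w0; apply: lube; rewrite -redp_w0.
by rewrite (wle_len_eq ze (zmax e (conj ey xe))).
Qed.

Lemma wrem_uniq x y z : wle z y -> redp x z ->
  (forall t, wle t y -> redp x t -> wle t z) -> wrem x y = z.
Proof.
by move=> zy xz zmax; have [ry xr rmax] := wremP x y; apply: wle_anti; auto.
Qed.

(* [star x y] is the greatest element below the (in the Artin monoid,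
   possibly non reduced) product of [x] and [y]. *)
Definition star x y : W := x * wrem x y.

Lemma wle_star x y : wle x (star x y).
Proof. by rewrite wle_mul; have [] := wremP x y. Qed.

Lemma star_redp x y : redp x y -> star x y = x * y.
Proof. by move=> xy; rewrite /star (@wrem_uniq _ _ y) // wle_refl. Qed.

Lemma star1 x : star x 1 = x.
Proof. by rewrite star_redp ?redp1 // wmulg1. Qed.

Lemma star1l x : star 1 x = x.
Proof. by rewrite star_redp ?redp1l // wmul1g. Qed.

(** As [x * y] is reduced, the remainder of [y * p] after [x] begins with [y]; what follows [y] in
    it is the remainder of [z] after [x * y]. *)
Lemma starA x y z : redp x y -> star (x * y) z = star x (star y z).
Proof.
move=> xy; rewrite /star.
have [pz yp pmax] := wremP y z; set p := wrem y z in pz yp pmax *.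
have [qle xq qmax] := wremP x (y * p); set q := wrem x (y * p) in qle xq qmax *.
have /wleP[q' qE yq'] : wle y q by apply: qmax => //; rewrite wle_mul.
move: qle; rewrite qE wle_mul2l // => q'p.
rewrite wmulA; congr (_ * _); apply: wrem_uniq.
- exact: wle_trans q'p pz.
- by rewrite qE in xq; have [] := redpA xq yq'.
move=> t tz xyt; have [xyt' yt] := redpAr xyt xy.
have tp := pmax t tz yt.
by have := qmax (y * t); rewrite qE !wle_mul2l //; apply.
Qed.

Lemma star_word u y : reduced M u -> foldr (fun a => star (s a)) y u = star (c_ u) y.
Proof.
elim: u => [|a u IH] ru; first by rewrite star1l.
by rewrite /= IH ?(reduced_cons ru) // pres_word_cons starA // redp_gen_word.
Qed.

End FiniteWeakOrder.

(** * Artin monoids of finite type *)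

Section ArtinMonoid.
Local Open Scope nat_scope.
Local Open Scope group_scope.
Variables (G : finType) (M : coxeterMatrix G).

Local Notation W := (presMonoid (cox_rel M)).
Local Notation c_ := (pres_word (cox_rel M)).
Local Notation s := (pres_gen (cox_rel M)).
Local Notation l := (len s).
Local Notation A := (presMonoid (braid_rel M)).
Local Notation a_ := (pres_word (braid_rel M)).
Local Notation r := (pres_gen (braid_rel M)).
Local Notation L := (len r).
Implicit Types (a b : G) (u v : seq G) (w : W) (x y z g h d e : A) (J : {set G}).

Lemma amulA x y z : x * (y * z) = x * y * z. Proof. exact: mulgA. Qed.
Lemma amulg1 x : x * 1 = x. Proof. exact: mulg1. Qed.
Lemma amul1g x : 1 * x = x. Proof. exact: mul1g. Qed.

Lemma braid_eq_size u v : pres_eq (braid_rel M) u v -> size u = size v.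
Proof.
elim=> {u v} //; first by move=> u v [a [b [n [ab mab -> ->]]]]; rewrite !size_mkseq.
- by move=> u v w _ -> _ ->.
by move=> u u' v v' _ H1 _ H2; rewrite !size_cat H1 H2.
Qed.

Lemma len_a u : L (a_ u) = size u.
Proof.
by have [v <- uv] := len_wordP (a_ u); apply/esym/braid_eq_size/pres_wordP.
Qed.

Lemma len_aM x y : L (x * y : A) = L x + L y.
Proof.
by rewrite -[x]pres_wordK -[y]pres_wordK -pres_word_cat !len_a size_cat.
Qed.

Lemma len_r a : L (r a) = 1%N. Proof. exact: (len_a [:: a]). Qed.

Lemma len_a1 : L 1 = 0%N. Proof. exact: (len_a [::]). Qed.

Lemma artin_ind (P : A -> Prop) :
  P 1 -> (forall a x, P x -> P (r a * x)) -> forall x, P x.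
Proof.
move=> P1 Pr x; rewrite -[x]pres_wordK; elim: (repr x) => [//|a u IH].
by rewrite pres_word_cons; exact: Pr.
Qed.

Definition gsupp J x := all (mem J) (repr x).

Lemma gsupp_word J u : gsupp J (a_ u) = all (mem J) u.
Proof.
by apply: eq_all_r; apply: (@braid_eq_mem _ M); apply/pres_wordP; rewrite pres_wordK.
Qed.

Lemma gsupp_mul J x y : gsupp J (x * y) = gsupp J x && gsupp J y.
Proof.
by rewrite -[x]pres_wordK -[y]pres_wordK -pres_word_cat !gsupp_word all_cat.
Qed.

Lemma gsupp_gen J a : gsupp J (r a) = (a \in J).
Proof. by rewrite (gsupp_word J [:: a]) /= andbT. Qed.

Lemma gsupp1 J : gsupp J 1. Proof. by rewrite (gsupp_word J [::]). Qed.

Lemma gsuppT x : gsupp [set: G]%SET x.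
Proof. by apply/allP => a _; rewrite inE. Qed.

(** The lift of a Coxeter element along any of its reduced words; its values are the simple elements
    of the monoid. *)
Definition sigma w : A := a_ (rword w).

Lemma sigma_word u : reduced M u -> sigma (c_ u) = a_ u.
Proof.
move=> ru; apply/pres_wordP/reduced_braid => //; first exact: reduced_rword.
by rewrite rwordK.
Qed.

Lemma sigmaM w1 w2 : redp w1 w2 -> sigma (w1 * w2) = sigma w1 * sigma w2.
Proof.
move=> w12; rewrite -pres_word_cat -{1}[w1]rwordK -{1}[w2]rwordK -pres_word_cat.
by apply: sigma_word; apply: reduced_cat; rewrite ?reduced_rword ?rwordK.
Qed.

Lemma sigma_gen a : sigma (s a) = r a.
Proof. by apply: (@sigma_word [:: a]); rewrite /reduced len_s. Qed.

Lemma sigma1 : sigma 1 = 1.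
Proof. by apply: (@sigma_word [::]); rewrite /reduced len1. Qed.

Lemma len_sigma w : L (sigma w) = l w.
Proof. by rewrite len_a size_rword. Qed.

Lemma gsupp_sigma J w : gsupp J (sigma w) = wsupp J w.
Proof. by rewrite /sigma gsupp_word. Qed.

Lemma braid_eq_rev u v : pres_eq (braid_rel M) u v ->
  pres_eq (braid_rel M) (rev u) (rev v).
Proof.
elim=> {u v}.
- move=> u v [a [b [n [ab mab -> ->]]]]; rewrite !rev_alternating.
  case: (odd n); apply: pres_rel; first by exists a, b, n.
  by exists b, a, n; split => //; rewrite 1?eq_sym // cox_sym.
- by move=> u; exact: pres_refl.
- by move=> u v _; exact: pres_sym.
- by move=> u v t _ uv _; exact: pres_trans.
by move=> u u' v v' _ H1 _ H2; rewrite !rev_cat; exact: pres_cat.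
Qed.

(** The anti-automorphism that reverses words; it turns left-handed statements into right-handed
    ones. *)
Definition grev x : A := a_ (rev (repr x)).

Lemma grev_word u : grev (a_ u) = a_ (rev u).
Proof.
by apply/pres_wordP/braid_eq_rev/pres_wordP; rewrite pres_wordK.
Qed.

Lemma grevK : involutive grev.
Proof. by move=> x; rewrite -[x]pres_wordK !grev_word revK. Qed.

Lemma grevM x y : grev (x * y) = grev y * grev x.
Proof.
by rewrite -[x]pres_wordK -[y]pres_wordK -pres_word_cat !grev_word rev_cat pres_word_cat.
Qed.

Hypothesis fin : finite_type M.

Local Notation star := (@star G M).
Local Notation sw := (foldr (fun a => star (s a))).

(** Both sides of a braid relation are reduced words of one element, and along a reduced word the
    iterated [star] depends on this element only. *)
Lemma star_braid u v : pres_eq (braid_rel M) u v -> forall w, sw w u = sw w v.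
Proof.
elim=> {u v} //.
- move=> u v [a [b [n [ab mab -> ->]]]] w.
  rewrite !(star_word fin) ?(alternating_braid ab mab) //.
    by apply: reduced_alternating; rewrite 1?eq_sym // cox_sym mab.
  by apply: reduced_alternating; rewrite // mab.
- by move=> u v t _ H1 _ H2 w; rewrite H1.
by move=> u u' v v' _ H1 _ H2 w; rewrite !foldr_cat H2 H1.
Qed.

(* The greatest simple left divisor. *)
Definition alpha x : W := sw 1 (repr x).

Lemma alpha_word u : alpha (a_ u) = sw 1 u.
Proof. by apply: star_braid; apply/pres_wordP; rewrite pres_wordK. Qed.

Lemma alpha1 : alpha 1 = 1. Proof. exact: (alpha_word [::]). Qed.

Lemma alpha_wordM u x : alpha (a_ u * x) = sw (alpha x) u.
Proof. by rewrite -[x]pres_wordK -pres_word_cat !alpha_word foldr_cat. Qed.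

Lemma alpha_gen a x : alpha (r a * x) = star (s a) (alpha x).
Proof. exact: (alpha_wordM [:: a]). Qed.

Lemma alpha_sigmaM w x : alpha (sigma w * x) = star w (alpha x).
Proof. by rewrite alpha_wordM star_word ?reduced_rword // rwordK. Qed.

Lemma alpha_sigma w : alpha (sigma w) = w.
Proof. by rewrite -[sigma w]amulg1 alpha_sigmaM alpha1 star1. Qed.

Lemma sigma_alpha x : exists x', x = sigma (alpha x) * x'.
Proof.
elim/artin_ind: x => [|a x [x' IH]]; first by exists 1; rewrite alpha1 sigma1 amulg1.
rewrite alpha_gen /star; have [zx az _] := wremP fin (s a) (alpha x).
move: zx => /wleP[t tE zt].
exists (sigma t * x'); rewrite sigmaM // sigma_gen -amulA; congr (_ * _).
by rewrite {1}IH tE sigmaM // -!amulA -tE.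
Qed.

Lemma sigma_below w x : wle w (alpha x) -> exists x', x = sigma w * x'.
Proof.
move=> /wleP[t tE wt]; have [x' ->] := sigma_alpha x.
by exists (sigma t * x'); rewrite tE sigmaM // amulA.
Qed.

(** This precedes cancellation, whose proof rests on it. *)
Lemma left_divides_sigma w x : left_divides (sigma w) x <-> wle w (alpha x).
Proof.
split=> [[h ->]|]; last exact: sigma_below.
by rewrite alpha_sigmaM wle_star.
Qed.

Lemma left_divides_gen a x : left_divides (r a) x <-> wle (s a) (alpha x).
Proof. by rewrite -sigma_gen left_divides_sigma. Qed.

Lemma rem_ex a x : exists y, x = sigma (s a * alpha (r a * x)) * y.
Proof.
apply: sigma_below; rewrite alpha_gen /star gen_mulKg.
by have [] := wremP fin (s a) (alpha x).
Qed.

Lemma wle_alpha_gen a x : wle (s a) (alpha (r a * x)).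
Proof. by apply/left_divides_gen; exists x. Qed.

Lemma redp_desc a w : wle (s a) w -> redp (s a) (s a * w).
Proof. by move=> aw; rewrite redp_gen wle_gen gen_mulKg -leqNgt ltnW // -wle_gen. Qed.

Lemma sigma_desc a w : wle (s a) w -> r a * sigma (s a * w) = sigma w.
Proof.
by move=> aw; rewrite -sigma_gen -sigmaM ?gen_mulKg // redp_desc.
Qed.

(* If [a x = b y] and [alpha (a x) = a z = b z'], then the cofactors of [z] in
   [x] and of [z'] in [y] agree: this is preserved by every elementary step. *)
Lemma braid_eq_cofactor n :
  (forall g y z, L (g * y : A) < n -> g * y = g * z -> y = z) ->
  forall u v, pres_eq (braid_rel M) u v -> size u <= n ->
  forall a u' b v', u = a :: u' -> v = b :: v' ->
  exists2 t, a_ u' = sigma (s a * alpha (a_ u)) * t &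
             a_ v' = sigma (s b * alpha (a_ v)) * t.
Proof.
move=> can u v H; elim: H => {u v}.
- move=> u v [a [b [m [ab mab uE vE]]]] _ a' u' b' v'.
  have step (c d t : G) (p : seq G) : c != d -> M c d = Some m ->
      alternating c d m = t :: p -> a_ p = sigma (s t * alpha (a_ (t :: p))) * 1.
    move=> cd mcd E; have red : reduced M (t :: p).
      by rewrite -E; apply: reduced_alternating; rewrite ?mcd.
    rewrite amulg1 alpha_word (star_word fin) // (star1 fin) pres_word_cons gen_mulKg.
    by rewrite sigma_word // (reduced_cons red).
  move=> uE' vE'; exists 1; rewrite ?uE' ?vE'.
    by apply: (step a b); rewrite // -uE.
  by apply: (step b a); rewrite 1?eq_sym // 1?cox_sym // -vE.
- move=> u _ a u' b v' -> [<- <-]; have [t tE] := rem_ex a (a_ u').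
  by exists t; rewrite pres_word_cons.
- move=> u v uv IH szv a v' b u' vE uE.
  by have [|t] := IH _ b u' a v' uE vE; [rewrite (braid_eq_size uv)|exists t].
- move=> u v w uv IH1 vw IH2 szu a u' b w' uE wE.
  have := braid_eq_size uv; case: v => [|c v'] in uv vw IH1 IH2 *; rewrite {1}uE // => -[suv].
  have [t1 E1 E2] := IH1 szu a u' c v' uE erefl.
  have [|t2 E3 E4] := IH2 _ c v' b w' erefl wE.
    by rewrite -(braid_eq_size uv).
  (* Both steps factor the same [a_ v']; cancellation in smaller length identifies their
     cofactors. *)
  exists t1 => //; rewrite E4; congr (_ * _); apply/esym.
  apply: (can (sigma (s c * alpha (a_ (c :: v'))))); last by rewrite -E2.
  by rewrite -E2 len_a -suv; move: szu; rewrite uE.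
move=> u u' v v' uu' IH1 vv' IH2; rewrite size_cat => szuv a p b q.
case: u => [|c u1] in uu' IH1 szuv *.
  have := braid_eq_size uu'; case: u' => // in uu' IH1 * => _ /= vE v'E.
  exact: IH2.
case: u' => [|d u1'] in uu' IH1 *; first by have := braid_eq_size uu'.
move=> [ca <-] [db <-].
have [|t E1 E2] := IH1 _ c u1 d u1' erefl erefl.
  by apply: leq_trans szuv; rewrite leq_addr.
have auu' : a_ (c :: u1) = a_ (d :: u1') by apply/pres_wordP.
have avv' : a_ v = a_ v' by apply/pres_wordP.
rewrite -auu' in E2; set B := alpha (a_ (c :: u1)) in E1 E2.
have cB : wle (s c) B by rewrite /B pres_word_cons wle_alpha_gen.
have dB : wle (s d) B by rewrite /B auu' pres_word_cons wle_alpha_gen.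
have uE : a_ (c :: u1) = sigma B * t.
  by rewrite pres_word_cons E1 amulA sigma_desc.
(* In a longer word the greatest simple divisor grows from [B] to [B * y], and [sigma y] is removed
   from the left of [t * a_ v], which is the same for both words. *)
have [yle By _] := wremP fin B (alpha (t * a_ v)).
set y := wrem B _ in yle By.
have [t' tE] := sigma_below yle.
have alE : alpha (a_ ((c :: u1) ++ v)) = B * y.
  by rewrite pres_word_cat uE -amulA alpha_sigmaM.
have alE' : alpha (a_ ((d :: u1') ++ v')) = B * y.
  by rewrite pres_word_cat -auu' -avv' -pres_word_cat.
have fin_ f p1 : wle (s f) B -> a_ p1 = sigma (s f * B) * t ->
    a_ (p1 ++ v) = sigma (s f * (B * y)) * t'.
  move=> fB pE; rewrite pres_word_cat pE -amulA tE amulA; congr (_ * _).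
  rewrite wmulA [in RHS]sigmaM //.
  by have := redp_desc fB; rewrite -{1}(gen_mulKg f B) in By;
    move=> fB'; have [] := redpAr By fB'.
exists t'; first by rewrite -ca alE; apply: fin_.
rewrite -db alE' pres_word_cat -avv' -pres_word_cat; exact: fin_.
Qed.

(** By induction on the length: applied to [r a * x = r a * x'], the cofactor lemma writes [x] and
    [x'] as one and the same product. *)
Lemma artin_mulI g y z : g * y = g * z -> y = z.
Proof.
have [n] := ubnP (L (g * y : A)); elim: n g y z => // n IH g y z.
elim/artin_ind: g => [|a g IHg]; first by rewrite !amul1g.
rewrite -!amulA len_aM len_r add1n ltnS => ltn E.
apply: IHg; first exact: ltnW.
move: E ltn; move: (g * y) (g * z) => x x' E ltn.
have /pres_wordP xx' : a_ (a :: repr x) = a_ (a :: repr x').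
  by rewrite !pres_word_cons !pres_wordK.
have [|t E1 E2] := braid_eq_cofactor IH xx' _ erefl erefl.
  by rewrite /= -len_a pres_wordK.
move: E1 E2; rewrite !pres_wordK !pres_word_cons !pres_wordK -E => E1 E2.
by rewrite E1.
Qed.

Lemma artin_Imul g y z : y * g = z * g -> y = z.
Proof.
move=> E; apply: (inv_inj grevK); apply: (@artin_mulI (grev g)).
by rewrite -!grevM E.
Qed.

End ArtinMonoid.

(** * Greatest common divisors, common multiples and parabolic factors *)

Section ArtinDivisibility.
Local Open Scope nat_scope.
Local Open Scope group_scope.
Variables (G : finType) (M : coxeterMatrix G).
Hypothesis fin : finite_type M.

Local Notation W := (presMonoid (cox_rel M)).
Local Notation s := (pres_gen (cox_rel M)).
Local Notation l := (len s).
Local Notation A := (presMonoid (braid_rel M)).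
Local Notation a_ := (pres_word (braid_rel M)).
Local Notation r := (pres_gen (braid_rel M)).
Local Notation L := (len r).
Implicit Types (a b : G) (u v : seq G) (w : W) (x y z g h d e : A) (J : {set G}).

Lemma left_divides_len d x : left_divides d x -> L d <= L x.
Proof. by move=> [h ->]; rewrite len_aM leq_addr. Qed.

Lemma left_divides_anti d e : left_divides d e -> left_divides e d -> d = e.
Proof.
move=> [h ->] /left_divides_len; rewrite len_aM -{2}[L d]addn0 leq_add2l leqn0.
by move=> /eqP/len0->; rewrite amulg1.
Qed.

Lemma left_divides_refl d : left_divides d d.
Proof. by exists 1; rewrite amulg1. Qed.

Lemma left_divides_trans e d x : left_divides d e -> left_divides e x -> left_divides d x.
Proof. by move=> [h ->] [k ->]; exists (h * k); rewrite amulA. Qed.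

Lemma left_divides_mul2l g d x : left_divides (g * d) (g * x) <-> left_divides d x.
Proof.
split=> [[h]|[h ->]]; last by exists h; rewrite amulA.
by rewrite -amulA => /(artin_mulI fin) ->; exists h.
Qed.

Lemma wsupp_alpha J x : gsupp J x -> wsupp J (alpha x).
Proof.
by have [x' E] := sigma_alpha fin x; rewrite {1}E gsupp_mul gsupp_sigma => /andP[].
Qed.

Lemma gen_complement J w b : wsupp J w -> b \in J ->
  exists2 w', wsupp J w' & forall y,
    wle w (star (s b) (alpha y)) <-> wle w' (alpha y).
Proof.
move=> Jw bJ; have [e [be we lube]] := lub_exists fin (s b) w.
have eJ : wle e (wJ M J).
  by apply: lube; [exact: wJ_gen|exact: wle_wJ].
have /wleP[w' eE bw'] := be.
have Je : wsupp J e by apply: wsupp_le eJ _; have [] := wJP fin J.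
exists w'; first by move: Je; rewrite eE wsupp_mul // => /andP[].
move=> y; rewrite /star; have [zy bz zmax] := wremP fin (s b) (alpha y).
set z := wrem _ _ in zy bz zmax *.
split=> [wz|w'y].
  apply: wle_trans zy; rewrite -(wle_mul2l bw' bz) -eE.
  by apply: lube => //; rewrite wle_mul.
by apply: wle_trans we _; rewrite eE wle_mul2l //; exact: zmax.
Qed.

Lemma complement J w d : wsupp J w -> gsupp J d ->
  exists2 w', wsupp J w' & forall y,
    left_divides (sigma w) (d * y) <-> left_divides (sigma w') y.
Proof.
elim/artin_ind: d w => [|b d IH] w Jw; first by exists w => // y; rewrite amul1g.
rewrite gsupp_mul gsupp_gen => /andP[bJ Jd].
have [w1 Jw1 H1] := gen_complement Jw bJ.
have [w' Jw' H2] := IH w1 Jw1 Jd; exists w' => // y.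
by rewrite -H2 -amulA !left_divides_sigma // alpha_gen.
Qed.

(** Induction on [e]. The complement, after [d], of the first letter [a] of [e] divides every [y];
    since no letter of [J] does, it is trivial. So [a] divides [d] itself and can be cancelled. The
    lemma serves both gcds and parabolic factors. *)
Lemma left_divides_family J (Y : A -> Prop) d e : gsupp J d -> gsupp J e ->
  (forall a, a \in J -> ~ forall y, Y y -> left_divides (r a) y) ->
  (forall y, Y y -> left_divides e (d * y)) -> left_divides e d.
Proof.
move=> Jd Je HY; elim/artin_ind: e d Jd Je => [|a e IH] d Jd.
  by move=> _ _; exists d; rewrite amul1g.
rewrite gsupp_mul gsupp_gen => /andP[aJ Je] He.
have [|w' Jw' Hw'] := @complement J (s a) d _ Jd; first by rewrite wsupp_gen.
have w'Y y : Y y -> left_divides (sigma w') y.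
  by move=> /He ady; apply/Hw'; rewrite sigma_gen; apply: left_divides_trans ady; exists e.
have [w'1|w'1] := eqVneq w' 1; last first.
  have [b bw'] := gen_ex w'1; case: (HY b) => [|y Yy].
    by have := wsupp_le bw' Jw'; rewrite wsupp_gen.
  by apply: left_divides_trans (w'Y y Yy); apply/left_divides_gen; rewrite ?alpha_sigma.
have : left_divides (sigma w') 1 by rewrite w'1 sigma1; exact: left_divides_refl.
rewrite -Hw' amulg1 sigma_gen => -[d' dE].
move: Jd He; rewrite dE gsupp_mul => /andP[_ Jd'] He.
apply/left_divides_mul2l; apply: IH => // y Yy.
by have := He y Yy; rewrite -amulA left_divides_mul2l.
Qed.

(** For a longest common divisor [d] the quotients by [d] have no common first letter, so that the
    previous lemma applies to them. *)
Lemma left_gcd_exists (Y : A -> Prop) : (exists y, Y y) ->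
  exists2 d, (forall y, Y y -> left_divides d y) &
    forall e, (forall y, Y y -> left_divides e y) -> left_divides e d.
Proof.
move=> [y0 Yy0].
pose Q n := `[< exists2 d, (forall y, Y y -> left_divides d y) & L d = n >].
have exQ : exists n, Q n.
  exists 0%N; apply/asboolP; exists 1; rewrite ?len1 // => y _.
  by exists y; rewrite amul1g.
have Qle n : Q n -> n <= L y0.
  by move=> /asboolP[d dY <-]; exact/left_divides_len/dY.
case: (ex_maxnP exQ Qle) => n /asboolP[d dY <-] dmax; exists d => // e eY.
apply: (@left_divides_family [set: G]%SET (fun y => Y (d * y))); rewrite ?gsuppT //.
- move=> a _ aY; have : L (d * r a : A) <= L d.
    apply: dmax; apply/asboolP; exists (d * r a) => // y Yy.
    have [z yE] := dY y Yy.
    by rewrite yE left_divides_mul2l; apply: aY; rewrite -yE.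
  by rewrite len_aM len_r addn1 ltnn.
- by move=> y; exact: eY.
Qed.

(** Multiplied by the complement of its first letter [a], [d] becomes [r a * d']; the rest of [x] is
    then treated with [d']. *)
Lemma right_common_multiple x d : exists p q, x * p = d * q.
Proof.
elim/artin_ind: x d => [|a x IH] d; first by exists d, 1; rewrite amul1g amulg1.
have [||w' _ Hw'] := @complement [set: G]%SET (s a) d; rewrite ?wsuppT ?gsuppT //.
have : left_divides (r a) (d * sigma w').
  by rewrite -sigma_gen Hw'; exact: left_divides_refl.
move=> [d' dE]; have [p [q E]] := IH d'; exists p, (sigma w' * q).
by rewrite [RHS]amulA dE -!amulA E.
Qed.

Lemma left_common_multiple x d : exists p q, p * x = q * d.
Proof.
have [p [q E]] := right_common_multiple (grev x) (grev d).
by exists (grev p), (grev q); rewrite -[x]grevK -[d]grevK -!grevM E.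
Qed.

Definition indivisible J g := forall a, a \in J -> ~ left_divides (r a) g.

Lemma parabolic_factor J g :
  exists h k, [/\ g = h * k, gsupp J h & indivisible J k].
Proof.
have [n] := ubnP (L g); elim: n g => // n IH g ltn.
have [[a aJ [g' gE]]|none] := pselect (exists2 a, a \in J & left_divides (r a) g).
  move: ltn; rewrite gE len_aM len_r add1n ltnS => /IH[h [k [-> Jh Jk]]].
  by exists (r a * h), k; rewrite gsupp_mul gsupp_gen aJ amulA.
exists 1, g; rewrite amul1g gsupp1; split => // a aJ ag.
by apply: none; exists a.
Qed.

(** So [h] is the greatest left divisor of [h * k] with letters in [J], which gives uniqueness of
    the factorization. *)
Lemma parabolic_divides J h k e : gsupp J h -> gsupp J e -> indivisible J k ->
  left_divides e (h * k) -> left_divides e h.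
Proof.
move=> Jh Je Jk ehk; apply: (@left_divides_family J (eq k)) => // [a aJ H|y <-] //.
by apply: (Jk a aJ); exact: H.
Qed.

Lemma parabolic_uniq J h k h' k' : gsupp J h -> gsupp J h' ->
  indivisible J k -> indivisible J k' -> h * k = h' * k' -> h = h' /\ k = k'.
Proof.
move=> Jh Jh' Jk Jk' E.
have hh' : h = h'.
  apply: left_divides_anti.
    by apply: (parabolic_divides Jh' Jh Jk'); exists k.
  by apply: (parabolic_divides Jh Jh' Jk); exists k'.
by split => //; apply: (artin_mulI fin (g := h)); rewrite E hh'.
Qed.

(** The local condition for left normal forms: a first letter of [g] that is not a right descent of
    [w] could be absorbed into the simple factor. *)
Lemma alpha_sigma_mul w g :
  alpha (sigma w * g) = w <->
  forall a, left_divides (r a) g -> l (w * s a : W) < l w.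
Proof.
rewrite alpha_sigmaM // /star; have [zg wz zmax] := wremP fin w (alpha g).
split=> [E a|H].
  rewrite left_divides_gen // => ag; rewrite ltnNge; apply/negP => le.
  have wa : redp w (s a).
    rewrite /redp len_s; have := len_gen a (winv w).
    have -> : s a * winv w = winv (w * s a) by rewrite winvM winv_gen.
    have lV t : l (winv t) = l t by exact: lenV.
    by rewrite !lV => -[->|H]; [rewrite addn1|move: le; rewrite H ltnn].
  have := zmax _ ag wa.
  have -> : wrem w (alpha g) = 1.
    by apply: (@wmulI _ _ w); rewrite E wmulg1.
  by move=> /wle1/eqP; rewrite (negbTE (gen_neq1 _ _)).
have [->|z1] := eqVneq (wrem w (alpha g)) 1; first by rewrite wmulg1.
have [a az] := gen_ex z1.
have /H : left_divides (r a) g by apply/left_divides_gen => //; apply: wle_trans zg.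
by rewrite ltnNge (eqP (redp_wle az wz)) leq_addr.
Qed.

End ArtinDivisibility.

(** * Ratios of solutions of nonnegative recurrences *)

Section RatioLimit.
Variables (R : realType) (S : finType) (x : S -> nat -> R).
Variables (E : S -> seq (S * nat)) (D : nat) (K : R) (a : S).

Let edge : rel S := fun I I' => has (fun e => e.1 == I') (E I).
Let reach I := connect edge a I.

Hypotheses
  (x_rec : forall I n, reach I -> (D <= n)%N ->
     x I n = \sum_(e <- E I) x e.1 (n - e.2)%N)
  (E_delay : forall I (e : S * nat), e \in E I -> (0 < e.2 <= D)%N)
  (x_gt0 : forall I n, reach I -> 0 < x I n)
  (x_growth : forall I n, reach I -> x I n.+1 <= K * x I n)
  (E_loop : (a, 1%N) \in E a)
  (E_back : forall I, reach I -> connect edge I a).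

Let rho I n := x I n.+1 / x I n.

Lemma reach_edge I (e : S * nat) : reach I -> e \in E I -> reach e.1.
Proof.
move=> aI eE; apply: connect_trans aI (connect1 _).
by apply/hasP; exists e.
Qed.

Lemma recurrence_K_gt0 : 0 < K.
Proof.
have a0 : reach a by exact: connect0.
have := lt_le_trans (x_gt0 1 a0) (x_growth 0 a0).
by rewrite pmulr_lgt0 // x_gt0.
Qed.

Lemma recurrence_edge_le I (e : S * nat) n : reach I -> e \in E I -> (D <= n)%N ->
  x e.1 (n - e.2)%N <= x I n.
Proof.
move=> rI eE Dn; rewrite (x_rec rI Dn) (big_rem e) //= lerDl.
rewrite big_seq; apply: sumr_ge0 => f /mem_rem fE.
by apply/ltW/x_gt0/(reach_edge rI fE).
Qed.

Lemma recurrence_path_le I I' : reach I -> connect edge I I' ->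
  exists T, forall n, (D + T <= n)%N -> x I' (n - T)%N <= x I n.
Proof.
move=> rI /connectP[p]; elim: p I rI => [|J p IH] I rI /=.
  by move=> _ ->; exists 0%N => n _; rewrite subn0.
move=> /andP[/hasP[e eE /eqP eJ] pth] lst.
have rJ : reach J by rewrite -eJ; exact: reach_edge eE.
have [T HT] := IH J rJ pth lst; exists (T + e.2)%N => n Hn.
have /andP[e0 eD] := E_delay eE.
apply: le_trans (recurrence_edge_le rI eE _); last by lia.
by rewrite eJ addnC subnDA; apply: HT; lia.
Qed.

Lemma recurrence_growth I n t : reach I -> x I (n + t)%N <= K ^+ t * x I n.
Proof.
move=> rI; elim: t => [|t IH]; first by rewrite addn0 mul1r.
rewrite addnS exprS -mulrA; apply: le_trans (x_growth _ rI) _.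
by rewrite ler_pM2l // recurrence_K_gt0.
Qed.

(** A Harnack inequality: a path from [e.1] back to [I] bounds an earlier value at [I] by the term
    of [e], and [x_growth] pays for the shift. So each term of the recurrence is at least a fixed
    share of the whole. *)
Lemma recurrence_edge_weight I (e : S * nat) : reach I -> e \in E I ->
  exists d N, 0 < d /\ forall n, (N <= n)%N -> d * x I n <= x e.1 (n - e.2)%N.
Proof.
move=> rI eE; have re := reach_edge rI eE.
have [T HT] := recurrence_path_le re (connect_trans (E_back re) rI).
have K0 := recurrence_K_gt0.
exists (K ^+ (T + e.2))^-1, (D + T + e.2)%N; rewrite invr_gt0 exprn_gt0 //.
split=> // n Hn; rewrite ler_pdivrMl ?exprn_gt0 //.
have -> : n = ((n - e.2 - T) + (T + e.2))%N by lia.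
apply: le_trans (recurrence_growth _ _ rI) _.
rewrite ler_pM2l ?exprn_gt0 //.
have -> : (n - e.2 - T + (T + e.2) - e.2 = n - e.2)%N by lia.
by apply: HT; lia.
Qed.

(* The two signs [g = 1] and [g = -1] give the upper and the lower bound. *)
Definition contracts I t d N := forall n g u, (N <= n)%N ->
  (forall J k, reach J -> (n <= k + D)%N -> g * rho J k <= u) ->
  g * rho I (n + t)%N <= u - d * (u - g * rho a n).

(** Thus [rho I m] is a weighted mean of earlier ratios, the weights being the shares of the terms
    in the recurrence. *)
Lemma rho_avg I m g : reach I -> (D <= m)%N ->
  g * rho I m * x I m = \sum_(e <- E I) x e.1 (m - e.2)%N * (g * rho e.1 (m - e.2)%N).
Proof.
move=> rI Dm; rewrite /rho -!mulrA mulVf ?gt_eqF ?x_gt0 // mulr1.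
rewrite x_rec // 1?leqW // mulr_sumr; apply: eq_big_seq => e eE.
have := E_delay eE => /andP[e0 eD].
rewrite subSn ?(leq_trans eD) // [RHS]mulrC -!mulrA mulVf ?mulr1 //.
by rewrite gt_eqF // x_gt0 // (reach_edge rI).
Qed.

(** In the mean no ratio exceeds [u], and the one of [e] has weight at least [w]; so the fraction
    [w] of its gain is inherited. *)
Lemma contracts_step I (e : S * nat) t d N : reach I -> e \in E I -> 0 < d ->
  contracts e.1 t d N ->
  exists d' N', 0 < d' /\ contracts I (t + e.2) d' N'.
Proof.
move=> rI eE d0 C; have [w [N1 [w0 Hw]]] := recurrence_edge_weight rI eE.
exists (d * w), (maxn N (maxn N1 D)); split; first by rewrite mulr_gt0.
move=> n g u; rewrite !geq_max => /and3P[Nn N1n Dn] Hu.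
have ra : reach a by exact: connect0.
set m := (n + (t + e.2))%N.
have Dm : (D <= m)%N by rewrite /m; clear -Dn; lia.
have xm : 0 < x I m by exact: x_gt0.
rewrite -(ler_pM2r xm) rho_avg //.
have -> : (u - d * w * (u - g * rho a n)) * x I m =
          u * x I m - (d * (u - g * rho a n)) * (w * x I m) by ring.
rewrite {1}(x_rec rI Dm) mulr_sumr.
rewrite lerBrDr -lerBrDl -sumrB (big_rem e) //=.
have ua : 0 <= u - g * rho a n by rewrite subr_ge0; apply: Hu => //; clear; lia.
have := Hw m; have -> : (m - e.2 = n + t)%N by rewrite /m; clear; lia.
rewrite /m -/m => /(_ ltac:(rewrite /m; clear -N1n; lia)) wle.
have Ce := C n g u Nn Hu.
have xe : 0 < x e.1 (n + t)%N by apply: x_gt0; exact: reach_edge eE.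
apply: ler_wpDr.
  rewrite big_seq; apply: sumr_ge0 => f /mem_rem fE; rewrite mulrC -mulrBr; apply: mulr_ge0.
    by apply/ltW/x_gt0/(reach_edge rI fE).
  rewrite subr_ge0; apply: Hu; first exact: reach_edge fE.
  by have := E_delay fE; rewrite /m; clear; lia.
rewrite [u * _]mulrC -mulrBr mulrC.
apply: (@le_trans _ _ (x e.1 (n + t)%N * (d * (u - g * rho a n)))).
  by rewrite ler_wpM2r // mulr_ge0 // ltW.
by rewrite ler_pM2l // lerBrDr addrC -lerBrDr.
Qed.

(** The loop of delay 1 carries the gain to every later time, and not only to an arithmetic
    progression. *)
Lemma contracts_base t : exists d N, 0 < d /\ contracts a t d N.
Proof.
elim: t => [|t [d [N [d0 C]]]].
  by exists 1, 0%N; split => // n g u _ H; rewrite addn0 mul1r; lra.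
have := @contracts_step a (a, 1%N) t d N (connect0 _ _) E_loop d0 C.
by rewrite /= addn1.
Qed.

Lemma contracts_late I : reach I ->
  exists T, forall t, (T <= t)%N -> exists d N, 0 < d /\ contracts I t d N.
Proof.
move=> rI; have /connectP[p] := E_back rI.
elim: p I rI => [|J p IH] I rI /=.
  by move=> _ <-; exists 0%N => t _; exact: contracts_base.
move=> /andP[/hasP[e eE /eqP eJ] pth] lst.
have rJ : reach J by rewrite -eJ; exact: reach_edge eE.
have [T HT] := IH J rJ pth lst; exists (T + e.2)%N => t Ht.
have [|d [N [d0 C]]] := HT (t - e.2)%N; first by lia.
rewrite -eJ in C; have := contracts_step rI eE d0 C.
by rewrite subnK //; lia.
Qed.

Lemma contracts_weaken I t d d' N N' : d' <= d -> (N <= N')%N ->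
  contracts I t d N -> contracts I t d' N'.
Proof.
move=> dd NN C n g u Nn Hu; apply: le_trans (C n g u (leq_trans NN Nn) Hu) _.
rewrite lerB // ler_wpM2r // subr_ge0; apply: Hu; first exact: connect0.
by rewrite leq_addr.
Qed.

Lemma contracts_common (q : seq (S * nat)) :
  (forall p, p \in q -> exists d N, 0 < d /\ contracts p.1 p.2 d N) ->
  exists d N, 0 < d /\ forall p, p \in q -> contracts p.1 p.2 d N.
Proof.
elim: q => [|p q IH] H; first by exists 1, 0%N.
have [p' p'q|d1 [N1 [d10 C1]]] := IH; first by apply: H; rewrite inE p'q orbT.
have [|d2 [N2 [d20 C2]]] := H p; first by rewrite inE eqxx.
exists (Num.min d1 d2), (maxn N1 N2); rewrite lt_min d10 d20; split => // p'.
rewrite inE => /orP[/eqP->|p'q].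
  by apply: contracts_weaken C2; rewrite ?ge_min ?lexx ?orbT ?leq_maxr.
by apply: contracts_weaken (C1 _ p'q); rewrite ?ge_min ?lexx ?leq_maxl.
Qed.

(** Only finitely many pairs occur in a window of [D] times, so that common constants exist. *)
Lemma contracts_uniform : exists T d N, 0 < d /\ forall I t, reach I ->
  (T <= t < T + D)%N -> contracts I t d N.
Proof.
have exT : exists T, forall I, reach I -> forall t, (T <= t)%N ->
    exists d N, 0 < d /\ contracts I t d N.
  have H (I : S) : exists T, reach I -> forall t, (T <= t)%N ->
      exists d N, 0 < d /\ contracts I t d N.
    have [rI|nrI] := boolP (reach I); last by exists 0%N.
    by have [T HT] := contracts_late rI; exists T.
  have [f Hf] := choice H; exists (\max_I f I) => I rI t Ht.
  by apply: (Hf I rI); apply: leq_trans Ht; exact: leq_bigmax.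
have [T HT] := exT.
pose q := [seq p <- [seq (J, t) | J <- enum S, t <- iota T D] | reach p.1].
have [p|d [N [d0 C]]] := @contracts_common q.
  rewrite mem_filter => /andP[rI /allpairsP[[I t] /= [_ tq E']]].
  by apply: HT => //; rewrite E' /=; move: tq; rewrite mem_iota => /andP[].
exists T, d, N; split => // I t rI tT; apply: (C (I, t)).
rewrite mem_filter rI /=.
by apply/allpairsP; exists (I, t); rewrite mem_enum mem_iota.
Qed.

(** Every ratio after the window is a mean of ratios at most [D] steps earlier, so that a bound on
    [D] consecutive times persists. *)
Lemma rho_convex m g u : (D <= m)%N ->
  (forall I k, reach I -> (m <= k < m + D)%N -> g * rho I k <= u) ->
  forall I k, reach I -> (m <= k)%N -> g * rho I k <= u.
Proof.
move=> Dm H I k; elim/ltn_ind: k I => k IH I rI mk.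
have [kD|Dk] := ltnP k (m + D); first by apply: H; rewrite ?mk.
have Dk' : (D <= k)%N by lia.
rewrite -(ler_pM2r (x_gt0 k rI)) rho_avg // {1}(x_rec rI Dk') mulr_sumr.
rewrite big_seq [X in _ <= X]big_seq; apply: ler_sum => e eE.
have /andP[e0 eD] := E_delay eE; have re := reach_edge rI eE.
rewrite [leRHS]mulrC; apply: ler_wpM2l; first by apply/ltW/x_gt0.
by apply: IH => //; lia.
Qed.

Lemma rho_contraction : exists T d N, 0 < d /\ forall n lo hi, (N <= n)%N ->
  (forall J k, reach J -> (n <= k + D)%N -> lo <= rho J k <= hi) ->
  exists lo' hi', hi' - lo' = (1 - d) * (hi - lo) /\
    forall J k, reach J -> (n + T <= k + D)%N -> lo' <= rho J k <= hi'.
Proof.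
have [T [d [N [d0 C]]]] := contracts_uniform.
exists (T + D)%N, d, (maxn N D); split=> // n lo hi; rewrite geq_max => /andP[Nn Dn] H.
(* Whatever the position of [rho a n] between the bounds, the two gains add up to
   [d * (hi - lo)]. *)
exists (lo + d * (rho a n - lo)), (hi - d * (hi - rho a n)); split; first by ring.
have key g u : (forall J k, reach J -> (n <= k + D)%N -> g * rho J k <= u) ->
    forall J k, reach J -> (n + T <= k)%N -> g * rho J k <= u - d * (u - g * rho a n).
  move=> Hu; apply: rho_convex => [|I k rI kT]; first by lia.
  have -> : k = (n + (k - n))%N by lia.
  by apply: (C I (k - n)%N rI) => //; lia.
move=> J k rJ kT; apply/andP; split.
  have := key (-1) (- lo) _ J k rJ; rewrite !mulN1r => H'.
  suff : - rho J k <= - lo - d * (- lo - - rho a n) by lra.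
  apply: H'; last by lia.
  by move=> J' k' rJ' nk'; rewrite mulN1r lerN2; have /andP[] := H J' k' rJ' nk'.
have := key 1 hi _ J k rJ; rewrite !mul1r; apply; last by lia.
by move=> J' k' rJ' nk'; rewrite mul1r; have /andP[] := H J' k' rJ' nk'.
Qed.

Lemma rho_bounds J k : reach J -> 0 <= rho J k <= K.
Proof.
move=> rJ; apply/andP; split; first by rewrite divr_ge0 // ltW // x_gt0.
by rewrite ler_pdivrMr ?x_gt0 // x_growth.
Qed.

Lemma rho_narrow : exists2 d, 0 < d & forall j, exists n lo hi,
  hi - lo = (1 - d) ^+ j * K /\
  forall J k, reach J -> (n <= k + D)%N -> lo <= rho J k <= hi.
Proof.
have [T [d [N [d0 C]]]] := rho_contraction; exists d => //.
suff H j : exists n lo hi, [/\ (N <= n)%N, hi - lo = (1 - d) ^+ j * K &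
    forall J k, reach J -> (n <= k + D)%N -> lo <= rho J k <= hi].
  by move=> j; have [n [lo [hi [_ E' H']]]] := H j; exists n, lo, hi.
elim: j => [|j [n [lo [hi [Nn E' H]]]]].
  by exists N, 0, K; rewrite subr0 mul1r; split => // J k rJ _; exact: rho_bounds.
have [lo' [hi' [E2 H2]]] := C n lo hi Nn H.
exists (n + T)%N, lo', hi'; rewrite (leq_trans Nn) ?leq_addr // E2 E' exprS mulrA.
by split.
Qed.

Lemma x_base_le n : (D <= n)%N -> x a n <= x a n.+1.
Proof.
move=> Dn; have := @recurrence_edge_le a (a, 1%N) n.+1 (connect0 _ _) E_loop.
by rewrite /= subn1; apply; exact: leqW.
Qed.

Lemma ratio_limit : exists2 r : R, 0 < r <= 1 & (fun n => x a n / x a n.+1) @ \oo --> r.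
Proof.
have ra : reach a by exact: connect0.
have [d d0 H] := rho_narrow.
(* The limit of [rho a] is the supremum of its eventual lower bounds; the loop makes 1 one of
   them. *)
pose B := [set lo | exists n, forall k, (n <= k)%N -> lo <= rho a k].
have B1 : B 1.
  by exists D => k Dk; rewrite /rho ler_pdivlMr ?x_gt0 // mul1r x_base_le.
have Bub y : ubound B y -> sup B <= y by apply: ge_sup; exists 1.
have Bsup : has_sup B.
  split; first by exists 1.
  exists K => y [n Hn]; apply: le_trans (Hn n (leqnn n)) _.
  by have /andP[] := rho_bounds n ra.
have B_le y : B y -> y <= sup B by move=> By; apply: ub_le_sup => //; case: Bsup.
have dist j : exists n, forall k, (n <= k)%N -> `|sup B - rho a k| <= (1 - d) ^+ j * K.
  have [n [lo [hi [E' Hn]]]] := H j; exists n => k nk.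
  have /andP[l1 l2] : lo <= rho a k <= hi by apply: Hn => //; lia.
  have l3 : lo <= sup B.
    apply: B_le; exists n => k' nk'.
    by have /andP[] : lo <= rho a k' <= hi by apply: Hn => //; lia.
  have l4 : sup B <= hi.
    apply: Bub => y [n' Hn']; apply: le_trans (Hn' (n' + n)%N (leq_addr _ _)) _.
    by have /andP[] : lo <= rho a (n' + n)%N <= hi by apply: Hn => //; lia.
  rewrite -E' ler_norml; lra.
have K0 := recurrence_K_gt0.
(* An interval of length [(1 - d) * K] contains a ratio, so that [1 - d] is nonnegative. *)
have d1 : d <= 1.
  have [n [lo [hi [E' Hn]]]] := H 1%N.
  have /andP[l1 l2] : lo <= rho a n <= hi by apply: Hn => //; lia.
  have : 0 <= (1 - d) * K by rewrite -[1 - d]expr1 -E'; lra.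
  by rewrite pmulr_lge0 //; lra.
have cv : rho a @ \oo --> sup B.
  apply/cvgrPdist_le => eps eps0.
  have : (fun j => (1 - d) ^+ j * K) @ \oo --> 0 * K.
    by apply: cvgMl; apply: cvg_expr; rewrite ltr_norml; lra.
  rewrite mul0r => /cvgrPdist_le/(_ eps eps0)[j _ /(_ j (leqnn j))] /=.
  rewrite sub0r normrN => Hj; have [n Hn] := dist j.
  exists n => // k nk; apply: le_trans (Hn k nk) _; apply: le_trans Hj.
  exact: ler_norm.
have s1 : 1 <= sup B by exact: B_le.
exists (sup B)^-1; first by rewrite invr_gt0 (lt_le_trans ltr01) //= invf_le1 // (lt_le_trans ltr01).
have -> : (fun n => x a n / x a n.+1) = (fun n => (rho a n)^-1).
  by apply/funext => n; rewrite /rho invf_div.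
by apply: cvgV => //; rewrite gt_eqF // (lt_le_trans ltr01).
Qed.

End RatioLimit.

(** * Convolutions of sequences with convergent ratios *)

Section Convolution.
Variables (R : realType) (a b : nat -> R) (al be eps : R) (N0 : nat).
Hypotheses (a_gt0 : forall n, 0 < a n) (b_gt0 : forall n, 0 < b n).
Hypotheses (a_le : forall n, a n <= a n.+1) (b_le : forall n, b n <= b n.+1).
Hypotheses (a_lim : (fun n => a n / a n.+1) @ \oo --> al)
  (b_lim : (fun n => b n / b n.+1) @ \oo --> be) (al_gt0 : 0 < al) (al_le_be : al <= be).
Hypotheses (eps_gt0 : 0 < eps) (a_big : forall i, (N0 <= i)%N -> eps <= a i * be ^+ i).

Definition cauchy_prod n := \sum_(i < n.+1) a i * b (n - i)%N.

Lemma cauchy_prod_gt0 n : 0 < cauchy_prod n.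
Proof.
rewrite /cauchy_prod big_ord_recl; apply: ltr_wpDr; last by rewrite mulr_gt0.
by apply: sumr_ge0 => i _; apply/ltW/mulr_gt0.
Qed.

Lemma ratio_pow i : (fun n => b n / b (n + i)%N) @ \oo --> be ^+ i.
Proof.
elim: i => [|i IH].
  rewrite expr0 (_ : (fun n => _) = cst 1); first exact: cvg_cst.
  by apply/funext => n; rewrite addn0 divff // gt_eqF.
rewrite exprSr (_ : (fun n => _) = (fun n => b n / b (n + i)%N) \*
    (fun n => b (n + i)%N / b (n + i).+1)).
  by apply: cvgM => //; apply: (cvg_comp _ _ (cvg_addnr i) b_lim).
apply/funext => n /=; rewrite addnS mulrA -[_ / _ * b _]mulrA mulVf ?mulr1 //.
by rewrite gt_eqF.
Qed.

(** The term of index [i] is asymptotically [a i * be ^+ i * b n], which is at least [eps * b n];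
    the factor 1/2 leaves room for the convergence. *)
Lemma cauchy_prod_part k : exists N, forall n, (N <= n)%N ->
  k%:R * (eps / 2) * b n <= \sum_(N0 <= i < N0 + k) a i * b (n - i)%N.
Proof.
have be0 : 0 < be by exact: lt_le_trans al_le_be.
elim: k => [|k [N IH]].
  by exists 0%N => n _; rewrite addn0 big_geq // !mul0r.
have bp : 0 < be ^+ (N0 + k) by rewrite exprn_gt0.
have /cvgrPdist_le/(_ (be ^+ (N0 + k) / 2)) := @ratio_pow (N0 + k)%N.
case; first by rewrite divr_gt0.
move=> N1 _ H1; exists (N + N1 + (N0 + k))%N => n Hn.
rewrite addnS big_nat_recr ?leq_addr //= -[k.+1]addn1 natrD !mulrDl mul1r.
apply: lerD; first by apply: IH; lia.
have := H1 (n - (N0 + k))%N; rewrite /= => /(_ ltac:(lia)).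
rewrite subnK; last by lia.
set q := b (n - _)%N => H.
have {}H : be ^+ (N0 + k) / 2 * b n <= q.
  rewrite -ler_pdivlMr //; have := ler_norm (be ^+ (N0 + k) - q / b n); lra.
apply: (@le_trans _ _ (a (N0 + k)%N * (be ^+ (N0 + k) / 2 * b n))); last by rewrite ler_pM2l.
rewrite !mulrA ler_pM2r // ler_pM2r ?invr_gt0 //; apply: a_big; exact: leq_addr.
Qed.

(** As many terms as desired contribute [eps / 2 * b n] each. Through [a_big] this holds even when
    the limits [al] and [be] coincide. *)
Lemma cauchy_prod_small eta : 0 < eta -> exists N, forall n, (N <= n)%N -> b n <= eta * cauchy_prod n.
Proof.
move=> eta0; pose k := Num.bound (eta * (eps / 2))^-1.
have [N HN] := cauchy_prod_part k; exists (N + (N0 + k))%N => n Hn.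
have hk : 1 <= eta * (k%:R * (eps / 2)).
  have e0 : 0 < eta * (eps / 2) by rewrite mulr_gt0 // divr_gt0.
  rewrite mulrCA -ler_pdivrMr // mul1r; apply: le_trans (ltW (archi_boundP _)) => //.
  by rewrite invr_ge0 ltW.
apply: (@le_trans _ _ (eta * (k%:R * (eps / 2) * b n))).
  by rewrite (mulrA eta) ler_peMl // ltW.
rewrite ler_pM2l //; apply: le_trans (HN n _) _; first by lia.
rewrite /cauchy_prod -(big_mkord xpredT (fun i => a i * b (n - i)%N)).
have ge0 m q : 0 <= \sum_(m <= i < q) a i * b (n - i)%N.
  by apply: sumr_ge0 => i _; apply/ltW/mulr_gt0.
rewrite [leRHS](@big_cat_nat _ _ _ N0) //=; last by lia.
rewrite [X in _ <= _ + X](@big_cat_nat _ _ _ (N0 + k)) ?leq_addr //=; last by lia.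
have := ge0 0%N N0; have := ge0 (N0 + k)%N n.+1; lra.
Qed.

(** In the defect [dec], the weights [a i / a i.+1 - al] are small from index [N] on. The terms
    before [N] and the boundary term are bounded by a constant times [b n.+1], which is negligible
    by [cauchy_prod_small]. *)
Lemma cauchy_prod_limit : (fun n => cauchy_prod n / cauchy_prod n.+1) @ \oo --> al.
Proof.
have b_mono m n : (m <= n)%N -> b m <= b n.
  by move=> mn; rewrite -(subnK mn) addnC; elim: (n - m)%N => [|i IH];
    rewrite ?addn0 // addnS; exact: le_trans IH (b_le _).
have a_ratio1 i : a i / a i.+1 <= 1 by rewrite ler_pdivrMr // mul1r.
have a_ratio0 i : 0 <= a i / a i.+1 by rewrite divr_ge0 // ltW.
have al1 : al <= 1.
  by apply: (@cvgr_to_le _ _ _ _ _ _ _ a_lim); apply: nearW.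
have dec n : cauchy_prod n - al * cauchy_prod n.+1 =
    \sum_(i < n.+1) (a i / a i.+1 - al) * (a i.+1 * b (n - i)%N) - al * (a 0%N * b n.+1).
  rewrite [cauchy_prod n.+1]/cauchy_prod big_ord_recl subn0 mulrDr opprD addrCA addrC; congr (_ - _).
  rewrite mulr_sumr /cauchy_prod -sumrB; apply: eq_bigr => i _.
  rewrite lift0 subSS mulrBl; congr (_ - _).
  by rewrite mulrA mulfVK // gt_eqF.
apply/cvgrPdist_le => eta eta0.
have /cvgrPdist_le/(_ (eta / 2)) := a_lim.
case; first by rewrite divr_gt0.
move=> N _ HN.
(* [B * b n.+1] bounds the first [N] terms of the defect together with its boundary term. *)
pose B := \sum_(i < N) a i.+1 + a 0%N.
have B0 : 0 < B by apply: ltr_wpDl => //; apply: sumr_ge0 => i _; exact: ltW.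
have [N1 H1] : exists N1, forall n, (N1 <= n)%N -> b n <= (eta / 2 / B) * cauchy_prod n.
  by apply: cauchy_prod_small; rewrite !divr_gt0.
exists (N + N1)%N => // n /= Hn.
have c0 := cauchy_prod_gt0 n.+1.
have -> : al - cauchy_prod n / cauchy_prod n.+1 = - (cauchy_prod n - al * cauchy_prod n.+1) / cauchy_prod n.+1.
  by rewrite opprB mulrBl mulfK // gt_eqF.
rewrite normrM normrN normfV (gtr0_norm c0) ler_pdivrMr // dec.
have -> : eta * cauchy_prod n.+1 = eta / 2 * cauchy_prod n.+1 + eta / 2 * cauchy_prod n.+1.
  by rewrite -mulrDl -splitr.
apply: le_trans (ler_normB _ _) _.
have bB : B * b n.+1 <= eta / 2 * cauchy_prod n.+1.
  have := H1 n.+1; rewrite mulrAC ler_pdivlMr // mulrC; apply; lia.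
have cS : \sum_(i < n.+1) a i.+1 * b (n - i)%N <= cauchy_prod n.+1.
  rewrite /cauchy_prod [leRHS]big_ord_recl; apply: ler_wpDl; first by apply/ltW/mulr_gt0.
  by apply: ler_sum => i _; rewrite lift0 subSS.
suff S1 : `|\sum_(i < n.+1) (a i / a i.+1 - al) * (a i.+1 * b (n - i)%N)| <=
    eta / 2 * (\sum_(i < n.+1) a i.+1 * b (n - i)%N) + \sum_(i < N) a i.+1 * b n.+1.
  have S2 : `|al * (a 0%N * b n.+1)| <= a 0%N * b n.+1.
    by rewrite ger0_norm ?mulr_ge0 ?ler_piMl ?mulr_ge0 // ltW.
  have S3 : eta / 2 * (\sum_(i < n.+1) a i.+1 * b (n - i)%N) <= eta / 2 * cauchy_prod n.+1.
    by rewrite ler_pM2l // divr_gt0.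
  have S4 : \sum_(i < N) a i.+1 * b n.+1 + a 0%N * b n.+1 = B * b n.+1.
    by rewrite -mulr_suml -mulrDl.
  by lra.
apply: le_trans (ler_norm_sum _ _ _) _.
have Nn : (N <= n.+1)%N by apply/leqW/(leq_trans _ Hn)/leq_addr.
rewrite -(big_mkord xpredT (fun i => `|(a i / a i.+1 - al) * (a i.+1 * b (n - i)%N)|)).
rewrite -(big_mkord xpredT (fun i => a i.+1 * b (n - i)%N)).
rewrite -(big_mkord xpredT (fun i => a i.+1 * b n.+1)).
rewrite (@big_cat_nat _ _ _ N) //= addrC mulr_sumr (@big_cat_nat _ _ _ N 0%N n.+1) //=.
rewrite -addrA [leRHS]addrCA; apply: lerD.
  rewrite !big_nat; apply: ler_sum => i /andP[Ni _].
  have h0 : 0 <= a i.+1 * b (n - i)%N by apply/ltW/mulr_gt0.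
  by rewrite normrM (ger0_norm h0) ler_wpM2r // distrC; apply: HN.
apply: ler_wpDl.
  by apply: sumr_ge0 => i _; rewrite mulr_ge0 ?divr_ge0 ?ltW ?mulr_gt0.
rewrite !big_nat; apply: ler_sum => i /andP[_ iN].
have h0 : 0 <= a i.+1 * b (n - i)%N by apply/ltW/mulr_gt0.
rewrite normrM (ger0_norm h0); apply: (@le_trans _ _ (a i.+1 * b (n - i)%N)).
  apply: ler_piMl => //; have := a_ratio1 i; have := a_ratio0 i.
  by move: (a i / a i.+1) => q q0 q1; rewrite ler_norml lerBrDr lerBlDr addrC (le_trans _ q0) ?subr_le0 //=
    (le_trans q1) // lerDl ltW.
by rewrite ler_pM2l // b_mono // leqW // leq_subr.
Qed.

End Convolution.

(** * Growth of the monoid *)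

Section Counting.
Local Open Scope nat_scope.
Local Open Scope group_scope.
Variables (G : finType) (M : coxeterMatrix G).
Hypothesis fin : finite_type M.

Local Notation W := (presMonoid (cox_rel M)).
Local Notation c_ := (pres_word (cox_rel M)).
Local Notation s := (pres_gen (cox_rel M)).
Local Notation l := (len s).
Local Notation A := (presMonoid (braid_rel M)).
Local Notation a_ := (pres_word (braid_rel M)).
Local Notation r := (pres_gen (braid_rel M)).
Local Notation L := (len r).
Implicit Types (a b c d : G) (u v : seq G) (w : W) (x y z g h : A) (I J K : {set G}).

Definition alist n : seq A := undup [seq a_ (tval t) | t <- enum {: n.-tuple G}].

Lemma mem_alist x n : (x \in alist n) = (L x == n).
Proof.
rewrite mem_undup; apply/mapP/eqP => [[t _ ->]|Lx]; first by rewrite len_a size_tuple.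
have sx : size (repr x) == n by rewrite -(len_a M) pres_wordK Lx.
by exists (Tuple sx); rewrite ?mem_enum //= pres_wordK.
Qed.

Definition acount n (P : pred A) := count P (alist n).

Lemma acount_bij n m (P Q : pred A) (f : A -> A) :
  (forall x, L x = n -> P x -> L (f x) = m /\ Q (f x)) ->
  (forall x y, f x = f y -> x = y) ->
  (forall y, L y = m -> Q y -> exists x, [/\ L x = n, P x & f x = y]) ->
  acount n P = acount m Q.
Proof.
move=> fP finj fsurj; rewrite /acount -!size_filter -(size_map f).
apply/perm_size/uniq_perm.
- by rewrite map_inj_in_uniq ?filter_uniq ?undup_uniq // => x y _ _; exact: finj.
- by rewrite filter_uniq ?undup_uniq.
move=> y; rewrite mem_filter mem_alist; apply/mapP/andP => [[x]|[Qy /eqP Ly]].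
  by rewrite mem_filter mem_alist => /andP[Px /eqP Lx] ->; have [-> ->] := fP x Lx Px.
have [x [Lx Px <-]] := fsurj y Ly Qy.
by exists x; rewrite // mem_filter mem_alist Px Lx eqxx.
Qed.

Lemma acount_ext n (P Q : pred A) : (forall x, L x = n -> P x = Q x) ->
  acount n P = acount n Q.
Proof. by move=> PQ; apply: eq_in_count => x; rewrite mem_alist => /eqP; exact: PQ. Qed.

Lemma acount0 n (P : pred A) : (forall x, L x = n -> ~~ P x) -> acount n P = 0%N.
Proof.
move=> H; rewrite (@acount_ext _ _ pred0) ?/acount ?count_pred0 // => x Lx.
exact/negbTE/H.
Qed.

Lemma acount_gt0 n (P : pred A) x : L x = n -> P x -> 0 < acount n P.
Proof.
by move=> Lx Px; rewrite -has_count; apply/hasP; exists x; rewrite ?mem_alist ?Lx.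
Qed.

Lemma count_partition (T I : eqType) (q : seq T) (P : pred T) (f : T -> I) (S : seq I) :
  uniq S -> (forall t : T, t \in q -> P t -> f t \in S) ->
  count P q = \sum_(i <- S) count (fun t : T => P t && (f t == i)) q.
Proof.
move=> uS fS; rewrite -sum1_count big_seq_cond.
rewrite (eq_bigr (fun t : T => \sum_(i <- S) (f t == i))); last first.
  move=> x /andP[xq Px]; rewrite (bigD1_seq (f x)) ?fS //= eqxx.
  by rewrite big1 ?addn0 // => i; rewrite eq_sym => /negbTE->.
rewrite exchange_big /=; apply: eq_bigr => i _; rewrite -big_seq_cond.
by rewrite -sum1_count big_mkcondr /=; apply: eq_bigr => x _; case: (_ == _).
Qed.

Lemma acount_partition n (P : pred A) (I : eqType) (f : A -> I) (S : seq I) :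
  uniq S -> (forall x, L x = n -> P x -> f x \in S) ->
  acount n P = \sum_(i <- S) acount n (fun x => P x && (f x == i)).
Proof.
by move=> uS fS; apply: count_partition => // x; rewrite mem_alist => /eqP; exact: fS.
Qed.

Definition desc x : {set G} := [set a | wle (s a) (alpha x)]%SET.
Definition wdl w : {set G} := [set a | wle (s a) w]%SET.
Definition wdr w : {set G} := [set a | l (w * s a : W) < l w]%SET.

Lemma gen_inj a b : r a = r b -> a = b.
Proof.
move/pres_wordP/braid_eq_mem => /(_ a).
by rewrite !inE eqxx => /esym/eqP.
Qed.

Lemma cgen_inj a b : s a = s b -> a = b.
Proof. by move=> E; apply: gen_inj; rewrite -!sigma_gen E. Qed.

Lemma descP a x : reflect (left_divides (r a) x) (a \in desc x).
Proof. by rewrite inE; apply: (iffP idP); rewrite left_divides_gen. Qed.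

Lemma desc_supp J x a : gsupp J x -> a \in desc x -> a \in J.
Proof. by move=> Jx /descP[y xE]; move: Jx; rewrite xE gsupp_mul gsupp_gen => /andP[]. Qed.

Lemma normal_formE w g : (alpha (sigma w * g) == w) = (desc g \subset wdr w).
Proof.
apply/eqP/fintype.subsetP => [/(alpha_sigma_mul fin) H a /descP ag|H].
  by rewrite inE; exact: H.
by apply/alpha_sigma_mul => // a /descP/H; rewrite inE.
Qed.

Lemma wdl_gen a : wdl (s a) = [set a]%SET.
Proof.
apply/setP => b; rewrite !inE; apply/idP/eqP => [/wle_gen_eq/cgen_inj //|->].
exact: wle_refl.
Qed.

Lemma wdr_inv w : wdr w = wdl (winv w).
Proof.
apply/setP => a; rewrite !inE wle_gen.
have lV t : l (winv t) = l t by exact: lenV.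
by rewrite lV -lV winvM winv_gen.
Qed.

Lemma wdr_gen a : wdr (s a) = [set a]%SET.
Proof. by rewrite wdr_inv winv_gen wdl_gen. Qed.

Lemma wdr_supp J w a : wsupp J w -> a \in wdr w -> a \in J.
Proof.
rewrite inE => Jw aw.
have E : w = w * s a * s a by rewrite gen_mulgK.
have red : redp (w * s a) (s a).
  rewrite /redp -E len_s addn1.
  have := len_mul_le (w * s a) (s a); rewrite -E len_s addn1 => H.
  by rewrite eqn_leq H.
by move: Jw; rewrite E wsupp_mul // wsupp_gen => /andP[].
Qed.

Lemma wdl_supp J w a : wsupp J w -> a \in wdl w -> a \in J.
Proof. by rewrite inE => Jw /wsupp_le/(_ Jw); rewrite wsupp_gen. Qed.

Lemma wdr_neq0 w : w != 1 -> wdr w != finset.set0.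
Proof.
move=> w1; rewrite wdr_inv; have /gen_ex[a aw] : winv w != 1.
  apply: contra w1 => /eqP E; rewrite -[w]winvK E; apply/eqP; exact: invg1.
by apply/set0Pn; exists a; rewrite inE.
Qed.

Definition wenum : seq W := fset_set [set: W]%classic.

Lemma mem_wenum w : w \in wenum.
Proof.
have fin' : finite_set [set: W]%classic by exact: fin.
by have := in_fset_set fin' w; rewrite in_setT.
Qed.

Lemma wenum_uniq : uniq wenum. Proof. exact: fset_uniq. Qed.

Definition acnt J n := acount n (gsupp J).
Definition ccnt J I n := acount n (fun x => gsupp J x && (desc x \subset I)).

(** The greatest simple divisor [w] is split off. By the normal form condition its cofactors are
    exactly the elements whose left descents are right descents of [w], and [n > 0] excludes
    [w = 1]. *)
Lemma ccnt_rec J I n : 0 < n ->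
  ccnt J I n = \sum_(w <- wenum | [&& w != 1, wsupp J w, wdl w \subset I & l w <= n])
    ccnt J (wdr w) (n - l w).
Proof.
move=> n0; rewrite /ccnt (acount_partition (f := fun x => alpha x) wenum_uniq); last first.
  by move=> x _ _; exact: mem_wenum.
rewrite [RHS]big_mkcond; apply: eq_bigr => w _.
case: ifP => [/and4P[w1 Jw wI lw]|H].
  apply/esym/(acount_bij (f := fun g => sigma w * g)) => [x Lx /andP[Jx dx]|x y|y Ly].
  - have aE : alpha (sigma w * x) = w by apply/eqP; rewrite normal_formE.
    by rewrite len_aM len_sigma Lx subnKC // gsupp_mul gsupp_sigma Jw Jx /desc aE eqxx andbT.
  - exact: artin_mulI.
  move=> /andP[/andP[Jy dy] /eqP aE]; have [g yE] := sigma_alpha fin y.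
  rewrite aE in yE; move: Jy Ly; rewrite yE gsupp_mul len_aM len_sigma => /andP[_ Jg] <-.
  by exists g; rewrite addKn Jg -normal_formE -yE aE eqxx.
apply: acount0 => x Lx; apply/negP => /andP[/andP[Jx dx] /eqP aE].
move: H; rewrite -aE wsupp_alpha // (_ : wdl (alpha x) = desc x) // dx /=.
have [g xE] := sigma_alpha fin x.
have -> : l (alpha x) <= n by rewrite -Lx {2}xE len_aM len_sigma leq_addr.
rewrite andbT => /negbFE/eqP a1.
have [a [y E]] : exists a, left_divides (r a) x.
  rewrite -[x]pres_wordK; case E : (repr x) => [|a u].
    by move: n0; rewrite -Lx -[x]pres_wordK E len_a1.
  by exists a, (a_ u); rewrite pres_word_cons.
have : wle (s a) (alpha x) by rewrite -left_divides_gen //; exists y.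
by rewrite a1 => /wle1/eqP; rewrite (negbTE (gen_neq1 _ _)).
Qed.

Lemma ccnt_mono J I I' n : I \subset I' -> ccnt J I n <= ccnt J I' n.
Proof.
by move=> II'; apply: sub_count => x /andP[-> dI] /=; exact: fintype.subset_trans II'.
Qed.

Lemma alpha_gen_mul a x : desc x \subset [set a]%SET -> desc (r a * x) = [set a]%SET.
Proof.
rewrite -wdr_gen -normal_formE sigma_gen => /eqP E.
by rewrite /desc E wdr_gen; exact: wdl_gen.
Qed.

Lemma ccnt_le J a n : a \in J -> ccnt J [set a]%SET n <= ccnt J [set a]%SET n.+1.
Proof.
move=> aJ; rewrite /ccnt /acount -!size_filter -(size_map (fun x => r a * x)).
apply: uniq_leq_size.
  rewrite map_inj_in_uniq ?filter_uniq ?undup_uniq // => x y _ _.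
  exact: artin_mulI.
move=> y /mapP[x]; rewrite !mem_filter mem_alist => /andP[/andP[Jx dx] /eqP Lx] ->.
by rewrite mem_alist gsupp_mul gsupp_gen aJ Jx alpha_gen_mul // subxx len_aM len_r Lx add1n /=.
Qed.

Lemma acnt_le J a n : a \in J -> acnt J n <= acnt J n.+1.
Proof.
move=> aJ; rewrite /acnt /acount -!size_filter -(size_map (fun x => r a * x)).
apply: uniq_leq_size.
  rewrite map_inj_in_uniq ?filter_uniq ?undup_uniq // => x y _ _.
  exact: artin_mulI.
move=> y /mapP[x]; rewrite !mem_filter mem_alist => /andP[Jx /eqP Lx] ->.
by rewrite mem_alist gsupp_mul gsupp_gen aJ Jx len_aM len_r Lx add1n /=.
Qed.

Lemma acnt_mulD J m n : acnt J (m + n) <= acnt J m * acnt J n.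
Proof.
rewrite /acnt /acount -!size_filter.
rewrite -(size_allpairs (fun x y : A => x * y : A)).
apply: uniq_leq_size; first by rewrite filter_uniq ?undup_uniq.
move=> g; rewrite mem_filter mem_alist => /andP[Jg /eqP Lg].
have sg : size (repr g) = (m + n)%N by rewrite -Lg -(len_a M) pres_wordK.
have gE : g = a_ (take m (repr g)) * a_ (drop m (repr g)).
  by rewrite -pres_word_cat cat_take_drop pres_wordK.
have /andP[J1 J2] : gsupp J (a_ (take m (repr g))) && gsupp J (a_ (drop m (repr g))).
  by rewrite -gsupp_mul -gE.
apply/allpairsP; exists (a_ (take m (repr g)), a_ (drop m (repr g))).
rewrite !mem_filter !mem_alist J1 J2 !len_a size_drop sg addKn eqxx size_take sg.
split => //; case: ltnP => //= H; rewrite eqn_leq H.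
by rewrite leq_addr.
Qed.

(** Removing the last letter creates no left descent, and the letter removed takes at most [#|G|]
    values. *)
Lemma ccnt_growth J I n : ccnt J I n.+1 <= #|G| * ccnt J I n.
Proof.
rewrite /ccnt /acount -!size_filter cardE.
rewrite mulnC -(size_allpairs (fun (x : A) b => x * r b : A)).
apply: uniq_leq_size; first by rewrite filter_uniq ?undup_uniq.
move=> g; rewrite mem_filter mem_alist => /andP[/andP[Jg dg] /eqP Lg].
have sg : size (repr g) = n.+1 by rewrite -Lg -(len_a M) pres_wordK.
case/lastP E : (repr g) sg => [|u b] // sg.
have gE : g = a_ u * r b by rewrite -pres_word_cat cats1 -E pres_wordK.
apply/allpairsP; exists (a_ u, b); rewrite mem_filter mem_alist len_a mem_enum.
move: Jg; rewrite gE gsupp_mul => /andP[-> _].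
move: sg; rewrite size_rcons => -[->]; rewrite eqxx andbT /=; split => //.
apply: fintype.subset_trans dg; apply/fintype.subsetP => a /descP[y uE]; apply/descP.
by exists (y * r b); rewrite gE uE amulA.
Qed.

Lemma ccnt_gt0 J I a n : a \in I -> a \in J -> 0 < ccnt J I n.
Proof.
move=> aI aJ; apply: (@acount_gt0 _ _ (a_ (nseq n a))); first by rewrite len_a size_nseq.
have supp K : a \in K -> gsupp K (a_ (nseq n a)).
  by move=> aK; rewrite gsupp_word all_nseq /= aK orbT.
rewrite supp //=; apply/fintype.subsetP => b /(desc_supp (supp [set a]%SET _)).
by rewrite !inE eqxx => /(_ isT)/eqP->.
Qed.

Lemma acnt_gt0 J a n : a \in J -> 0 < acnt J n.
Proof.
move=> aJ; apply: leq_trans (ccnt_gt0 n aJ aJ) _.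
by apply: sub_count => x /andP[].
Qed.

(** Parabolic factorization with respect to [J] without [a]: for elements of support in [J], a
    cofactor with no first letter in the smaller set is one whose left descents lie in [{a}]. The
    elements are sorted by the length of their parabolic part, then by this part. *)
Lemma acnt_conv J a n : a \in J ->
  acnt J n = \sum_(i < n.+1) acnt (J :\ a)%SET i * ccnt J [set a]%SET (n - i).
Proof.
move=> aJ; set K := (J :\ a)%SET.
have KJ b : b \in K -> b \in J by rewrite !inE => /andP[].
have suppKJ x : gsupp K x -> gsupp J x.
  by move=> Kx; apply/allP => b /(allP Kx); exact: KJ.
have /choice[hp Hhp] : forall g, exists h, exists k,
    [/\ g = h * k, gsupp K h & indivisible K k].
  by move=> g; have [h [k H]] := parabolic_factor K g; exists h, k.
rewrite {1}/acnt (acount_partition (f := fun x => L (hp x)) _ (S := iota 0 n.+1)) ?iota_uniq //.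
  rewrite -{1}[n.+1]subn0 -/(index_iota 0 n.+1) big_mkord; apply: eq_bigr => i _.
  rewrite (acount_partition (f := hp) _ (S := [seq h <- alist i | gsupp K h])).
  - rewrite big_filter big_seq_cond (eq_bigr (fun=> ccnt J [set a]%SET (n - i))).
      by rewrite -big_seq_cond big_const_seq iter_addn_0 mulnC.
    move=> h; rewrite mem_alist => /andP[/eqP Lh Kh].
    apply/esym/(acount_bij (f := fun k => h * k)).
    + move=> k Lk /andP[Jk dk].
      have ik : indivisible K k.
        by move=> b bK /descP/(fintype.subsetP dk); move: bK; rewrite !inE => /andP[/negbTE->].
      rewrite len_aM Lh Lk subnKC ?gsupp_mul ?Jk ?suppKJ //=; last by rewrite -ltnS.
      have [k' [E Kh' ik']] := Hhp (h * k).
      have [<- _] := parabolic_uniq fin Kh Kh' ik ik' E.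
      by rewrite Lh !eqxx.
    + by move=> x y; exact: artin_mulI.
    move=> y Ly /andP[/andP[Jy _] /eqP hE]; have [k [yE _ ik]] := Hhp y.
    exists k; rewrite -hE; split=> //; first by have := len_aM h k; rewrite -hE -yE Ly hE Lh; lia.
    move: Jy; rewrite yE gsupp_mul => /andP[_ Jk]; rewrite Jk /=.
    apply/fintype.subsetP => b bk; rewrite inE; apply/negPn/negP => ba.
    by apply: (ik b); [rewrite !inE ba (desc_supp Jk bk)|apply/descP].
  - by rewrite filter_uniq ?undup_uniq.
  move=> x Lx /andP[_ /eqP Lh]; rewrite mem_filter mem_alist Lh eqxx.
  by have [k [_ ->]] := Hhp x.
move=> x Lx _; have [k [E _ _]] := Hhp x; rewrite mem_iota /= add0n ltnS.
by rewrite -Lx {2}E len_aM leq_addr.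
Qed.

Lemma acnt0 n : acnt finset.set0 n = (n == 0%N).
Proof.
have H x : gsupp finset.set0 x = (x == 1).
  rewrite /gsupp; apply/idP/eqP => [|->]; last exact: gsupp1.
  case E : (repr x) => [|a u] /=; last by rewrite inE.
  by rewrite -[x]pres_wordK E.
rewrite /acnt (acount_ext (Q := pred1 1)) => [|x _]; last exact: H.
rewrite /acount count_uniq_mem ?undup_uniq // mem_alist len1.
by rewrite eq_sym.
Qed.

Lemma sum_subset_sign (D : {set G}) :
  (\sum_(J : {set G} | J \subset D) (-1) ^+ #|J| = (D == finset.set0)%:R :> int)%R.
Proof.
pose F i : int := (if i \in D then -1 else 0)%R.
transitivity (\prod_(i : G) (F i + 1))%R; last first.
  case: (set_0Vmem D) => [D0|[a aD]].
    by rewrite D0 eqxx big1 // => i _; rewrite /F D0 finset.in_set0 add0r.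
  rewrite (bigD1 a) //= /F aD addNr mul0r; case: eqP => // D0.
  by rewrite D0 inE in aD.
rewrite bigA_distr [LHS]big_mkcond /=; apply: eq_bigr => J _.
rewrite -big_mkcond /=; case: ifP => [JD|/negbT/fintype.subsetPn[a aJ aD]].
  rewrite (eq_bigr (fun=> (-1)%R)) ?prodr_const // => i iJ.
  by rewrite /F (fintype.subsetP JD).
by rewrite (bigD1 a) //= /F (negbTE aD) mul0r.
Qed.

(** The multiples of [Delta_J] are the elements having all of [J] as left descents.
    Inclusion-exclusion over [J] keeps the elements without descents, that is the unit. *)
Lemma acount_mobius n :
  (\sum_(J : {set G}) (-1) ^+ #|J| *
     (if l (wJ M J) <= n then acnt [set: G]%SET (n - l (wJ M J)) else 0)%N%:Z
   = (n == 0%N)%:Z :> int)%R.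
Proof.
have E (J : {set G}) : (if l (wJ M J) <= n then acnt [set: G]%SET (n - l (wJ M J)) else 0%N) =
    acount n (fun x => J \subset desc x).
  have JE x : (J \subset desc x) = wle (wJ M J) (alpha x).
    apply/fintype.subsetP/idP => [H|H a aJ].
      by apply: wJ_le => // a /H; rewrite inE.
    by rewrite inE; apply: wle_trans H; exact: wJ_gen.
  case: ifP => lJ.
    apply: (acount_bij (f := fun x => sigma (wJ M J) * x)) => [x Lx _|x y|y Ly].
    - by rewrite len_aM len_sigma Lx subnKC // JE -left_divides_sigma //; split => //; exists x.
    - exact: artin_mulI.
    rewrite JE => /(sigma_below fin)[x yE]; exists x; rewrite gsuppT -yE.
    by split => //; rewrite -Ly yE len_aM len_sigma addKn.
  apply/esym/acount0 => x Lx; rewrite JE; apply/negP => /(sigma_below fin)[y xE].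
  by move: lJ; rewrite -Lx xE len_aM len_sigma leq_addr.
have d1 x : (desc x == finset.set0) = (x == 1).
  apply/eqP/eqP => [|->]; last first.
    by apply/setP => a; rewrite inE finset.in_set0 (alpha1 fin); apply: negbTE; apply/negP => /wle1/eqP; rewrite (negbTE (gen_neq1 _ _)).
  rewrite -[x]pres_wordK; case: (repr x) => // a u d0.
  have : a \in desc (a_ (a :: u)) by apply/descP; exists (a_ u); rewrite pres_word_cons.
  by rewrite d0 inE.
transitivity (\sum_(x <- alist n) (\sum_(J : {set G} | J \subset desc x) (-1) ^+ #|J|) : int)%R.
  under [RHS]eq_bigr => x _ do rewrite big_mkcond /=.
  rewrite exchange_big /=; apply: eq_bigr => J _.
  rewrite E /acount -sum1_count (big_morph Posz PoszD erefl) big_mkcond mulr_sumr.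
  by apply: eq_bigr => x _; case: ifP; rewrite ?mulr1 ?mulr0.
under eq_bigr => x _ do rewrite sum_subset_sign d1 natz.
rewrite -(big_morph Posz PoszD erefl); congr (Posz _).
rewrite (eq_bigr (fun x => if x == 1 then 1%N else 0%N)); last by move=> x _; case: (_ == _).
by rewrite -big_mkcond sum1_count /= count_uniq_mem ?undup_uniq // mem_alist len1 eq_sym.
Qed.
End Counting.

Lemma cvg_sumr (R : realType) (I : Type) (q : seq I) (f : I -> nat -> R) (v : I -> R) :
  (forall i, f i @ \oo --> v i) ->
  (fun n => \sum_(i <- q) f i n) @ \oo --> \sum_(i <- q) v i.
Proof.
move=> fv; elim: q => [|i q IH].
  by under eq_fun => n do rewrite big_nil; rewrite big_nil; exact: cvg_cst.
by under eq_fun => n do rewrite big_cons; rewrite big_cons; exact: cvgD.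
Qed.

Lemma cvg_seq_le (R : realType) (f : nat -> R) (x y : R) :
  f @ \oo --> x -> (forall n, f n <= y) -> x <= y.
Proof. by move=> fx fy; apply: (cvgr_to_le fx); apply: nearW. Qed.

Lemma cvg_seq_unique (R : realType) (f : nat -> R) (x y : R) :
  f @ \oo --> x -> f @ \oo --> y -> x = y.
Proof. by move=> fx fy; apply: cvg_unique fx fy; exact: norm_hausdorff. Qed.

(** * Ratios of the growth numbers of parabolic submonoids *)

Section GrowthRate.
Local Open Scope nat_scope.
Local Open Scope group_scope.
Variables (R : realType) (G : finType) (M : coxeterMatrix G).
Hypothesis fin : finite_type M.

Local Notation W := (presMonoid (cox_rel M)).
Local Notation c_ := (pres_word (cox_rel M)).
Local Notation s := (pres_gen (cox_rel M)).
Local Notation l := (len s).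
Implicit Types (a b c d : G) (u v : seq G) (w : W) (I J K : {set G}).
Local Notation acnt := (acnt M).
Local Notation ccnt := (ccnt M).
Local Notation w0 := (wJ M [set: G]%SET).

(** * Strong connection of the graph of descents within a component *)

Section Component.
Variables (J : {set G}) (a0 : G).
Hypothesis a0J : a0 \in J.

(** The recurrence of [ccnt] as a graph: a simple factor [w] leads from [I] to its right descents,
    with its length as delay. *)
Let E I : seq ({set G} * nat) :=
  [seq (wdr w, l w) | w <- wenum M & [&& w != 1, wsupp J w & wdl w \subset I]].
Let edge : rel {set G} := fun I I' => has (fun e => e.1 == I') (E I).
Let reach I := connect edge [set a0]%SET I.

Lemma edgeP I I' : reflect
  (exists w, [/\ w != 1, wsupp J w, wdl w \subset I & I' = wdr w]) (edge I I').
Proof.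
apply: (iffP hasP) => [[e /mapP[w]]|[w [w1 Jw wI ->]]].
  rewrite mem_filter => /andP[/and3P[w1 Jw wI] _] -> /eqP <-.
  by exists w.
exists (wdr w, l w) => //; apply/mapP; exists w => //.
by rewrite mem_filter w1 Jw wI mem_wenum.
Qed.

Let adj : rel G := fun b c => [&& b \in J, c \in J, b != c & M b c != Some 2].
Let comp : {set G} := [set b | connect adj a0 b]%SET.

Lemma comp_sub b : b \in comp -> b \in J.
Proof.
rewrite inE => /connectP[p]; elim: p a0 a0J => [|c p IH] d dJ /=; first by move=> _ ->.
by move=> /andP[/and4P[_ cJ _ _] pth]; exact: IH.
Qed.

Lemma gen_comm b c : b \in comp -> c \in J -> c \notin comp -> s b * s c = s c * s b.
Proof.
move=> bc cJ nc; have bc' : b != c by apply: contraNneq nc => <-.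
have mbc : M b c = Some 2.
  apply/eqP; apply/negPn/negP => m2; move/negP: nc; apply; rewrite inE.
  have bJ := comp_sub bc; rewrite inE in bc; apply: connect_trans bc (connect1 _).
  by rewrite /adj cJ bc' m2 bJ.
have := alternating_braid bc' mbc.
by rewrite !pres_word_cons !mulg1.
Qed.

Lemma word_comm u b : all (mem comp) u -> b \in J -> b \notin comp ->
  s b * c_ u = c_ u * s b.
Proof.
move=> + bJ nb; elim: u => [|c u IH] /=; first by rewrite mulg1 mul1g.
move=> /andP[cc uc]; rewrite pres_word_cons -mulgA -IH // !mulgA.
by rewrite (gen_comm cc bJ nb).
Qed.

(* A first letter outside the component could be moved to the front. *)
Lemma word_comp u v : reduced M (u ++ v) -> all (mem comp) u -> all (mem J) v ->
  wdl (c_ (u ++ v)) \subset comp -> all (mem comp) v.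
Proof.
elim: v u => [//|b v IH] u red uc /andP[bJ vJ] wc /=; apply/andP.
have bc : b \in comp.
  apply/negPn/negP => nb; move/negP: (nb); apply; apply: (fintype.subsetP wc).
  have E' : s b * c_ (u ++ b :: v) = c_ (u ++ v).
    rewrite !pres_word_cat pres_word_cons (mulgA (s b)) (@word_comm u b) //.
    by rewrite -(mulgA (c_ u)) gen_mulKg.
  rewrite inE wle_gen E' (eqP red).
  by apply: leq_ltn_trans (len_word_le _ _) _; rewrite !size_cat /= addnS.
split => //; apply: (IH (rcons u b)); rewrite ?cat_rcons //.
by rewrite all_rcons /= bc uc.
Qed.

Lemma wdl_comp w : wsupp J w -> wdl w \subset comp -> wsupp comp w.
Proof.
move=> Jw wc; apply: (@word_comp [::]) => //; first exact: reduced_rword.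
by rewrite /= rwordK.
Qed.

Lemma reach_comp I : reach I -> I != finset.set0 /\ I \subset comp.
Proof.
move=> /connectP[p].
have : [set a0]%SET != finset.set0 /\ [set a0]%SET \subset comp.
  split; first by apply/set0Pn; exists a0; rewrite inE.
  by rewrite finset.sub1set inE connect0.
elim: p [set a0]%SET => [|I' p IH] K KP /=; first by move=> _ ->.
move=> /andP[/edgeP[w [w1 Jw wK ->]] pth]; apply: IH pth.
split; first exact: wdr_neq0.
have cw : wsupp comp w by apply: wdl_comp => //; case: KP => _; exact: fintype.subset_trans.
by apply/fintype.subsetP => b; exact: wdr_supp.
Qed.

Lemma edge_gen I b : b \in I -> b \in J -> edge I [set b]%SET.
Proof.
move=> bI bJ; apply/edgeP; exists (s b).
by rewrite gen_neq1 wsupp_gen bJ wdl_gen wdr_gen finset.sub1set.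
Qed.

Lemma redp_pair b c : b != c -> redp (s b) (s c).
Proof.
by move=> bc; rewrite redp_gen; apply: contra bc => /wle_gen_eq/cgen_inj->.
Qed.

Lemma len_pair b c : b != c -> l (s b * s c : W) = 2.
Proof. by move=> bc; rewrite (eqP (redp_pair bc)) !len_s. Qed.

Lemma wdr_pair b c : b != c -> c \in wdr (s b * s c).
Proof. by move=> bc; rewrite inE gen_mulgK len_s len_pair. Qed.

(** If [c] were a descent too, an alternating word of length [M b c >= 3] would lie below an element
    of length 2. *)
Lemma wdl_pair b c : b != c -> M b c != Some 2 -> wdl (s b * s c) = [set b]%SET.
Proof.
move=> bc m2; apply/setP => e; rewrite !inE; apply/idP/eqP => [ew|->]; last first.
  by rewrite wle_mul redp_pair.
have : e \in [set b; c]%SET.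
  apply: (@wdl_supp _ _ _ (s b * s c)); last by rewrite inE.
  by rewrite wsupp_mul ?redp_pair // !wsupp_gen !inE !eqxx orbT.
rewrite !inE => /orP[/eqP //|/eqP ec]; rewrite ec in ew.
have bw : wle (s b) (s b * s c) by rewrite wle_mul redp_pair.
have [L HL] := len_bounded fin.
have [m mbc] := label_finite b c HL.
have := @join_alternating _ _ b c _ m bc bw ew; rewrite mbc => /(_ (leqnn _))/wle_len.
have : reduced M (alternating b c m) by apply: reduced_alternating; rewrite ?mbc.
move=> /eqP->; rewrite size_mkseq len_pair //.
have := cox_ge2 bc mbc; move: m2; rewrite mbc => /eqP m2 le1 le2.
by case: m2; congr Some; apply/eqP; rewrite eqn_leq le1 le2.
Qed.

Lemma edge_pair b c : adj b c ->
  exists2 I, edge [set b]%SET I & c \in I.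
Proof.
move=> /and4P[bJ cJ bc m2]; exists (wdr (s b * s c)); last exact: wdr_pair.
apply/edgeP; exists (s b * s c); rewrite wdl_pair // fintype.subxx.
rewrite wsupp_mul ?redp_pair // !wsupp_gen bJ cJ; split => //.
by apply: contra_eq_neq (len_pair bc) => ->; rewrite len1.
Qed.

Lemma adj_sym : symmetric adj.
Proof.
move=> b c; rewrite /adj eq_sym cox_sym.
by case: (b \in J); case: (c \in J).
Qed.

(** After a descent [b] of [I] has been isolated, the factors [s b * s c] walk along the edges of
    the Coxeter graph up to [a0]. *)
Lemma reach_back I : reach I -> connect edge I [set a0]%SET.
Proof.
move=> /reach_comp[/set0Pn[b bI] /fintype.subsetP/(_ b bI) bc].
apply: connect_trans (connect1 (edge_gen bI (comp_sub bc))) _.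
rewrite inE (sym_connect_sym adj_sym) in bc.
have /connectP[p] := bc; elim: p b {bI bc} => [|c p IH] b /=; first by move=> _ ->.
move=> /andP[bc pth] lst; have [I' bI' cI'] := edge_pair bc.
have cJ : c \in J by have /and4P[] := bc.
apply: connect_trans (connect1 bI') (connect_trans (connect1 (edge_gen cI' cJ)) _).
exact: IH.
Qed.

Lemma len_w0 w : l w <= l w0.
Proof. by apply/wle_len/wle_w0. Qed.

Lemma ccnt_ratio : exists2 rho : R, (0 < rho <= 1)%R &
  (fun n => (ccnt J [set a0]%SET n)%:R / (ccnt J [set a0]%SET n.+1)%:R)%R @ \oo --> rho.
Proof.
apply: (@ratio_limit R _ (fun I n => (ccnt J I n)%:R)%R E (l w0) #|G|%:R%R [set a0]%SET).
- move=> I n rI Dn.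
  have n0 : 0 < n by apply: leq_trans Dn; have := len_w0 (s a0); rewrite len_s.
  rewrite ccnt_rec // natr_sum big_map big_filter /=; apply: eq_bigl => w.
  by rewrite (leq_trans (len_w0 w) Dn) andbT.
- move=> I e /mapP[w]; rewrite mem_filter => /andP[/and3P[w1 _ _] _] -> /=.
  rewrite len_w0 andbT lt0n; apply: contra w1 => /eqP lw0; apply/eqP.
  exact: (@len0 _ (cox_rel M)).
- move=> I n /reach_comp[/set0Pn[b bI] /fintype.subsetP/(_ b bI) bc].
  by rewrite ltr0n; apply: ccnt_gt0 bI (comp_sub bc).
- by move=> I n _; rewrite -natrM ler_nat ccnt_growth.
(* The loop of delay 1 is the simple factor [s a0]. *)
- apply/mapP; exists (s a0); last by rewrite wdr_gen len_s.
  by rewrite mem_filter gen_neq1 wsupp_gen a0J wdl_gen fintype.subxx mem_wenum.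
- by move=> I; exact: reach_back.
Qed.

End Component.

(** For a positive sequence and positive [r], the ratio test makes [r] the radius of convergence of
    the generating series of [q]. *)
Definition has_ratio (q : nat -> nat) (r : R) :=
  (fun n => (q n)%:R / (q n.+1)%:R)%R @ \oo --> r.

(** The convolution of [acnt_conv] takes the smaller of the two limits. The sequence with this limit
    plays the part of [a] in the convolution lemma, and its lower bound [a_big] has a different
    source in the two cases. *)
Lemma acnt_ratio_step J a (rho : R) : a \in J -> (0 < rho <= 1)%R ->
  has_ratio (ccnt J [set a]%SET) rho ->
  (forall K, #|K| < #|J| -> K != finset.set0 -> exists rK : R,
     [/\ (0 < rK <= 1)%R, has_ratio (acnt K) rK & forall n, (1 <= (acnt K n)%:R * rK ^+ n)%R]) ->
  exists rJ : R, [/\ (0 < rJ <= 1)%R, has_ratio (acnt J) rJ, (rJ <= rho)%R &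
     (J :\ a = finset.set0 /\ rJ = rho) \/ exists rK, [/\ J :\ a != finset.set0, has_ratio (acnt (J :\ a)%SET) rK & rJ = Num.min rho rK]].
Proof.
move=> aJ /andP[rho0 rho1] Hrho IH.
set K := (J :\ a)%SET.
have [K0|Kn0] := eqVneq K finset.set0.
  exists rho; rewrite rho0 rho1; split => //; last by left.
  rewrite /has_ratio (_ : acnt J = ccnt J [set a]%SET) //.
  apply/funext => n; rewrite (acnt_conv fin n aJ) -/K K0 big_ord_recl acnt0 mul1n subn0.
  by rewrite big1 ?addn0 // => i _; rewrite acnt0.
have [b bK] := set0Pn _ Kn0.
have [|rK [/andP[rK0 rK1] HK KB]] := IH K _ Kn0; first by rewrite [X in _ < X](cardsD1 a) aJ.
have cv n : (acnt J n)%:R = cauchy_prod (fun n => (acnt K n)%:R%R : R) (fun n => (ccnt J [set a]%SET n)%:R%R) n.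
  by rewrite (acnt_conv fin n aJ) natr_sum; apply: eq_bigr => i _; rewrite natrM.
have cv' n : (acnt J n)%:R = cauchy_prod (fun n => (ccnt J [set a]%SET n)%:R%R : R) (fun n => (acnt K n)%:R%R) n.
  rewrite cv /cauchy_prod (reindex_inj rev_ord_inj) /=; apply: eq_bigr => i _.
  by rewrite subSS subKn 1?mulrC // -ltnS.
have Kgt0 n : (0 < (acnt K n)%:R :> R)%R by rewrite ltr0n (acnt_gt0 fin n bK).
have Cgt0 n : (0 < (ccnt J [set a]%SET n)%:R :> R)%R.
  by rewrite ltr0n; apply: (ccnt_gt0 fin _ _ aJ); rewrite inE.
have Kle n : ((acnt K n)%:R <= (acnt K n.+1)%:R :> R)%R by rewrite ler_nat (acnt_le fin n bK).
have Cle n : ((ccnt J [set a]%SET n)%:R <= (ccnt J [set a]%SET n.+1)%:R :> R)%R.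
  by rewrite ler_nat ccnt_le.
exists (Num.min rho rK); split; last by right; exists rK.
- by rewrite lt_min rho0 rK0 ge_min rho1.
- rewrite /has_ratio; have [rr|rr] := leP rK rho.
    (* For [rK <= rho], equality included, the bound comes from [1 <= acnt K i * rK ^+ i], an
       instance of submultiplicativity. *)
    under eq_fun => n do rewrite !cv.
    by apply: (@cauchy_prod_limit R _ _ rK rho 1 0) => // i _; apply: le_trans (KB i) _;
      rewrite ler_pM2l // lerXn2r // nnegrE ltW.
  under eq_fun => n do rewrite !cv'.
  have /cvgrPdist_le/(_ (rK - rho)%R) := Hrho.
  case; first by rewrite subr_gt0.
  move=> N _ HN.
  apply: (@cauchy_prod_limit R _ _ rho rK ((ccnt J [set a]%SET N)%:R * rK ^+ N)%R N) => //.
  - exact: ltW.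
  - by rewrite mulr_gt0 // exprn_gt0.
  (* From [N] on the ratios of [ccnt] are at most [rK], so that [ccnt i * rK ^+ i] does not
     decrease. *)
  elim=> [|i IHi]; first by rewrite leqn0 => /eqP->.
  rewrite leq_eqVlt => /orP[/eqP-> //|Ni]; apply: le_trans (IHi Ni) _.
  rewrite exprS mulrA ler_pM2r ?exprn_gt0 // -ler_pdivrMr //.
  have := HN i Ni => /=; rewrite distrC => /(le_trans (ler_norm _)) H.
  rewrite ler_pdivrMr // mulrC -ler_pdivrMr //.
  by move: H; rewrite lerBlDr subrK.
- by rewrite ge_min lexx.
Qed.

Lemma ratio_shift (q : nat -> nat) (r : R) k : (forall n, 0 < q n) ->
  has_ratio q r -> (fun n => (q n)%:R / (q (n + k)%N)%:R)%R @ \oo --> (r ^+ k)%R.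
Proof.
move=> q0 H; apply: (@ratio_pow R (fun n => (q n)%:R)%R r) => // n.
by rewrite ltr0n.
Qed.

(** By submultiplicativity [acnt J m] is at least [acnt J (k + m) / acnt J k], which tends to
    [r ^- m] as [k] grows; this is the lower bound required for the next convolution. *)
Lemma acnt_ratio J : J != finset.set0 -> exists r : R,
  [/\ (0 < r <= 1)%R, has_ratio (acnt J) r & forall n, (1 <= (acnt J n)%:R * r ^+ n)%R].
Proof.
have [n] := ubnP #|J|; elim: n J => // n IH J ltJ J0.
have [a aJ] := set0Pn _ J0.
have [rho rho01 Hrho] := ccnt_ratio aJ.
have [|r [r01 Hr _ _]] := acnt_ratio_step aJ rho01 Hrho.
  by move=> K ltK K0; apply: IH => //; exact: leq_trans ltK _.
exists r; split => // m.
have q0 k : 0 < acnt J k by exact: acnt_gt0 aJ.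
have := ratio_shift (k := m) q0 Hr.
rewrite -ler_pdivrMl ?ltr0n // mulr1 => H.
apply: (cvgr_to_ge H); apply: nearW => k.
rewrite ler_pdivlMr ?ltr0n // ler_pdivrMl ?ltr0n // -natrM ler_nat mulnC.
exact: acnt_mulD.
Qed.

Lemma has_ratio_uniq (q : nat -> nat) (r r' : R) : has_ratio q r -> has_ratio q r' -> r = r'.
Proof. exact: cvg_seq_unique. Qed.

Lemma acnt_ratio_le J a (r rho : R) : a \in J -> has_ratio (acnt J) r ->
  (0 < rho <= 1)%R -> has_ratio (ccnt J [set a]%SET) rho -> (r <= rho)%R.
Proof.
move=> aJ Hr rho01 Hrho.
have [K _ K0|rJ [_ HJ le _]] := acnt_ratio_step aJ rho01 Hrho; first exact: acnt_ratio.
by rewrite (has_ratio_uniq Hr HJ).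
Qed.

Local Notation A := (presMonoid (braid_rel M)).
Local Notation a_ := (pres_word (braid_rel M)).
Local Notation r_ := (pres_gen (braid_rel M)).
Local Notation L := (len r_).

(** A letter other than [a] could be moved to the front and would be a descent. *)
Lemma desc_commuting (x : A) a : all_commuting M -> desc x \subset [set a]%SET ->
  x = a_ (nseq (L x) a).
Proof.
move=> comm; elim/artin_ind: x => [|b x IH]; first by rewrite len_a1.
move=> /fintype.subsetP dx; have /eqP ba : b == a.
  by have := dx b; rewrite inE; apply; apply/descP => //; exists x.
rewrite ba in dx *; rewrite len_aM len_r add1n /= pres_word_cons -IH //.
apply/fintype.subsetP => c /(descP fin)[y xE]; rewrite inE; apply/negPn/negP => ca.
have := dx c; rewrite inE (negbTE ca) => H; apply/notF/H/(descP fin).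
exists (r_ a * y); rewrite xE !mulgA; congr (_ * _).
rewrite -!pres_word_cons; apply/pres_wordP/pres_rel.
by exists a, c, 2; rewrite eq_sym ca comm // eq_sym.
Qed.

(** The elements with descents in [{a}] are the powers of [a], one of each length, so that every
    factor of the convolution has ratio limit 1. *)
Lemma acnt_ratio_commuting J (r : R) : all_commuting M -> J != finset.set0 ->
  has_ratio (acnt J) r -> r = 1%R.
Proof.
move=> comm; have [n] := ubnP #|J|; elim: n J r => // n IH J r ltJ J0 Hr.
have [a aJ] := set0Pn _ J0.
have C1 k : ccnt J [set a]%SET k = 1%N.
  apply/eqP; rewrite eqn_leq; apply/andP; split; last by apply: (ccnt_gt0 fin _ _ aJ); rewrite inE.
  have -> : 1%N = acount k (pred1 (a_ (nseq k a))).
    by rewrite /acount count_uniq_mem ?undup_uniq // mem_alist len_a size_nseq eqxx.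
  rewrite /ccnt /acount -!size_filter; apply: uniq_leq_size.
    by rewrite filter_uniq ?undup_uniq.
  move=> x; rewrite !mem_filter mem_alist => /andP[/andP[_ dx] /eqP Lx] /=.
  by rewrite {1}(desc_commuting comm dx) Lx !eqxx.
have H1 : has_ratio (ccnt J [set a]%SET) 1.
  rewrite /has_ratio (_ : (fun _ => _) = cst 1%R); first exact: cvg_cst.
  by apply/funext => k /=; rewrite !C1 divr1.
have [||rJ [_ HJ le Hmin]] := acnt_ratio_step aJ _ H1; first by rewrite ltr01 lexx.
  by move=> K _ K0; exact: acnt_ratio.
rewrite (has_ratio_uniq Hr HJ); case: Hmin => [[] //|[rK [K0 HK ->]]].
rewrite (IH _ rK _ K0 HK) ?minxx //.
by move: ltJ; rewrite (cardsD1 a) aJ.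
Qed.

(** Besides the loop [s a], the factors [s a * s b] and [s b * s a] in succession allow a second
    return to [{a}] with total delay 4; in the limit [rho + rho ^+ 4 <= 1]. *)
Lemma acnt_ratio_lt1 J (r : R) a b : a \in J -> b \in J -> a != b -> M a b != Some 2 ->
  has_ratio (acnt J) r -> (r < 1)%R.
Proof.
move=> aJ bJ ab m2 Hr.
have [rho rho01 Hrho] := ccnt_ratio aJ.
apply: le_lt_trans (acnt_ratio_le aJ Hr rho01 Hrho) _.
have ba : b != a by rewrite eq_sym.
have m2' : M b a != Some 2 by rewrite cox_sym.
have pairJ c d : c != d -> c \in J -> d \in J -> wsupp J (s c * s d).
  by move=> cd cJ dJ; rewrite wsupp_mul ?redp_pair // !wsupp_gen cJ.
have pair1 c d : c != d -> s c * s d != 1 :> W.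
  by move=> cd; apply: contra_eq_neq (len_pair cd) => ->; rewrite len1.
have step I w k : w != 1 -> wsupp J w -> wdl w \subset I -> l w <= k -> 0 < k ->
    ccnt J (wdr w) (k - l w) <= ccnt J I k.
  move=> w1 Jw wI lw k0; rewrite [leqRHS]ccnt_rec // big_mkcond.
  by rewrite (bigD1_seq w) ?mem_wenum ?wenum_uniq //= w1 Jw wI lw leq_addr.
have key n : ccnt J [set a]%SET n.+3 + ccnt J [set a]%SET n <= ccnt J [set a]%SET n.+4.
  rewrite [leqRHS]ccnt_rec // big_mkcond (bigD1_seq (s a)) ?mem_wenum ?wenum_uniq //=.
  rewrite gen_neq1 wsupp_gen aJ wdl_gen fintype.subxx len_s wdr_gen /= subn1 leq_add2l.
  rewrite big_mkcond (bigD1_seq (s a * s b)) ?mem_wenum ?wenum_uniq //=.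
  rewrite pair1 // pairJ // wdl_pair // fintype.subxx len_pair //= !subSS subn0.
  have -> : s a * s b != s a.
    by apply: contra_eq_neq (len_pair ab) => ->; rewrite len_s.
  apply: leq_trans (leq_addr _ _).
  apply: (@leq_trans (ccnt J [set b]%SET n.+2)); last first.
    by apply: ccnt_mono; rewrite finset.sub1set wdr_pair.
  have := step [set b]%SET (s b * s a) n.+2.
  rewrite pair1 // pairJ // wdl_pair // fintype.subxx len_pair //= !subSS subn0.
  move=> /(_ isT isT isT isT isT); apply: leq_trans; apply: ccnt_mono.
  by rewrite finset.sub1set wdr_pair.
have Cgt0 n : 0 < ccnt J [set a]%SET n by apply: (ccnt_gt0 fin _ _ aJ); rewrite inE.
have H4 := ratio_shift (k := 4%N) Cgt0 Hrho.
have H1 : (fun n => (ccnt J [set a]%SET n.+3)%:R / (ccnt J [set a]%SET n.+4)%:R)%R @ \oo --> rho.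
  have := cvg_comp _ _ (cvg_addnr 3) Hrho; apply: cvg_trans; apply: near_eq_cvg.
  by apply: nearW => n /=; rewrite addn3.
have : (rho + rho ^+ 4 <= 1)%R.
  have H5 : (fun n => (ccnt J [set a]%SET n.+3)%:R / (ccnt J [set a]%SET n.+4)%:R +
     (ccnt J [set a]%SET n)%:R / (ccnt J [set a]%SET (n + 4)%N)%:R : R)%R @ \oo -->
     (rho + rho ^+ 4)%R by exact: cvgD H1 H4.
  apply: (cvg_seq_le H5) => n; rewrite addn4 -mulrDl ler_pdivrMr ?ltr0n // mul1r -natrD ler_nat.
  exact: key.
have /andP[rho0 _] := rho01.
by apply: lt_le_trans; rewrite ltrDl exprn_gt0.
Qed.

Local Notation p := (acnt [set: G]%SET).
Local Notation d_ J := (l (wJ M J)).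

Definition growth_poly (t : R) : R := (\sum_(J : {set G}) (-1) ^+ #|J| * t ^+ d_ J)%R.

Lemma acnt_recurrence n : 0 < n ->
  (\sum_(J : {set G}) (-1) ^+ #|J| *
    (if (d_ J <= n)%N then (p (n - d_ J)%N)%:R else 0) = 0 :> R)%R.
Proof.
move=> n0; have := congr1 (fun k : int => k%:~R%R : R) (acount_mobius fin n).
rewrite rmorph_sum /= (gtn_eqF n0) mulr0z => H; rewrite -[RHS]H.
apply: eq_bigr => J _; rewrite rmorphM rmorphXn /= rmorphN1; congr (_ * _)%R.
by case: ifP.
Qed.

(** The recurrence at [m + D] is divided by [p (m + D)]; the shift by [D], the largest degree, keeps
    all its indices nonnegative, and the terms converge to those of the polynomial. *)
Lemma growth_poly_root (r : R) : (forall n, 0 < p n) -> has_ratio p r ->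
  growth_poly r = 0%R.
Proof.
move=> p0 Hr; set D := l w0.
have cv J : (fun m => (p (m + (D - d_ J))%N)%:R / (p (m + D)%N)%:R)%R @ \oo --> (r ^+ d_ J)%R.
  have := cvg_comp _ _ (cvg_addnr (D - d_ J)) (ratio_shift (k := d_ J) p0 Hr).
  apply: cvg_trans; apply: near_eq_cvg; near=> m => /=.
  by rewrite -addnA subnK // len_w0.
have cvs : (fun m => \sum_(J : {set G}) (-1) ^+ #|J| *
    ((p (m + (D - d_ J))%N)%:R / (p (m + D)%N)%:R))%R @ \oo --> growth_poly r.
  apply: cvg_sumr => J; exact: cvgMr.
apply: (cvg_seq_unique cvs).
have : (fun=> 0%R : R) @ \oo --> (0%R : R) by exact: cvg_cst.
apply: cvg_trans; apply: near_eq_cvg; near=> m => /=.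
have m0 : 0 < m + D by near: m; exists 1%N => // m /= m1; rewrite addn_gt0 m1.
apply/esym; transitivity ((\sum_(J : {set G}) (-1) ^+ #|J| *
    (if (d_ J <= m + D)%N then (p (m + D - d_ J)%N)%:R else 0)) / (p (m + D)%N)%:R : R)%R;
  last by rewrite acnt_recurrence ?mul0r.
rewrite mulr_suml.
apply: eq_bigr => J _; rewrite -mulrA; congr (_ * (_ / _))%R.
have dD : d_ J <= D by exact: len_w0.
by rewrite (leq_trans dD (leq_addl _ _)) addnBA.
Unshelve. all: by end_near.
Qed.

(** Below [r] the generating series of [p] converges, and its product with the polynomial is 1. The
    argument uses partial sums [S] only, whose differences over bounded distances tend to 0. *)
Lemma growth_poly_neq0 (r t : R) : (forall n, 0 < p n) -> has_ratio p r ->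
  (0 < t < r)%R -> growth_poly t != 0%R.
Proof.
move=> p0 Hr /andP[t0 tr]; apply/eqP => N0.
pose e k : R := ((p k)%:R * t ^+ k)%R.
(* Eventually [p k / p k.+1 >= t'], so that the terms [e k] decay at least like powers of
   [t / t' < 1]. *)
pose t' := ((t + r) / 2)%R.
have tt' : (t < t')%R by rewrite /t'; lra.
have t'r : (t' < r)%R by rewrite /t'; lra.
have t'0 : (0 < t')%R by exact: lt_trans tt'.
have [k0 Hk] : exists k0, forall k, k0 <= k -> (e k.+1 <= (t / t') * e k)%R.
  have /cvgrPdist_le/(_ (r - t')%R) := Hr.
  case; first by rewrite subr_gt0.
  move=> k0 _ Hk; exists k0 => k kk; have := Hk k kk => /= /(le_trans (ler_norm _)) H.
  have {}H : (t' <= (p k)%:R / (p k.+1)%:R)%R by lra.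
  rewrite ler_pdivlMr ?ltr0n // in H.
  have -> : (e k.+1 = (t / t') * (t' * (p k.+1)%:R * t ^+ k))%R.
    by rewrite /e exprS; field; rewrite gt_eqF.
  apply: ler_wpM2l; first by rewrite divr_ge0 ?ltW.
  by apply: ler_wpM2r H; rewrite exprn_ge0 ?ltW.
have Hj j : (e (k0 + j)%N <= (t / t') ^+ j * e k0)%R.
  elim: j => [|j IH]; first by rewrite addn0 mul1r.
  rewrite addnS exprS -mulrA; apply: le_trans (Hk _ (leq_addr _ _)) _.
  by apply: ler_wpM2l IH; rewrite divr_ge0 ?ltW.
have e_lim : e @ \oo --> (0%R : R).
  rewrite -(cvg_shiftn k0).
  apply: (@squeeze_cvgr _ _ _ _ (fun=> 0%R) (fun j => (t / t') ^+ j * e k0)%R).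
  - apply: nearW => j; rewrite /= addnC Hj andbT /e mulr_ge0 //.
    by rewrite exprn_ge0 // ltW.
  - exact: cvg_cst.
  rewrite -[X in _ --> X](mul0r (e k0)); apply: cvgMl; apply: cvg_expr.
  have q0 : (0 < t / t')%R by rewrite divr_gt0.
  by rewrite (gtr0_norm q0) ltr_pdivrMr // mul1r.
pose S m : R := (\sum_(k < m) e k)%R.
have S_lim i : (fun m => S (m + i)%N - S m)%R @ \oo --> (0%R : R).
  elim: i => [|i IH].
    rewrite (_ : (fun _ => _) = (fun=> 0%R)); first exact: cvg_cst.
    by apply/funext => m; rewrite addn0 subrr.
  have e_lim' : (fun m => e (m + i)%N) @ \oo --> (0%R : R) by rewrite cvg_shiftn.
  rewrite -[X in _ --> X](addr0 (0%R : R)).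
  have H : (fun m => (S (m + i)%N - S m) + e (m + i)%N)%R @ \oo --> (0 + 0 : R)%R.
    by exact: cvgD IH e_lim'.
  move: H; apply: cvg_trans; apply: near_eq_cvg; apply: nearW => m /=.
  by rewrite addnS /S big_ord_recr /= addrAC.
have inner (d m : nat) : (\sum_(n < d + m) t ^+ n * (if (d <= n)%N then (p (n - d)%N)%:R else 0) =
    t ^+ d * S m)%R.
  elim: m => [|m IH].
    rewrite addn0 /S big_ord0 mulr0 big1 // => n _.
    by rewrite leqNgt ltn_ord mulr0.
  rewrite addnS big_ord_recr /= IH leq_addr addKn /S big_ord_recr /= mulrDr; congr (_ + _)%R.
  by rewrite /e exprD -mulrA [(t ^+ m * _)%R]mulrC.
set D := l w0.
(* This is the product of series and polynomial, truncated after degree [m + D]; subtracting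
   [growth_poly t * S m], which is 0 by assumption, leaves differences of partial sums. *)
have one m : (1 = \sum_(J : {set G}) (-1) ^+ #|J| * t ^+ d_ J * (S (m + (D - d_ J).+1)%N - S m) :> R)%R.
  transitivity (\sum_(J : {set G}) (-1) ^+ #|J| * t ^+ d_ J * S (m + (D - d_ J).+1)%N : R)%R; last first.
    under [RHS]eq_bigr => J _ do rewrite mulrBr.
    by rewrite sumrB -mulr_suml -/(growth_poly t) N0 mul0r subr0.
  transitivity (\sum_(n < (m + D).+1) t ^+ n * (\sum_(J : {set G}) (-1) ^+ #|J| *
    (if (d_ J <= n)%N then (p (n - d_ J)%N)%:R else 0)) : R)%R; last first.
    under eq_bigr => n _ do rewrite mulr_sumr.
    rewrite exchange_big /=; apply: eq_bigr => J _; rewrite -mulrA -inner mulr_sumr.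
    have -> : (d_ J + (m + (D - d_ J).+1) = (m + D).+1)%N.
      by have := len_w0 (wJ M J); rewrite -/D; lia.
    by apply: eq_bigr => n _; rewrite mulrCA.
  rewrite [RHS]big_ord_recl /= [X in (_ + X)%R]big1 ?addr0 => [|i _]; last first.
    by rewrite acnt_recurrence ?mulr0.
  have := congr1 (fun k : int => k%:~R%R : R) (acount_mobius fin 0).
  rewrite rmorph_sum /= expr0 mul1r => H.
  transitivity ((0%N == 0%N)%:Z%:~R : R)%R; first by [].
  rewrite -H.
  apply: eq_bigr => J _; rewrite rmorphM rmorphXn /= rmorphN1; congr (_ * _)%R.
  by case: ifP.
have lim0 : (fun m => \sum_(J : {set G}) (-1) ^+ #|J| * t ^+ d_ J *
    (S (m + (D - d_ J).+1)%N - S m))%R @ \oo --> (\sum_(J : {set G}) 0)%R.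
  apply: cvg_sumr => J; rewrite -[X in _ --> X](mulr0 ((-1) ^+ #|J| * t ^+ d_ J)%R).
  exact: cvgMr.
have : (fun=> 1%R : R) @ \oo --> (\sum_(J : {set G}) 0 : R)%R.
  by move: lim0; apply: cvg_trans; apply: near_eq_cvg; apply: nearW => m /=; rewrite -one.
move=> /cvg_seq_unique/(_ (cvg_cst _)).
by rewrite big1 // => /eqP; rewrite eq_sym oner_eq0.
Qed.

End GrowthRate.

(** * The configuration algebra *)

Section Configurations.
Local Open Scope nat_scope.
Variables (X : monoidType) (G : finType) (gen : G -> X).

Local Notation conf := (conf gen).
Local Notation cls := (conf_of gen).
Local Notation edge := (edge gen).
Implicit Types (Y Z V : {fset X}) (S U : conf) (x y : X) (a : G).

(** Isomorphisms as total maps of [X], considered on [Y] only; they can be restricted and glued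
    without dependent types. *)
Definition graph_iso (f : X -> X) Y Z :=
  [/\ {in Y &, injective f}, Z = [fset f x | x in Y]%fset &
      forall x y a, x \in Y -> y \in Y -> ((x * gen a)%g = y <-> (f x * gen a)%g = f y)].

Lemma conf_ofP Y Z : cls Y = cls Z <-> exists f, graph_iso f Y Z.
Proof.
split=> [/eqquotP/asboolP[f [[g fK gK] fiso]]|[f [finj ZE fiso]]].
  pose h x := if insub x is Some u then val (f u) else x.
  have hE x (xY : x \in Y) : h x = val (f [` xY]%fset) by rewrite /h insubT.
  exists h; split.
  - move=> x y xY yY; rewrite !hE => /val_inj/(can_inj fK)/(congr1 val); exact.
  - apply/fsetP => z; apply/idP/imfsetP => [zZ|[x xY ->]].
      exists (val (g [` zZ]%fset)); first exact: valP.
      rewrite hE; first exact: valP.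
      by move=> gY; rewrite (_ : [` gY]%fset = g [` zZ]%fset) ?gK //; exact: val_inj.
    by rewrite hE; exact: valP.
  - move=> x y a xY yY; rewrite !hE; exact: (fiso [` xY]%fset [` yY]%fset a).
have fZ (u : Y) : f (val u) \in Z by rewrite ZE; apply/imfsetP; exists (val u) => //; exact: valP.
apply/eqquotP/asboolP; exists (fun u => [` fZ u]%fset); split; last first.
  by move=> x y a; apply: fiso; exact: valP.
apply: inj_card_bij => [u v /(congr1 val)/= /finj E|].
  by apply: val_inj; apply: E; exact: valP.
by rewrite -!cardfE ZE card_in_imfset.
Qed.

Lemma graph_iso_sub f Y Z Y' : graph_iso f Y Z -> (Y' `<=` Y)%fset ->
  graph_iso f Y' [fset f x | x in Y']%fset.
Proof.
move=> [finj _ fiso] /fsubsetP Y'Y; split=> // [x y /Y'Y xY /Y'Y yY|x y a /Y'Y xY /Y'Y yY].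
  exact: finj.
exact: fiso.
Qed.

Lemma conf_of_repr S : cls (repr S) = S.
Proof. exact: reprK. Qed.

Lemma conf_of_card Y Z : cls Y = cls Z -> #|` Y| = #|` Z|.
Proof. by move=> /conf_ofP[f [finj -> _]]; rewrite card_in_imfset. Qed.

Lemma conf_deg_of Y : conf_deg (cls Y) = #|` Y|.
Proof. by apply: conf_of_card; exact: conf_of_repr. Qed.

Lemma conf_of0 Y : (cls Y == cls fset0) = (Y == fset0).
Proof.
apply/eqP/eqP => [/conf_of_card|-> //].
by rewrite cardfs0 => /cardfs0_eq.
Qed.

Lemma big_fpowerset_iso (R : nmodType) f Y Z (F : {fset X} -> R) : graph_iso f Y Z ->
  (\sum_(Z' <- fpowerset Z) F Z' = \sum_(Y' <- fpowerset Y) F [fset f x | x in Y']%fset)%R.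
Proof.
move=> fi; have [finj ZE _] := fi.
rewrite -(big_map (fun Y' => [fset f x | x in Y']%fset) xpredT F).
apply: perm_big; apply: uniq_perm; first exact: fset_uniq.
  rewrite map_inj_in_uniq; first exact: fset_uniq.
  suff H V V' : V \in fpowerset Y -> V' \in fpowerset Y ->
    [fset f x | x in V]%fset = [fset f x | x in V']%fset -> {subset V <= V'}.
    by move=> V V' VY V'Y E; apply/fsetP => x; apply/idP/idP; apply: H => //; rewrite E.
  rewrite !fpowersetE => /fsubsetP VY /fsubsetP V'Y E x xV.
  have : f x \in [fset f x | x in V']%fset by rewrite -E; apply/imfsetP; exists x.
  move=> /imfsetP[y /= yV' /finj ->] //; [exact: VY|exact: V'Y].
move=> V; apply/idP/mapP; rewrite fpowersetE.
  move=> VZ; exists [fset x in Y | f x \in V]%fset.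
    by rewrite fpowersetE; apply/fsubsetP => x; rewrite !inE => /andP[].
  apply/fsetP => z; apply/idP/imfsetP => [zV|[x + ->]]; last by rewrite !inE => /andP[].
  have := fsubsetP VZ z zV; rewrite ZE => /imfsetP[x /= xY E].
  by exists x; rewrite // !inE xY -E.
move=> [Y']; rewrite fpowersetE => /fsubsetP Y'Y ->; rewrite ZE.
by apply/fsubsetP => z /imfsetP[x /= /Y'Y xY ->]; apply/imfsetP; exists x.
Qed.

Lemma big_fpowerset_class (R : nmodType) Y Z (F : conf -> R) : cls Y = cls Z ->
  (\sum_(Y' <- fpowerset Y) F (cls Y') = \sum_(Z' <- fpowerset Z) F (cls Z'))%R.
Proof.
move=> /conf_ofP[f fi]; rewrite (big_fpowerset_iso _ fi) big_seq [RHS]big_seq.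
apply: eq_bigr => V; rewrite fpowersetE => VY; congr F; apply/conf_ofP; exists f.
exact: (graph_iso_sub fi).
Qed.

Lemma subgraph_countE S Y : subgraph_count S (cls Y) =
  \sum_(Z <- fpowerset Y) (cls Z == S).
Proof.
rewrite -(big_fpowerset_class (fun U => (U == S : nat)) (conf_of_repr (cls Y))).
rewrite /subgraph_count card_fset_sum1 big_fset /= big_mkcond; apply: eq_bigr => Z _.
by case: (_ == _).
Qed.

Definition detached Y Z := [disjoint Y & Z]%fset /\
  forall x y, x \in Y -> y \in Z -> ~~ edge x y && ~~ edge y x.

Lemma detachedC Y Z : detached Y Z -> detached Z Y.
Proof.
move=> [d e]; split=> [|x y xZ yY]; first by rewrite fdisjoint_sym.
by rewrite andbC e.
Qed.

Lemma detached_sub Y Z Y' Z' : detached Y Z -> (Y' `<=` Y)%fset -> (Z' `<=` Z)%fset ->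
  detached Y' Z'.
Proof.
move=> [d e] YY ZZ; split; first by apply: fdisjointWl YY _; exact: fdisjointWr ZZ d.
by move=> x y /(fsubsetP YY) xY /(fsubsetP ZZ); exact: e.
Qed.

Lemma detachedU Y Z V : detached Y Z -> detached Y V -> detached Y (Z `|` V)%fset.
Proof.
move=> [d e] [d' e']; split; first by rewrite fdisjointXU d.
by move=> x y xY; rewrite inE => /orP[]; [exact: e|exact: e'].
Qed.

Lemma graph_iso_edge f Y Z x y : graph_iso f Y Z -> x \in Y -> y \in Y ->
  edge (f x) (f y) = edge x y.
Proof.
move=> [_ _ fiso] xY yY; apply/existsP/existsP => -[a /eqP E]; exists a; apply/eqP.
  by apply/fiso.
by apply/(fiso _ _ a xY yY).
Qed.

Lemma graph_iso_detached f Y Z Y1 Y2 : graph_iso f Y Z ->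
  (Y1 `<=` Y)%fset -> (Y2 `<=` Y)%fset -> detached Y1 Y2 ->
  detached [fset f x | x in Y1]%fset [fset f x | x in Y2]%fset.
Proof.
move=> fi /fsubsetP Y1Y /fsubsetP Y2Y [d e]; have [finj _ _] := fi; split.
  apply/fdisjointP => z /imfsetP[x /= xY ->]; apply/imfsetP => -[y /= yY /finj E].
  by have := fdisjointP d x xY; rewrite (E (Y1Y _ xY) (Y2Y _ yY)) yY.
move=> z t /imfsetP[x /= xY ->] /imfsetP[y /= yY ->].
have xY' := Y1Y _ xY; have yY' := Y2Y _ yY.
by rewrite (graph_iso_edge fi xY' yY') (graph_iso_edge fi yY' xY') e.
Qed.

Lemma conf_prodP S1 S2 V : conf_prod S1 S2 (cls V) <->
  exists Y1 Y2, [/\ cls Y1 = S1, cls Y2 = S2, detached Y1 Y2 & V = (Y1 `|` Y2)%fset].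
Proof.
split=> [[Y1 [Y2 [<- <- d e /conf_ofP[f fi]]]]|[Y1 [Y2 [? ? [d e] ->]]]]; last first.
  by exists Y1, Y2.
have sub1 : (Y1 `<=` Y1 `|` Y2)%fset by exact: fsubsetUl.
have sub2 : (Y2 `<=` Y1 `|` Y2)%fset by exact: fsubsetUr.
exists [fset f x | x in Y1]%fset, [fset f x | x in Y2]%fset; split.
- by apply/esym/conf_ofP; exists f; exact: (graph_iso_sub fi).
- by apply/esym/conf_ofP; exists f; exact: (graph_iso_sub fi).
- exact: (graph_iso_detached fi).
- by have [_ -> _] := fi; rewrite imfsetU.
Qed.

Lemma conf_of_union Y1 Y2 Z1 Z2 : cls Y1 = cls Z1 -> cls Y2 = cls Z2 ->
  detached Y1 Y2 -> detached Z1 Z2 -> cls (Y1 `|` Y2)%fset = cls (Z1 `|` Z2)%fset.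
Proof.
move=> /conf_ofP[f [finj ZE fiso]] /conf_ofP[g [ginj ZE' giso]] [d e] [d' e'].
apply/conf_ofP; pose h x := if x \in Y1 then f x else g x; exists h.
have h1 x : x \in Y1 -> h x = f x by rewrite /h => ->.
have n21 x : x \in Y2 -> x \in Y1 = false.
  by move=> x2; apply/negbTE/(fdisjointP_sym d).
have h2 x : x \in Y2 -> h x = g x by rewrite /h => /n21->.
have fZ x : x \in Y1 -> f x \in Z1 by rewrite ZE => ?; apply/imfsetP; exists x.
have gZ x : x \in Y2 -> g x \in Z2 by rewrite ZE' => ?; apply/imfsetP; exists x.
have no x y : x \in Y1 -> y \in Y2 -> f x <> g y.
  by move=> /fZ x1 /gZ y2 E; have := fdisjointP d' _ x1; rewrite E y2.
have noe x y a : edge x y = false -> (x * gen a)%g <> y.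
  by move=> /existsP H E; apply: H; exists a; apply/eqP.
split.
- move=> x y; rewrite !inE => /orP[] xY /orP[] yY; rewrite ?(h1 _ xY) ?(h2 _ xY) ?(h1 _ yY) ?(h2 _ yY).
  + exact: finj.
  + by move=> /no; case.
  + by move=> /esym/no; case.
  + exact: ginj.
- apply/fsetP => z; rewrite inE ZE ZE'; apply/orP/imfsetP.
    case=> /imfsetP[x /= xY ->]; exists x; rewrite ?inE ?xY ?orbT //.
      by rewrite h1.
    by rewrite h2.
  move=> [x]; rewrite /= inE => /orP[] xY ->; [left|right]; apply/imfsetP; exists x => //.
    exact: h1.
  exact: h2.
- move=> x y a; rewrite !inE => /orP[] xY /orP[] yY;
    rewrite ?(h1 _ xY) ?(h2 _ xY) ?(h1 _ yY) ?(h2 _ yY).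
  + exact: fiso.
  + have /andP[/negbTE E1 _] := e _ _ xY yY.
    have /andP[/negbTE E2 _] := e' _ _ (fZ _ xY) (gZ _ yY).
    by split=> [/(noe _ _ _ E1)|/(noe _ _ _ E2)].
  + have /andP[_ /negbTE E1] := e _ _ yY xY.
    have /andP[_ /negbTE E2] := e' _ _ (fZ _ yY) (gZ _ xY).
    by split=> [/(noe _ _ _ E1)|/(noe _ _ _ E2)].
  + exact: giso.
Qed.

Lemma conf_prod_fun S1 S2 U U' : conf_prod S1 S2 U -> conf_prod S1 S2 U' -> U = U'.
Proof.
move=> [Y1 [Y2 [<- <- d e <-]]] [Z1 [Z2 [E1 E2 d' e' <-]]].
by apply: conf_of_union.
Qed.

Lemma conf_prodC S1 S2 U : conf_prod S1 S2 U -> conf_prod S2 S1 U.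
Proof.
rewrite -(conf_of_repr U) => /conf_prodP[Y1 [Y2 [<- <- s E]]].
by apply/conf_prodP; exists Y2, Y1; split=> //; [exact: detachedC|rewrite E fsetUC].
Qed.

Lemma conf_prodA S1 S2 S3 S12 U : conf_prod S1 S2 S12 -> conf_prod S12 S3 U ->
  exists2 S23, conf_prod S2 S3 S23 & conf_prod S1 S23 U.
Proof.
rewrite -(conf_of_repr U) => P12 /conf_prodP[Y [Y3 [E E3 s EU]]].
move: P12; rewrite -E => /conf_prodP[Y1 [Y2 [E1 E2 s12 EY]]].
have s1 : detached Y1 Y3 by apply: (detached_sub s) => //; rewrite EY fsubsetUl.
have s2 : detached Y2 Y3 by apply: (detached_sub s) => //; rewrite EY fsubsetUr.
exists (cls (Y2 `|` Y3)%fset); apply/conf_prodP; first by exists Y2, Y3.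
exists Y1, (Y2 `|` Y3)%fset; split=> //; first exact: detachedU.
by rewrite EU EY fsetUA.
Qed.

Lemma conf_prod0 S U : conf_prod (cls fset0) S U <-> S = U.
Proof.
rewrite -(conf_of_repr U); split=> [/conf_prodP[Y1 [Y2 [/eqP]]]|->].
  by rewrite conf_of0 => /eqP-> <- _ ->; rewrite fset0U.
apply/conf_prodP; exists fset0, (repr U); split; rewrite ?fset0U //.
by split=> [|x y]; rewrite ?fdisjoint0X ?inE.
Qed.

Lemma conf_prod_deg S1 S2 U : conf_prod S1 S2 U -> conf_deg U = conf_deg S1 + conf_deg S2.
Proof.
rewrite -(conf_of_repr U) => /conf_prodP[Y1 [Y2 [<- <- [/eqP d _] ->]]].
by rewrite !conf_deg_of cardfsU d cardfs0 subn0.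
Qed.

Lemma conf_deg0 S : (conf_deg S == 0) = (S == cls fset0).
Proof. by rewrite cardfs_eq0 -conf_of0 conf_of_repr. Qed.

Definition sub_confs U : seq conf := undup [seq cls Y | Y <- fpowerset (repr U)].

Lemma mem_sub_confs S V : S \in sub_confs (cls V) <-> exists2 Y, (Y `<=` V)%fset & cls Y = S.
Proof.
rewrite mem_undup; have := conf_of_repr (cls V) => /conf_ofP[f fi].
have /esym/conf_ofP[g gi] := conf_of_repr (cls V).
split=> [/mapP[Y]|[Y YV <-]].
  rewrite fpowersetE => YV ->; exists [fset f x | x in Y]%fset.
    have [_ -> _] := fi; apply/fsubsetP => z /imfsetP[x /= xY ->].
    by apply/imfsetP; exists x => //; exact: (fsubsetP YV).
  by apply/esym/conf_ofP; exists f; exact: (graph_iso_sub fi).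
apply/mapP; exists [fset g x | x in Y]%fset; last first.
  by apply/conf_ofP; exists g; exact: (graph_iso_sub gi).
rewrite fpowersetE; have [_ -> _] := gi; apply/fsubsetP => z /imfsetP[x /= xY ->].
by apply/imfsetP; exists x => //; exact: (fsubsetP YV).
Qed.

Lemma sub_confs_prod S1 S2 U : conf_prod S1 S2 U -> S1 \in sub_confs U /\ S2 \in sub_confs U.
Proof.
rewrite -(conf_of_repr U) => /conf_prodP[Y1 [Y2 [<- <- _ ->]]].
by split; apply/mem_sub_confs; [exists Y1|exists Y2]; rewrite ?fsubsetUl ?fsubsetUr.
Qed.

Lemma sub_confs_trans S U U' : S \in sub_confs U -> U \in sub_confs U' -> S \in sub_confs U'.
Proof.
rewrite -(conf_of_repr U') => SU /mem_sub_confs[Y YU E]; move: SU.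
rewrite -E => /mem_sub_confs[Z ZY <-].
by apply/mem_sub_confs; exists Z => //; exact: fsubset_trans YU.
Qed.

Definition conf_prodb S1 S2 U := `[< conf_prod S1 S2 U >].

(** The index list may be any one that contains the classes of subgraphs of [U], so that products at
    several classes share their indices, as associativity requires. *)
Lemma conf_mulE (R : realType) (f g : confAlg gen R) U (q : seq conf) :
  uniq q -> {subset sub_confs U <= q} -> conf_mul f g U =
  (\sum_(S1 <- q) \sum_(S2 <- q) f S1 * g S2 * (conf_prodb S1 S2 U)%:R)%R.
Proof.
move=> uq sub; rewrite /conf_mul.
set q2 := [seq p <- [seq (S1, S2) | S1 <- q, S2 <- q] | conf_prodb p.1 p.2 U].
have -> : [set p : conf * conf | conf_prod p.1 p.2 U] = [set` q2].
  apply/seteqP; split=> -[S1 S2] /=; rewrite mem_filter /conf_prodb /=.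
    move=> P; rewrite asboolT //=; have [] := sub_confs_prod P.
    by move=> /sub ? /sub ?; apply/allpairsP; exists (S1, S2).
  by move=> /andP[/asboolP].
rewrite -fsbig_seq; last first.
  by rewrite filter_uniq // allpairs_uniq // => -[? ?] [? ?].
rewrite big_filter big_mkcond big_allpairs_dep /=; apply: eq_bigr => S1 _.
by apply: eq_bigr => S2 _; case: ifP => _; rewrite (mulr1, mulr0).
Qed.

Lemma sum_unique (R : realType) (I : eqType) (q : seq I) (p : pred I) :
  uniq q -> (forall i j, p i -> p j -> i = j) -> (\sum_(i <- q) (p i)%:R = (has p q)%:R :> R)%R.
Proof.
elim: q => [|i q IH] /=; first by rewrite big_nil.
move=> /andP[iq uq] pu; rewrite big_cons IH //.
have [pi|] := boolP (p i); last by rewrite add0r.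
case: hasP => [[j jq /(pu _ _ pi) E]|_]; last by rewrite addr0.
by rewrite E jq in iq.
Qed.

Definition conf_ring (R : realType) := confAlg gen R.

Section Ring.
Variable R : realType.
Local Open Scope ring_scope.
Local Notation CR := (conf_ring R).
Implicit Types (f g h : CR).

HB.instance Definition _ := GRing.Zmodule.copy CR (conf -> R)%type.

Lemma conf_mulC : commutative (@conf_mul X G gen R).
Proof.
move=> f g; apply/funext => U; rewrite !(@conf_mulE _ _ _ U (sub_confs U)) ?undup_uniq //.
rewrite exchange_big /=; apply: eq_bigr => S1 _; apply: eq_bigr => S2 _.
rewrite [f _ * _]mulrC; congr (_ * (nat_of_bool _)%:R).
by apply/asboolP/asboolP; exact: conf_prodC.
Qed.

(** Both sides become sums over triples of classes, weighted by the existence of an intermediate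
    product; this product is unique by [conf_prod_fun], so that no triple is counted twice. *)
Lemma conf_mulA : associative (@conf_mul X G gen R).
Proof.
move=> f g h; apply/funext => U; set q := sub_confs U.
have uq : uniq q by exact: undup_uniq.
have mulE (f1 f2 : CR) S : S \in q -> conf_mul f1 f2 S =
    \sum_(S1 <- q) \sum_(S2 <- q) f1 S1 * f2 S2 * (conf_prodb S1 S2 S)%:R :> R.
  by move=> Sq; apply: conf_mulE => // T TS; exact: sub_confs_trans Sq.
rewrite !(@conf_mulE _ _ _ U q) //.
transitivity (\sum_(S1 <- q) \sum_(S2 <- q) \sum_(S3 <- q) f S1 * g S2 * h S3 *
  (has (fun S => conf_prodb S1 S U && conf_prodb S2 S3 S) q)%:R).
  apply: eq_bigr => S1 _.
  under eq_big_seq => S Sq.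
    rewrite (mulE _ _ _ Sq) mulr_sumr mulr_suml.
    under eq_bigr => S2 _ do rewrite mulr_sumr mulr_suml.
    over.
  rewrite exchange_big /=; apply: eq_bigr => S2 _.
  rewrite exchange_big /=; apply: eq_bigr => S3 _.
  rewrite -sum_unique // => [|T T' /andP[_ /asboolP P] /andP[_ /asboolP P']]; last first.
    exact: conf_prod_fun P P'.
  rewrite mulr_sumr; apply: eq_bigr => S _.
  by rewrite andbC -mulnb natrM; ring.
apply/esym.
transitivity (\sum_(S3 <- q) \sum_(S1 <- q) \sum_(S2 <- q) f S1 * g S2 * h S3 *
  (has (fun S => conf_prodb S S3 U && conf_prodb S1 S2 S) q)%:R).
  rewrite exchange_big /=; apply: eq_bigr => S3 _.
  under eq_big_seq => S Sq.
    rewrite (mulE _ _ _ Sq) 2!mulr_suml.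
    under eq_bigr => S1 _ do rewrite 2!mulr_suml.
    over.
  rewrite exchange_big /=; apply: eq_bigr => S1 _.
  rewrite exchange_big /=; apply: eq_bigr => S2 _.
  rewrite -sum_unique // => [|T T' /andP[_ /asboolP P] /andP[_ /asboolP P']]; last first.
    exact: conf_prod_fun P P'.
  rewrite mulr_sumr; apply: eq_bigr => S _.
  by rewrite andbC -mulnb natrM; ring.
rewrite exchange_big /=; apply: eq_bigr => S1 _.
rewrite exchange_big /=; apply: eq_bigr => S2 _; apply: eq_bigr => S3 _.
congr (_ * (nat_of_bool _)%:R); apply/hasP/hasP => -[S _ /andP[/asboolP P1 /asboolP P2]].
  have [S' P3 P4] := conf_prodA P2 P1; exists S'; first by have [] := sub_confs_prod P4.
  by rewrite /conf_prodb !asboolT.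
have [S' P3 P4] := conf_prodA (conf_prodC P2) (conf_prodC P1).
exists S'; first by have [] := sub_confs_prod P4.
by apply/andP; split; apply/asboolP; exact: conf_prodC.
Qed.

Lemma conf_mul1 : left_id (@conf_one X G gen R) (@conf_mul X G gen R).
Proof.
move=> f; apply/funext => U; rewrite (@conf_mulE _ _ _ U (sub_confs U)) ?undup_uniq //.
have P0 : conf_prod (cls fset0) U U by apply/conf_prod0.
have [q0 qU] := sub_confs_prod P0.
rewrite (bigD1_seq (cls fset0)) ?undup_uniq //= (bigD1_seq U) ?undup_uniq //=.
rewrite /conf_one eqxx /conf_prodb asboolT // mul1r mulr1.
rewrite big1 ?addr0 => [|S SU]; last first.
  by rewrite asboolF ?mulr0 // => /conf_prod0 E; rewrite E eqxx in SU.
by rewrite big1 ?addr0 // => S /negbTE->; rewrite big1 // => T _; rewrite !mul0r.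
Qed.

Lemma conf_mulDl : left_distributive (@conf_mul X G gen R) (fun f g : CR => f + g).
Proof.
move=> f g h; apply/funext => U.
transitivity (conf_mul f h U + conf_mul g h U) => //.
rewrite !(@conf_mulE _ _ _ U (sub_confs U)) ?undup_uniq //.
rewrite -big_split /=; apply: eq_bigr => S1 _; rewrite -big_split /=.
by apply: eq_bigr => S2 _; rewrite !mulrDl.
Qed.

HB.instance Definition _ := GRing.Zmodule_isComPzRing.Build CR
  conf_mulA conf_mulC conf_mul1 conf_mulDl.

Lemma conf_powE (f : CR) k : conf_pow f k = f ^+ k.
Proof. by elim: k => [|k IH]; rewrite ?expr0 // exprS -IH. Qed.

End Ring.
End Configurations.

Lemma sum_delta (R : realType) (I : eqType) (q : seq I) (c : I) (H : I -> R) :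
  uniq q -> (c \notin q -> H c = 0) -> \sum_(i <- q) (c == i)%:R * H i = H c.
Proof.
move=> uq Hc; have [cq|/[dup] nc /Hc->] := boolP (c \in q).
  rewrite (bigD1_seq c) //= eqxx mul1r big1 ?addr0 // => i.
  by rewrite eq_sym => /negbTE->; rewrite mul0r.
rewrite big1_seq // => i /= iq; case: eqP => [E|]; last by rewrite mul0r.
by rewrite E iq in nc.
Qed.

Lemma poly_nat_eq (R : realType) (p q : {poly R}) : (forall n, p.[n%:R] = q.[n%:R]) -> p = q.
Proof.
move=> pq; apply/eqP; rewrite -subr_eq0; apply/negPn/negP => d0.
have := max_poly_roots d0 (rs := [seq i%:R | i <- iota 0 (size (p - q))]).
rewrite size_map size_iota ltnn => H; apply/notF/H.
  by apply/allP => _ /mapP[i _ ->]; rewrite rootE !hornerE pq subrr.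
by rewrite map_inj_uniq ?iota_uniq // => i j /eqP; rewrite eqr_nat => /eqP.
Qed.

(** * Binomial coefficients as polynomials *)

Section BinomialPoly.
Variable R : realType.

Definition binom_poly j : {poly R} := (j`!%:R)^-1 *: \prod_(i < j) ('X - i%:R%:P).

Lemma binom_polyE j n : (binom_poly j).[n%:R] = 'C(n, j)%:R.
Proof.
have prodE : (\prod_(i < j) ('X - i%:R%:P)).[n%:R] = (n ^_ j)%:R :> R.
  rewrite horner_prod; elim: j => [|j IH]; first by rewrite big_ord0.
  rewrite big_ord_recr /= IH ffactnSr natrM !hornerE.
  have [jn|nj] := leqP j n; first by rewrite natrB.
  by rewrite ffact_small // !mul0r.
by rewrite hornerZ prodE -bin_ffact natrM mulrC mulfK // pnatr_eq0 -lt0n fact_gt0.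
Qed.

(** These linear coefficients are the coefficients of the logarithmic series. *)
Lemma binom_poly_coef1 j : (binom_poly j)`_1 = if j is k.+1 then (-1) ^+ k / k.+1%:R else 0.
Proof.
rewrite coefZ; case: j => [|k]; first by rewrite big_ord0 coef1 mulr0.
rewrite big_ord_recl /= subr0 coefXM /= -horner_coef0 horner_prod.
have -> : \prod_(i < k) ('X - (bump 0 i)%:R%:P).[0] = (-1) ^+ k * k`!%:R :> R.
  elim: k => [|k IH]; first by rewrite big_ord0 mul1r.
  by rewrite big_ord_recr /= IH !hornerE /bump leq0n add1n exprS factS natrM; ring.
by rewrite factS natrM invfM mulrCA mulrAC mulfK // pnatr_eq0 -lt0n fact_gt0.
Qed.

End BinomialPoly.

(** * Additivity of the logarithm *)

Section LogAdditive.
Local Open Scope ring_scope.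
Variables (X : monoidType) (G : finType) (gen : G -> X) (R : realType).

Local Notation conf := (conf gen).
Local Notation cls := (conf_of gen).
Local Notation CR := (conf_ring gen R).
Implicit Types (Y Z T : {fset X}) (S U : conf) (f g : CR).

Lemma conf_ring_mulE f g U : (f * g) U =
  \sum_(S1 <- sub_confs U) \sum_(S2 <- sub_confs U) f S1 * g S2 * (conf_prodb S1 S2 U)%:R.
Proof. by apply: conf_mulE => //; exact: undup_uniq. Qed.

Lemma conf_ring_sumE (I : Type) (q : seq I) (F : I -> CR) U :
  (\sum_(i <- q) F i) U = \sum_(i <- q) F i U.
Proof. by elim: q => [|i q IH]; rewrite ?big_nil // !big_cons -IH. Qed.

Lemma conf_ring_muln f n U : (f *+ n) U = f U *+ n.
Proof. by elim: n => [//|n IH]; rewrite !mulrS -IH. Qed.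

Lemma conf_pow_small g j U : g (cls fset0) = 0 -> (conf_deg U < j)%N -> (g ^+ j) U = 0.
Proof.
move=> g0; elim: j U => [//|j IH] U ltj; rewrite exprS conf_ring_mulE.
apply: big1 => S1 _; apply: big1 => S2 _.
rewrite /conf_prodb; case: asboolP => [/conf_prod_deg E|]; last by rewrite mulr0.
have [|S10] := eqVneq (conf_deg S1) 0%N; first by move/eqP; rewrite conf_deg0 => /eqP->; rewrite g0 !mul0r.
by rewrite IH ?mulr0 ?mul0r //; lia.
Qed.

(* The coefficients of [f ^+ n] are polynomial in [n], and the logarithm is the
   linear term: this makes it additive. *)
Definition pow_poly f U : {poly R} :=
  \sum_(j < (conf_deg U).+1) ((f - 1) ^+ j) U *: binom_poly R j.

Lemma conf_one0 : (1 : CR) (cls fset0) = 1.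
Proof. by rewrite /GRing.one /= /conf_one eqxx. Qed.

Lemma conf_ring_subE f g U : (f - g) U = f U - g U.
Proof. by []. Qed.

(** The binomial expansion of [(1 + (f - 1)) ^+ n]: powers beyond the degree of [U] vanish at [U],
    so that the range of summation does not depend on [n]. *)
Lemma pow_polyE f n U : f (cls fset0) = 1 -> (pow_poly f U).[n%:R] = (f ^+ n) U.
Proof.
move=> f0; have g0 : (f - 1) (cls fset0) = 0 by rewrite conf_ring_subE f0 conf_one0 subrr.
have -> : f ^+ n = \sum_(j < n.+1) (f - 1) ^+ j *+ 'C(n, j).
  by rewrite -[in LHS](subrK 1 f) addrC exprDn; apply: eq_bigr => j _; rewrite expr1n mul1r.
rewrite conf_ring_sumE horner_sum.
pose F j := ((f - 1) ^+ j) U *+ 'C(n, j).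
transitivity (\sum_(j < (maxn n (conf_deg U)).+1) F j).
  rewrite (big_ord_widen _ (fun j => (((f - 1) ^+ j) U *: binom_poly R j).[n%:R]) (leq_maxr n.+1 (conf_deg U).+1)).
  rewrite -maxnSS big_mkcond; apply: eq_bigr => j _; rewrite /F hornerZ binom_polyE mulr_natr.
  by case: ltnP => // dj; rewrite conf_pow_small ?mul0rn.
rewrite (big_ord_widen _ (fun j => ((f - 1) ^+ j *+ 'C(n, j)) U) (leq_maxl n.+1 (conf_deg U).+1)).
rewrite -maxnSS [RHS]big_mkcond; apply: eq_bigr => j _; rewrite /F conf_ring_muln.
by case: ltnP => // nj; rewrite bin_small.
Qed.

Lemma pow_poly_coef0 f U : f (cls fset0) = 1 -> (pow_poly f U)`_0 = (1 : CR) U.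
Proof. by move=> f0; rewrite -horner_coef0 (pow_polyE 0). Qed.

Lemma pow_poly_coef1 f U : (pow_poly f U)`_1 = conf_log f U.
Proof.
rewrite coef_sum big_ord_recl coefZ binom_poly_coef1 mulr0 add0r.
rewrite /conf_log big_add1 big_mkord; apply: eq_bigr => j _.
rewrite lift0 coefZ binom_poly_coef1 -conf_powE mulrC; congr (_ / _ * _).
by rewrite !exprS !mulN1r opprK.
Qed.

(** [(f * g) ^+ n = f ^+ n * g ^+ n] for all [n] is an identity of polynomials in [n]. Its linear
    coefficients are compared; the constant coefficients are those of the unit. *)
Lemma conf_logM f g U : f (cls fset0) = 1 -> g (cls fset0) = 1 ->
  conf_log (conf_mul f g) U = conf_log f U + conf_log g U.
Proof.
move=> f0 g0; have fg0 : (f * g) (cls fset0) = 1.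
  have := congr1 (fun h : CR => h (cls fset0)) (esym (mul1r (1 : CR))).
  rewrite conf_one0 => ->; rewrite !conf_ring_mulE.
  apply: eq_bigr => S1 _; apply: eq_bigr => S2 _; rewrite /conf_prodb.
  case: asboolP => [/conf_prod_deg|]; last by rewrite !mulr0.
  rewrite conf_deg_of cardfs0 => /esym/eqP; rewrite addn_eq0 !conf_deg0.
  by move=> /andP[/eqP-> /eqP->]; rewrite f0 g0 conf_one0.
have -> : conf_mul f g = (f * g : CR) by [].
rewrite -!pow_poly_coef1.
have -> : pow_poly (f * g) U = \sum_(S1 <- sub_confs U) \sum_(S2 <- sub_confs U)
    (conf_prodb S1 S2 U)%:R *: (pow_poly f S1 * pow_poly g S2).
  apply: poly_nat_eq => n; rewrite pow_polyE // exprMn conf_ring_mulE horner_sum.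
  apply: eq_bigr => S1 _; rewrite horner_sum; apply: eq_bigr => S2 _.
  by rewrite hornerZ hornerM !pow_polyE // mulrC.
rewrite [in RHS]pow_poly_coef1 [X in _ = _ + X]pow_poly_coef1.
have -> : conf_log f = (conf_log f : CR) * 1 by rewrite mulr1.
have -> : conf_log g = 1 * (conf_log g : CR) by rewrite mul1r.
rewrite !conf_ring_mulE -big_split coef_sum; apply: eq_bigr => S1 _.
rewrite -big_split coef_sum; apply: eq_bigr => S2 _ /=.
rewrite coefZ coefM !big_ord_recl big_ord0 /= !pow_poly_coef0 // !pow_poly_coef1.
ring.
Qed.

Lemma big_fpowersetU (V : nmodType) T1 T2 (F : {fset X} -> V) : [disjoint T1 & T2]%fset ->
  \sum_(Y <- fpowerset (T1 `|` T2)%fset) F Y =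
  \sum_(Y1 <- fpowerset T1) \sum_(Y2 <- fpowerset T2) F (Y1 `|` Y2)%fset.
Proof.
move=> d; transitivity (\sum_(Y <- [seq (Y1 `|` Y2)%fset | Y1 <- fpowerset T1, Y2 <- fpowerset T2]) F Y);
  last by rewrite big_allpairs_dep.
have dP x : x \in T1 -> x \in T2 -> False by move=> /(fdisjointP d)/negP.
apply: perm_big; apply: uniq_perm; first exact: fset_uniq.
  apply: allpairs_uniq; rewrite ?fset_uniq // => -[Y1 Y2] [Z1 Z2].
  move=> /allpairsP[[? ?] /= [+ + [-> ->]]] /allpairsP[[? ?] /= [+ + [-> ->]]].
  rewrite !fpowersetE => /fsubsetP y1 /fsubsetP y2 /fsubsetP z1 /fsubsetP z2 E.
  congr pair; apply/fsetP => x; move/fsetP: E => /(_ x); rewrite !inE => E.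
    apply/idP/idP => xY; move: E; rewrite xY ?orbT /=.
      by move=> /esym/orP[//|/z2 /(dP _ (y1 _ xY))].
    by move=> /orP[//|/y2 /(dP _ (z1 _ xY))].
  apply/idP/idP => xY; move: E; rewrite xY ?orbT /=.
    by move=> /esym/orP[/z1/dP/(_ (y2 _ xY))|].
  by move=> /orP[/y1/dP/(_ (z2 _ xY))|].
move=> Y; rewrite fpowersetE; apply/idP/allpairsP => [YT|[[Y1 Y2] [/=]]].
  exists (Y `&` T1, Y `&` T2)%fset; rewrite /= !fpowersetE !fsubsetIr; split=> //.
  by rewrite -fsetIUr; apply/esym/fsetIidPl.
by rewrite !fpowersetE => y1 y2 ->; exact: fsetUSS.
Qed.

Lemma calAE T S : calA R (cls T) S = \sum_(Y <- fpowerset T) (cls Y == S)%:R.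
Proof. by rewrite /calA subgraph_countE natr_sum. Qed.

Lemma calA0 T : calA R (cls T) (cls fset0) = 1.
Proof.
rewrite calAE (bigD1_seq fset0) ?fset_uniq ?fpowersetE //= eqxx.
by rewrite big1 ?addr0 // => Y /negbTE; rewrite conf_of0 => ->.
Qed.

Lemma calAM T1 T2 : detached gen T1 T2 ->
  calA R (cls (T1 `|` T2)%fset) = conf_mul (calA R (cls T1)) (calA R (cls T2)).
Proof.
move=> s; apply/funext => S; rewrite (@conf_mulE _ _ _ _ _ _ S (sub_confs S)) ?undup_uniq //.
rewrite calAE big_fpowersetU; last by case: s.
under [RHS]eq_bigr => S1 _ do under eq_bigr => S2 _ do
  rewrite !calAE mulr_suml mulr_suml.
under [RHS]eq_bigr => S1 _ do rewrite exchange_big /=.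
rewrite [RHS]exchange_big /= big_seq [RHS]big_seq; apply: eq_bigr => Y1 Y1T.
under [RHS]eq_bigr => S1 _ do under eq_bigr => S2 _ do
  rewrite -mulrA mulr_suml mulr_sumr.
under [RHS]eq_bigr => S1 _ do rewrite exchange_big /=.
rewrite [RHS]exchange_big /= big_seq [RHS]big_seq; apply: eq_bigr => Y2 Y2T.
have s12 : detached gen Y1 Y2 by apply: (detached_sub s); rewrite -fpowersetE.
under [RHS]eq_bigr => S1 _.
  rewrite -mulr_sumr sum_delta ?undup_uniq; last 2 first.
  - by [].
  - move=> nq; rewrite /conf_prodb asboolF // => /sub_confs_prod[_ q2].
    by rewrite q2 in nq.
  over.
rewrite sum_delta ?undup_uniq // => [|nq]; last first.
  rewrite /conf_prodb asboolF // => /sub_confs_prod[q1 _].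
  by rewrite q1 in nq.
congr (nat_of_bool _)%:R; have P : conf_prod (cls Y1) (cls Y2) (cls (Y1 `|` Y2)%fset).
  by apply/conf_prodP; exists Y1, Y2.
by apply/eqP/asboolP => [<-//|]; exact: conf_prod_fun.
Qed.

Lemma calM_add T1 T2 U : detached gen T1 T2 ->
  calM R (cls (T1 `|` T2)%fset) U = calM R (cls T1) U + calM R (cls T2) U.
Proof. by move=> s; rewrite /calM calAM // conf_logM ?calA0. Qed.

End LogAdditive.

(** * Moebius inversion over finite subsets *)

Section SubsetTransform.
Local Open Scope ring_scope.
Variables (X : monoidType) (R : realType).
Implicit Types (Y Z T : {fset X}) (F c : {fset X} -> R).

Definition moebius F Y := \sum_(Z <- fpowerset Y) (-1) ^+ (#|` Y| + #|` Z|) * F Z.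

Lemma cardfsU_disjoint Y Z : [disjoint Y & Z]%fset -> #|` Y `|` Z|%fset = (#|` Y| + #|` Z|)%N.
Proof. by move=> /eqP d; rewrite cardfsU d cardfs0 subn0. Qed.

Lemma big_fpowersetU1 (V : nmodType) x T (F : {fset X} -> V) : x \notin T ->
  \sum_(Y <- fpowerset (x |` T)%fset) F Y =
  \sum_(Y <- fpowerset T) (F Y + F (x |` Y)%fset).
Proof.
move=> xT; rewrite big_fpowersetU ?fdisjoint1X // fpowerset1 big_fsetU1 /=; last first.
  by rewrite inE; apply/eqP => /fsetP/(_ x); rewrite !inE eqxx.
rewrite big_seq_fset1 -big_split; apply: eq_bigr => Y _.
by rewrite fset0U.
Qed.

Lemma moebius_sum F T : F T = \sum_(Y <- fpowerset T) moebius F Y.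
Proof.
have [n] := ubnP #|` T|; elim: n T F => // n IH T F ltn.
have [->|[x xT]] := fset_0Vmem T.
  by rewrite fpowerset0 big_seq_fset1 /moebius fpowerset0 big_seq_fset1 cardfs0 mul1r.
have TE : T = (x |` (T `\ x))%fset by rewrite fsetD1K.
have xT' : x \notin (T `\ x)%fset by rewrite !inE eqxx.
rewrite {2}TE big_fpowersetU1 // {1}TE.
rewrite (IH (T `\ x)%fset (fun Z => F (x |` Z)%fset)); last first.
  by move: ltn; rewrite (cardfsD1 x T) xT add1n ltnS.
rewrite big_seq [RHS]big_seq; apply: eq_bigr => Y; rewrite fpowersetE => YT.
have xY : x \notin Y by apply: contra xT' => /(fsubsetP YT).
rewrite {2 3}/moebius big_fpowersetU1 // /moebius -big_split big_seq [RHS]big_seq.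
apply: eq_bigr => Z; rewrite fpowersetE /= => ZY.
have xZ : x \notin Z by apply: contra xY => /(fsubsetP ZY).
rewrite !cardfsU1 xY xZ !add1n !addSn !addnS !exprS; ring.
Qed.

Lemma fpowerset_sum_inj c c' :
  (forall T, \sum_(Y <- fpowerset T) c Y = \sum_(Y <- fpowerset T) c' Y) -> c =1 c'.
Proof.
move=> H T; have [n] := ubnP #|` T|; elim: n T => // n IH T ltn.
have := H T; rewrite !(bigD1_seq T) ?fset_uniq ?fpowersetE //=.
rewrite big_seq_cond [in X in _ = _ + X]big_seq_cond.
rewrite (@eq_bigr _ _ _ _ _ _ _ c') ?[c' T + _]addrC ?[c T + _]addrC => [/addrI //|Y].
rewrite fpowersetE => /andP[YT YnT]; apply: IH; rewrite -ltnS; apply: leq_trans ltn.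
by rewrite ltnS; apply: fproper_ltn_card; rewrite fproperEneq YnT.
Qed.

Lemma moebius_uniq F c : (forall T, F T = \sum_(Y <- fpowerset T) c Y) -> moebius F =1 c.
Proof. by move=> H; apply: fpowerset_sum_inj => T; rewrite -moebius_sum. Qed.

Lemma sum_fpowerset_sign Y : Y != fset0 -> \sum_(Z <- fpowerset Y) (-1) ^+ #|` Z| = 0 :> R.
Proof.
move=> Y0; have : moebius (fun=> 1) Y = 0.
  rewrite (@moebius_uniq _ (fun Y => (Y == fset0)%:R)) ?(negbTE Y0) // => T.
  rewrite (bigD1_seq fset0) ?fset_uniq ?fpowersetE /= ?eqxx ?big1 ?addr0 // => Z.
  by move=> /negbTE->.
rewrite /moebius => H; rewrite -[RHS](mulr0 ((-1) ^+ #|` Y|)) -[in RHS]H.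
rewrite mulr_sumr; apply: eq_bigr => Z _.
by rewrite mulr1 exprD mulrA -expr2 sqrr_sign mul1r.
Qed.

(** [F] behaves as a polynomial of degree at most [d] in the indicator of its argument: only subsets
    of at most [d] elements contribute to it. *)
Definition subset_degree (d : nat) F := forall Y, (d < #|` Y|)%N -> moebius F Y = 0.

Lemma subset_degreeP d F c : (forall T, F T = \sum_(Y <- fpowerset T) c Y) ->
  (forall Y, (d < #|` Y|)%N -> c Y = 0) -> subset_degree d F.
Proof. by move=> Fc c0 Y dY; rewrite (moebius_uniq Fc) c0. Qed.

Lemma subset_degree_cst d (x : R) : subset_degree d (fun=> x).
Proof.
apply: (@subset_degreeP _ _ (fun Y => (Y == fset0)%:R * x)) => [T|Y dY].
  rewrite (bigD1_seq fset0) ?fset_uniq ?fpowersetE /= ?eqxx ?mul1r ?big1 ?addr0 // => Z.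
  by move=> /negbTE->; rewrite mul0r.
have -> : Y == fset0 = false by apply/negbTE; rewrite -cardfs_eq0; lia.
by rewrite mul0r.
Qed.

Lemma subset_degreeZ d (x : R) F : subset_degree d F -> subset_degree d (fun T => x * F T).
Proof.
move=> dF; apply: (@subset_degreeP _ _ (fun Y => x * moebius F Y)) => [T|Y /dF->].
  by rewrite {1}(moebius_sum F) mulr_sumr.
by rewrite mulr0.
Qed.

Lemma subset_degree_sum d (I : Type) (q : seq I) (P : pred I) (F : I -> {fset X} -> R) :
  (forall i, P i -> subset_degree d (F i)) ->
  subset_degree d (fun T => \sum_(i <- q | P i) F i T).
Proof.
move=> dF; apply: (@subset_degreeP _ _ (fun Y => \sum_(i <- q | P i) moebius (F i) Y)) => [T|Y dY].
  by rewrite exchange_big /=; apply: eq_bigr => i _; exact: moebius_sum.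
by apply: big1 => i /dF; exact.
Qed.

(** The product is a sum over pairs of subsets, regrouped by their union, which has at most [d + d']
    elements. *)
Lemma subset_degreeM d d' F F' : subset_degree d F -> subset_degree d' F' ->
  subset_degree (d + d') (fun T => F T * F' T).
Proof.
move=> dF dF'; pose c W := \sum_(Y <- fpowerset W) \sum_(Y' <- fpowerset W)
  ((Y `|` Y')%fset == W)%:R * (moebius F Y * moebius F' Y').
apply: (@subset_degreeP _ _ c) => [T|W dW]; last first.
  apply: big1 => Y _; apply: big1 => Y' _; case: eqP => [E|]; last by rewrite mul0r.
  have [dY|Yd] := ltnP d #|` Y|; first by rewrite (dF _ dY) mul0r mulr0.
  rewrite (dF' Y') ?mulr0 //; move: dW; rewrite -E; have := cardfsU Y Y'.
  by lia.
have cE W : W \in fpowerset T -> c W = \sum_(Y <- fpowerset T) \sum_(Y' <- fpowerset T)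
    ((Y `|` Y')%fset == W)%:R * (moebius F Y * moebius F' Y').
  rewrite fpowersetE => WT.
  have widen (H : {fset X} -> R) : (forall Y, ~~ (Y `<=` W)%fset -> H Y = 0) ->
      \sum_(Y <- fpowerset W) H Y = \sum_(Y <- fpowerset T) H Y.
    move=> H0; rewrite [RHS](bigID (mem (fpowerset W))) /= [X in _ + X]big1 ?addr0; last first.
      by move=> Y; rewrite /= fpowersetE; exact: H0.
    rewrite -[RHS]big_filter; apply: perm_big; apply: uniq_perm; rewrite ?filter_uniq ?fset_uniq //.
    move=> Y; rewrite mem_filter; case YW: (_ \in _) => //=.
    by move: YW; rewrite !fpowersetE => /fsubset_trans->.
  rewrite /c widen => [|Y YW].
    apply: eq_bigr => Y _; apply: widen => Y' YW.
    by case: eqP => [E|]; rewrite ?mul0r //; move: YW; rewrite -E fsubsetUr.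
  apply: big1 => Y' _.
  by case: eqP => [E|]; rewrite ?mul0r //; move: YW; rewrite -E fsubsetUl.
rewrite big_seq (eq_bigr _ cE) -big_seq exchange_big {1}(moebius_sum F) mulr_suml /=.
rewrite big_seq [RHS]big_seq; apply: eq_bigr => Y; rewrite fpowersetE => YT.
rewrite exchange_big {1}(moebius_sum F') mulr_sumr /=.
rewrite big_seq [RHS]big_seq; apply: eq_bigr => Y'; rewrite fpowersetE => Y'T.
rewrite (@sum_delta R _ (fpowerset T) _ (fun=> moebius F Y * moebius F' Y')) ?fset_uniq //.
by rewrite fpowersetE fsubUset YT Y'T.
Qed.

End SubsetTransform.

(** * The coefficients of the logarithm *)

Section LogCoefficients.
Local Open Scope ring_scope.
Variables (X : monoidType) (G : finType) (gen : G -> X) (R : realType).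

Local Notation conf := (conf gen).
Local Notation cls := (conf_of gen).
Local Notation CR := (conf_ring gen R).
Implicit Types (Y Z T : {fset X}) (S U : conf).

(** Connectedness in terms of the product alone: the vertices reachable from a given one are
    detached from the others. *)
Lemma connected_conf0 U : conf0 gen U <-> U <> cls fset0 /\
  forall S1 S2, conf_prod S1 S2 U -> S1 = cls fset0 \/ S2 = cls fset0.
Proof.
rewrite /conf0 /connected_subgraph /=; set V := repr U.
set e := [rel u v : V | edge gen (val u) (val v) || edge gen (val v) (val u)].
have UE : U = cls V by rewrite conf_of_repr.
have V0 : V != fset0 <-> U <> cls fset0.
  by rewrite UE -(conf_of0 gen); split=> /eqP.
split=> -[/V0 U0 H]; split=> //.
  move=> S1 S2; rewrite UE => /conf_prodP[Y1 [Y2 [<- <- [d ne] VE]]].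
  have [->|[x x1]] := fset_0Vmem Y1; first by left.
  have [->|[y y2]] := fset_0Vmem Y2; first by right.
  have xV : x \in V by rewrite VE inE x1.
  have yV : y \in V by rewrite VE inE y2 orbT.
  have cl : fingraph.closed e [pred z : V | val z \in Y1].
    move=> u v /= uv; rewrite !inE.
    have : val u \in (Y1 `|` Y2)%fset by rewrite -VE; exact: valP.
    have : val v \in (Y1 `|` Y2)%fset by rewrite -VE; exact: valP.
    rewrite !inE; case/orP => vY; case/orP => uY; rewrite ?vY ?uY //.
    - have := ne _ _ vY uY; move: uv.
      by case: (edge _ _ _); case: (edge _ _ _).
    - have := ne _ _ uY vY; move: uv.
      by case: (edge _ _ _); case: (edge _ _ _).
    - by rewrite (negbTE (fdisjointP_sym d _ vY)) (negbTE (fdisjointP_sym d _ uY)).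
  have := closed_connect cl (H [` xV]%fset [` yV]%fset).
  by rewrite !inE /= x1 (negbTE (fdisjointP_sym d _ y2)).
move=> x y; apply/negPn/negP => nxy.
pose c (z : X) := if insub z is Some u then connect e x u else false.
have cE (u : V) : c (val u) = connect e x u by rewrite /c valK.
have sep : detached gen [fset z in V | c z]%fset [fset z in V | ~~ c z]%fset.
  split; first by apply/fdisjointP => z; rewrite !inE => /andP[-> ->].
  move=> z t; rewrite !inE => /andP[zV cz] /andP[tV]; rewrite -negb_or.
  apply: contra => E; move: cz; rewrite (cE [` zV]%fset) (cE [` tV]%fset) => cz.
  by apply: connect_trans cz (connect1 _).
have := H (cls [fset z in V | c z]%fset) (cls [fset z in V | ~~ c z]%fset).
have VE : V = ([fset z in V | c z] `|` [fset z in V | ~~ c z])%fset.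
  by apply/fsetP => z; rewrite !inE; case: (c z); rewrite ?andbT ?andbF ?orbF.
rewrite UE; case; first by apply/conf_prodP; do 2 eexists; split; last exact: VE.
  move=> /eqP; rewrite conf_of0 => /eqP/fsetP/(_ (val x)).
  by rewrite !inE cE connect0 andbT (valP x).
move=> /eqP; rewrite conf_of0 => /eqP/fsetP/(_ (val y)).
by rewrite !inE cE nxy andbT (valP y).
Qed.

Definition nu U Y := moebius (fun T => calM R (cls T) U) Y.

Lemma nu_sum T U : calM R (cls T) U = \sum_(Y <- fpowerset T) nu U Y.
Proof. exact: moebius_sum. Qed.

Lemma nu_class U Y Z : cls Y = cls Z -> nu U Y = nu U Z.
Proof.
move=> YZ; rewrite /nu /moebius (conf_of_card YZ).
have H W : (-1) ^+ (#|` Z| + #|` W|) * calM R (cls W) U =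
  (fun S => (-1) ^+ (#|` Z| + conf_deg S) * calM R S U) (cls W).
  by rewrite conf_deg_of.
rewrite (eq_bigr _ (fun W _ => H W)) [RHS](eq_bigr _ (fun W _ => H W)).
exact: (big_fpowerset_class (fun S => (-1) ^+ (#|` Z| + conf_deg S) * calM R S U) YZ).
Qed.

Lemma calA_degree U : subset_degree (conf_deg U) (fun T => ((calA R (cls T) : CR) - 1) U).
Proof.
apply: (@subset_degreeP _ _ _ _ (fun Y => (cls Y == U)%:R - (Y == fset0)%:R * (1 : CR) U)).
  move=> T; rewrite conf_ring_subE calAE sumrB; congr (_ - _).
  rewrite (bigD1_seq fset0) ?fset_uniq ?fpowersetE /= ?eqxx ?mul1r ?big1 ?addr0 // => Z.
  by move=> /negbTE->; rewrite mul0r.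
move=> Y dY; case: eqP => [E|_]; first by move: dY; rewrite -E conf_deg_of ltnn.
have -> : Y == fset0 = false by apply/negbTE; rewrite -cardfs_eq0; lia.
by rewrite mul0r subr0.
Qed.

(** The bound is the same for every power, because [conf_deg] is additive along [conf_prod] just as
    subset degrees are along products. *)
Lemma calA_pow_degree j U :
  subset_degree (conf_deg U) (fun T => (((calA R (cls T) : CR) - 1) ^+ j) U).
Proof.
elim: j U => [|j IH] U; first exact: subset_degree_cst.
rewrite (_ : (fun T => _) = fun T => \sum_(S1 <- sub_confs U) \sum_(S2 <- sub_confs U)
    (conf_prodb S1 S2 U)%:R * (((calA R (cls T) : CR) - 1) S1 *
       (((calA R (cls T) : CR) - 1) ^+ j) S2)); last first.
  apply/funext => T; rewrite exprS conf_ring_mulE; apply: eq_bigr => S1 _.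
  by apply: eq_bigr => S2 _; rewrite mulrC.
apply: subset_degree_sum => S1 _; apply: subset_degree_sum => S2 _.
rewrite /conf_prodb; case: asboolP => [/conf_prod_deg->|_].
  apply: subset_degreeZ; apply: subset_degreeM; [exact: calA_degree|exact: IH].
rewrite (_ : (fun T => _) = fun=> 0); first exact: subset_degree_cst.
by apply/funext => T; rewrite mul0r.
Qed.

(** This is what makes the sums over all connected classes finite in each coefficient. *)
Lemma nu_degree U Y : (conf_deg U < #|` Y|)%N -> nu U Y = 0.
Proof.
move: Y; change (subset_degree (conf_deg U) (fun T => calM R (cls T) U)).
apply: subset_degree_sum => j _; apply: subset_degreeZ.
rewrite (_ : (fun T => _) = fun T => (((calA R (cls T) : CR) - 1) ^+ j) U).
  exact: calA_pow_degree.
by apply/funext => T; rewrite -conf_powE.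
Qed.

Lemma calM0 U : calM R (cls fset0) U = 0.
Proof.
have s : detached gen fset0 fset0 by split=> [|x y]; rewrite ?fdisjoint0X ?inE.
by have := calM_add R U s; rewrite fsetU0 => /eqP; rewrite -subr_eq subrr eq_sym => /eqP.
Qed.

Lemma nu0 U : nu U fset0 = 0.
Proof. by rewrite /nu /moebius fpowerset0 big_seq_fset1 calM0 mulr0. Qed.

(** Additivity of [calM] splits the alternating sum over pairs of subsets into two products, each
    containing the sum of the signs over all subsets of a nonempty set. *)
Lemma nu_detached U Y1 Y2 : detached gen Y1 Y2 -> Y1 != fset0 -> Y2 != fset0 ->
  nu U (Y1 `|` Y2)%fset = 0.
Proof.
move=> s Y10 Y20; have [d _] := s; rewrite /nu /moebius big_fpowersetU //.
pose F Z := (-1) ^+ #|` Z| * calM R (cls Z) U.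
pose e Z : R := (-1) ^+ #|` Z|.
transitivity (\sum_(Z1 <- fpowerset Y1) \sum_(Z2 <- fpowerset Y2)
  ((-1) ^+ #|` (Y1 `|` Y2)%fset| * (F Z1 * e Z2) + (-1) ^+ #|` (Y1 `|` Y2)%fset| * (e Z1 * F Z2))).
  rewrite big_seq [RHS]big_seq; apply: eq_bigr => Z1; rewrite fpowersetE => Z1Y.
  rewrite big_seq [RHS]big_seq; apply: eq_bigr => Z2; rewrite fpowersetE => Z2Y.
  have s' := detached_sub s Z1Y Z2Y; have [d' _] := s'.
  rewrite calM_add // exprD (cardfsU_disjoint d') exprD /F /e; ring.
under eq_bigr => Z1 _ do rewrite big_split -!mulr_sumr /= sum_fpowerset_sign // !mulr0 add0r.
rewrite -mulr_sumr -mulr_suml sum_fpowerset_sign // mul0r mulr0.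
by [].
Qed.

Lemma nu_disconnected U Y : ~ conf0 gen (cls Y) -> nu U Y = 0.
Proof.
move=> nc; have [->|Y0] := eqVneq Y fset0; first exact: nu0.
apply: contrapT => n0; apply: nc; apply/connected_conf0; split.
  by move=> /eqP; rewrite conf_of0 (negbTE Y0).
move=> S1 S2 /conf_prodP[Y1 [Y2 [<- <- s YE]]]; apply: contrapT => /not_orP[n1 n2].
apply: n0; rewrite YE nu_detached //; first by apply: contra_not_neq n1 => ->.
by apply: contra_not_neq n2 => ->.
Qed.

Lemma conf_pow_connected (g : CR) j U : conf0 gen U -> g (cls fset0) = 0 -> (g ^+ j.+2) U = 0.
Proof.
move=> /connected_conf0[U0 Uc] g0; rewrite exprS conf_ring_mulE.
apply: big1 => S1 _; apply: big1 => S2 _; rewrite /conf_prodb.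
case: asboolP => [/Uc[->|->]|_]; last by rewrite mulr0.
  by rewrite g0 !mul0r.
by rewrite (conf_pow_small g0) ?mulr0 ?mul0r // conf_deg_of cardfs0.
Qed.

Lemma calM_connected T U : conf0 gen U -> calM R (cls T) U = (subgraph_count U (cls T))%:R.
Proof.
move=> cU; have [U0 _] := (connected_conf0 U).1 cU.
have U1 : (0 < conf_deg U)%N by rewrite lt0n conf_deg0; apply/eqP.
rewrite /calM /conf_log -(prednK U1) big_nat_recl // prednK //.
pose g := (calA R (cls T) : CR) - 1.
have gE k : conf_pow (fun U => calA R (cls T) U - conf_one R U) k = g ^+ k.
  by rewrite -conf_powE.
have g0 : g (cls fset0) = 0 by rewrite /g conf_ring_subE calA0 conf_one0 subrr.
rewrite big_nat big1 ?addr0 => [|[|j] // _]; last by rewrite gE conf_pow_connected ?mulr0.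
rewrite gE expr1 expr2 mulrNN divr1 !mul1r /g conf_ring_subE.
have -> : (1 : CR) U = 0 by rewrite /GRing.one /= /conf_one (negbTE (introN eqP U0)).
by rewrite subr0.
Qed.

Lemma nu_connected U Y : conf0 gen U -> nu U Y = (cls Y == U)%:R.
Proof.
move=> cU; rewrite /nu (@moebius_uniq _ _ _ (fun Y => (cls Y == U)%:R)) // => T.
by rewrite calM_connected // subgraph_countE natr_sum.
Qed.

End LogCoefficients.

(** * Solution of the unitriangular system for [phi] *)

Section Coefficients.
Local Open Scope ring_scope.
Variables (X : monoidType) (G : finType) (gen : G -> X).

Local Notation conf := (conf gen).
Local Notation cls := (conf_of gen).
Implicit Types (Y Z T : {fset X}) (S U : conf).

(** The number of vertices and the labelled adjacency table for an enumeration of them. There are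
    finitely many codes for given [d], hence finitely many classes of degree at most [d]. *)
Definition conf_code d S : 'I_d.+1 * {ffun 'I_d * 'I_d * G -> bool} :=
  (inord (conf_deg S), [ffun p : 'I_d * 'I_d * G => [&& (p.1.1 < conf_deg S)%N, (p.1.2 < conf_deg S)%N &
    (nth 1%g (repr S) p.1.1 * gen p.2 == nth 1%g (repr S) p.1.2)%g]]).

Lemma conf_code_inj d S U : (conf_deg S <= d)%N -> (conf_deg U <= d)%N ->
  conf_code d S = conf_code d U -> S = U.
Proof.
move=> Sd Ud [/(congr1 val) /=]; rewrite !inordK ?ltnS // => degE /ffunP codeE.
rewrite -(conf_of_repr S) -(conf_of_repr U); apply/conf_ofP.
set Y := repr S in degE codeE *; set Z := repr U in degE codeE *.
have szE : size Y = size Z by exact: degE.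
have uY : uniq Y by exact: fset_uniq.
have uZ : uniq Z by exact: fset_uniq.
pose f x := nth 1%g Z (index x Y).
have iY x : x \in Y -> (index x Y < size Y)%N by rewrite index_mem.
have iZ x : x \in Y -> (index x Y < size Z)%N by rewrite -szE index_mem.
exists f; split.
- move=> x y xY yY /eqP; rewrite nth_uniq ?iZ // => /eqP E.
  by rewrite -[x](nth_index 1%g xY) E nth_index.
- apply/fsetP => z; apply/idP/imfsetP => [zZ|[x /= xY ->]]; last by apply: mem_nth; exact: iZ.
  have iz : (index z Z < size Y)%N by rewrite szE index_mem.
  exists (nth 1%g Y (index z Z)); first exact: mem_nth.
  by rewrite /f index_uniq // nth_index.
- move=> x y a xY yY.
  have xd : (index x Y < d)%N by apply: leq_trans (iY _ xY) Sd.
  have yd : (index y Y < d)%N by apply: leq_trans (iY _ yY) Sd.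
  have := codeE (Ordinal xd, Ordinal yd, a); rewrite !ffunE /=.
  rewrite -/Y -/Z /conf_deg -/Y -/Z (iY x xY) (iY y yY) (iZ x xY) (iZ y yY) /= !nth_index // => E.
  by split=> /eqP; [rewrite E|rewrite -E] => /eqP.
Qed.

Definition confs d : seq conf := undup [seq S <-
  [seq xget (cls fset0) [set S | (conf_deg S <= d)%N /\ conf_code d S = c] | c <- enum predT] |
  (conf_deg S <= d)%N].

Lemma mem_confs d S : (S \in confs d) = (conf_deg S <= d)%N.
Proof.
rewrite mem_undup mem_filter; case: leqP => //= Sd; apply/mapP.
exists (conf_code d S); first by rewrite mem_enum.
case: xgetP => [S' _ [S'd E]|/(_ S)[]//]; exact/esym/(conf_code_inj S'd Sd).
Qed.

Lemma confs_uniq d : uniq (confs d).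
Proof. exact: undup_uniq. Qed.

Variable R : realType.

Lemma conf_sumE (c : conf -> confAlg gen R) (a : conf -> R) U (q : seq conf) : uniq q ->
  (forall S, conf0 gen S -> S \notin q -> c S U * a S = 0) ->
  conf_sum c a U = \sum_(S <- q | `[< conf0 gen S >]) c S U * a S.
Proof.
move=> uq H; rewrite /conf_sum.
rewrite (@fsbigE _ _ _ _ (conf0 gen) [seq S <- q | `[< conf0 gen S >]]).
- rewrite big_filter_cond; apply: eq_bigl => S.
  by case: asboolP => //= cS; apply/idP; rewrite inE.
- exact: filter_uniq.
- by move=> S /=; rewrite mem_filter => /andP[/asboolP].
- by move=> S cS; rewrite mem_filter asboolT //= => nq; exact: H.
Qed.

Definition nu_conf S : confAlg gen R := fun U => nu R U (repr S).

Lemma nu_conf_of Y U : nu_conf (cls Y) U = nu R U Y.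
Proof. by apply: nu_class; rewrite conf_of_repr. Qed.

Lemma nu_conf0 S U : ~ conf0 gen S -> nu_conf S U = 0.
Proof. by move=> nc; apply: nu_disconnected; rewrite conf_of_repr. Qed.

Lemma nu_confE (a : conf -> R) U :
  conf_sum nu_conf a U = \sum_(S <- confs (conf_deg U)) nu_conf S U * a S.
Proof.
rewrite (conf_sumE (confs_uniq (conf_deg U))) => [|S _]; last first.
  by rewrite mem_confs -ltnNge => dS; rewrite /nu_conf nu_degree ?mul0r.
rewrite big_mkcond; apply: eq_bigr => S _; case: asboolP => // nc.
by rewrite nu_conf0 ?mul0r.
Qed.

Lemma subgraph_count_notin S T : S \notin sub_confs (cls T) -> subgraph_count S (cls T) = 0%N.
Proof.
move=> nS; rewrite subgraph_countE; apply: big1_seq => Y /=; rewrite fpowersetE => YT.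
by case: eqP => // E; case/negP: nS; apply/mem_sub_confs; exists Y.
Qed.

Lemma subgraph_count_id T : subgraph_count (cls T) (cls T) = 1%N.
Proof.
rewrite subgraph_countE (bigD1_seq T) ?fset_uniq ?fpowersetE //= eqxx big1_seq // => Y.
rewrite fpowersetE => /andP[YnT YT]; apply/eqP; rewrite eqb0; apply/negP => /eqP/conf_of_card E.
by have := @fproper_ltn_card _ Y T; rewrite fproperEneq YnT YT E ltnn => /(_ isT).
Qed.

Lemma calM_conf_sum T U :
  calM R (cls T) U = conf_sum nu_conf (fun S => (subgraph_count S (cls T))%:R) U.
Proof.
rewrite (@conf_sumE _ _ _ (sub_confs (cls T))) ?undup_uniq // => [|S _ nS]; last first.
  by rewrite subgraph_count_notin ?mulr0.
rewrite nu_sum.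
transitivity (\sum_(S <- sub_confs (cls T)) \sum_(Y <- fpowerset T) (cls Y == S)%:R * nu_conf S U).
  rewrite exchange_big /= big_seq [RHS]big_seq; apply: eq_bigr => Y; rewrite fpowersetE => YT.
  rewrite (@sum_delta R _ (sub_confs (cls T)) _ (fun S => nu_conf S U)) ?undup_uniq ?nu_conf_of //.
  by case/negP; apply/mem_sub_confs; exists Y.
rewrite [RHS]big_mkcond; apply: eq_bigr => S _; rewrite -mulr_suml subgraph_countE natr_sum.
by case: asboolP => [_|nc]; [rewrite mulrC|rewrite nu_conf0 ?mulr0].
Qed.

(** Induction on the degree: the count of [S] in itself is 1, and the other classes that occur in
    [S] have smaller degree. *)
Lemma phi_unique (p : conf -> confAlg gen R) S : phi_system p -> conf0 gen S -> p S = nu_conf S.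
Proof.
move=> pP; have [n] := ubnP (conf_deg S); elim: n S => // n IH S ltn cS.
apply/funext => U.
have := calM_conf_sum (repr S) U; rewrite conf_of_repr (pP S cS).
have HS (c : conf -> confAlg gen R) : conf_sum c (fun S' => (subgraph_count S' S)%:R) U =
    c S U + \sum_(S' <- sub_confs S | (S' != S) && `[< conf0 gen S' >]) c S' U * (subgraph_count S' S)%:R.
  rewrite (@conf_sumE _ _ _ (sub_confs S)) ?undup_uniq // => [|S' _ nS]; last first.
    by rewrite -(conf_of_repr S) subgraph_count_notin ?mulr0 // conf_of_repr.
  have SS : S \in sub_confs S.
    rewrite -{2}(conf_of_repr S); apply/mem_sub_confs; exists (repr S) => //.
    exact: conf_of_repr.
  rewrite big_mkcond (bigD1_seq S) ?undup_uniq //= asboolT // -big_mkcondr /=.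
  by have := subgraph_count_id (repr S); rewrite conf_of_repr => ->; rewrite mulr1.
rewrite !HS.
suff -> : \sum_(S' <- sub_confs S | (S' != S) && `[< conf0 gen S' >]) p S' U * (subgraph_count S' S)%:R =
  \sum_(S' <- sub_confs S | (S' != S) && `[< conf0 gen S' >]) nu_conf S' U * (subgraph_count S' S)%:R.
  exact: addIr.
rewrite big_seq_cond [RHS]big_seq_cond; apply: eq_bigr => S' /and3P[SS' S'S /asboolP cS'].
rewrite IH //; rewrite -ltnS; apply: leq_trans ltn; rewrite ltnS.
move: SS' S'S; rewrite -{1 2}(conf_of_repr S) => /mem_sub_confs[Y YS <-] YnS.
rewrite conf_deg_of; apply: fproper_ltn_card; rewrite fproperEneq YS andbT.
by apply: contra_neq YnS => ->.
Qed.

Lemma phiE S : conf0 gen S -> phi gen R S = nu_conf S.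
Proof.
apply: phi_unique; rewrite /phi.
apply: (@xgetPex _ (fun _ _ => 0) [set p | phi_system p]); exists nu_conf => T _.
by apply/funext => U; rewrite -{1}(conf_of_repr T) calM_conf_sum conf_of_repr.
Qed.

Lemma conf_sum_phi (a : conf -> R) U :
  conf_sum (phi gen R) a U = \sum_(S <- confs (conf_deg U)) nu_conf S U * a S.
Proof.
by rewrite -nu_confE; apply: eq_fsbigr => S; rewrite inE => cS; rewrite phiE.
Qed.

Lemma conf_sum_phi_connected (a : conf -> R) U : conf0 gen U -> conf_sum (phi gen R) a U = a U.
Proof.
move=> cU; rewrite conf_sum_phi (bigD1_seq U) ?confs_uniq ?mem_confs //=.
rewrite /nu_conf nu_connected // conf_of_repr eqxx mul1r big1 ?addr0 // => S SU.
by rewrite nu_connected // conf_of_repr (negbTE SU) mul0r.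
Qed.

Lemma calM_phi T U :
  calM R (cls T) U = conf_sum (phi gen R) (fun S => (subgraph_count S (cls T))%:R) U.
Proof. by rewrite conf_sum_phi calM_conf_sum nu_confE. Qed.

(** * From counts in balls to the limit element and the partition function *)

Section SimpleAccumulation.
Local Notation ball n := (cayley_ball gen n).
Local Notation p := (ball_card gen R).
Variables (L : conf -> nat) (r : R).
Hypothesis count_ball : forall S n, conf0 gen S ->
  (subgraph_count S (cls (ball n)))%:R = if (L S <= n)%N then p (n - L S)%N else 0.
Hypothesis p0 : p 0 = 1.
Hypothesis p_ratio : forall k, (fun n => p n / p (n + k)%N) @ \oo --> r ^+ k.

Lemma conf_sum_eq (a b : conf -> R) : (forall S, conf0 gen S -> a S = b S) ->
  conf_sum (phi gen R) a = conf_sum (phi gen R) b.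
Proof. by move=> ab; apply/funext => U; apply: eq_fsbigr => S; rewrite inE => /ab->. Qed.

Lemma ball_average_cvg U : (fun n => ball_average R n U) @ \oo -->
  conf_sum (phi gen R) (fun S => r ^+ L S) U.
Proof.
rewrite conf_sum_phi.
have H S : nu_conf S U * ((subgraph_count S (cls (ball n)))%:R / p n) @[n --> \oo] -->
    nu_conf S U * r ^+ L S.
  have [cS|nc] := pselect (conf0 gen S); last first.
    rewrite nu_conf0 // mul0r (_ : (fun n => _) = fun=> 0); first exact: cvg_cst.
    by apply/funext => n; rewrite mul0r.
  apply: cvgMr; rewrite -(cvg_shiftn (L S)).
  move: (@p_ratio (L S)); apply: cvg_trans; apply: near_eq_cvg; apply: nearW => n /=.
  by rewrite count_ball // leq_addl addnK.
move: (@cvg_sumr _ _ (confs (conf_deg U)) _ _ H); apply: cvg_trans; apply: near_eq_cvg; apply: nearW => n /=.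
rewrite /ball_average calM_phi conf_sum_phi mulr_suml; apply: eq_bigr => S _.
by rewrite mulrA.
Qed.

Lemma Omega_singleton : Omega gen R = [set conf_sum (phi gen R) (fun S => r ^+ L S)].
Proof.
apply/seteqP; split=> [w [s [s_mono ws]]|_ ->]; last first.
  by exists id; split=> // U; exact: ball_average_cvg.
apply/funext => U; apply: (cvg_seq_unique (ws U)).
apply: (cvg_comp s (fun n => ball_average R n U)); last exact: ball_average_cvg.
have s_ge n : (n <= s n)%N.
  by elim: n => // n IH; apply: leq_ltn_trans IH _; exact: s_mono.
move=> A [N _ HN]; exists N => // n /= Nn; apply: HN => /=.
exact: leq_trans (s_ge n).
Qed.

Lemma growth_quotient_conv (z : conf -> nat -> int) : growth_quotient R z <->
  forall n U, calM R (cls (ball n)) U =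
    conf_sum (phi gen R) (fun S => \sum_(k < n.+1) p (n - k)%N * (z S k)%:~R) U.
Proof.
have H n U : \sum_(k < n.+1) p (n - k)%N * conf_sum (phi gen R) (fun S => (z S k)%:~R) U =
    conf_sum (phi gen R) (fun S => \sum_(k < n.+1) p (n - k)%N * (z S k)%:~R) U.
  under eq_bigr => k _ do rewrite conf_sum_phi mulr_sumr.
  rewrite exchange_big /= conf_sum_phi; apply: eq_bigr => S _; rewrite mulr_sumr.
  by apply: eq_bigr => k _; rewrite mulrCA.
by split=> Hz n U; rewrite Hz H.
Qed.

Lemma ball_conv S n : conf0 gen S ->
  \sum_(k < n.+1) p (n - k)%N * ((k == L S :> nat)%:~R : int)%:~R =
  (subgraph_count S (cls (ball n)))%:R.
Proof.
move=> cS; rewrite count_ball //; case: leqP => [Ln|nL].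
  rewrite (bigD1 (inord (L S))) //= inordK ?ltnS // eqxx mulr1 big1 ?addr0 // => k.
  rewrite -val_eqE /= inordK ?ltnS // => /negbTE->.
  by rewrite mulr0.
apply: big1 => k _; have -> : (k == L S :> nat) = false; last by rewrite mulr0.
by apply/negbTE; rewrite neq_ltn (leq_ltn_trans _ nL) // -ltnS.
Qed.

(** Read at the connected class [S], the condition is a triangular system for [z S] with diagonal
    [p 0 = 1]. Its solution is the monomial [t ^ L(S)], because the counts are those of balls
    shifted by [L S]. *)
Lemma growth_quotient_uniq (z : conf -> nat -> int) S k : growth_quotient R z ->
  conf0 gen S -> z S k = (k == L S :> nat)%:~R.
Proof.
move=> /growth_quotient_conv zP cS; have [n] := ubnP k; elim: n k => // n IH k kn.
have := zP k S; rewrite calM_phi !conf_sum_phi_connected // -ball_conv //.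
rewrite !big_ord_recr /= subnn p0 !mul1r.
have -> : \sum_(i < k) p (k - i)%N * (z S i)%:~R =
    \sum_(i < k) p (k - i)%N * ((i == L S :> nat)%:~R : int)%:~R.
  by apply: eq_bigr => i _; rewrite IH //; have := ltn_ord i; lia.
by move/addrI/eqP; rewrite eqr_int eq_sym => /eqP.
Qed.

Lemma ZcoefE S k : conf0 gen S -> Zcoef R S k = (k == L S :> nat)%:~R.
Proof.
apply: growth_quotient_uniq; rewrite /Zcoef.
apply: (@xgetPex _ (fun _ _ => 0) [set z | growth_quotient R z]).
exists (fun S k => (k == L S :> nat)%:~R); apply/growth_quotient_conv => n U.
by rewrite calM_phi; congr (_ U); apply: conf_sum_eq => S' cS'; rewrite ball_conv.
Qed.

Lemma Zseries_cvg S : conf0 gen S -> Zseries (R := R) S r @ \oo --> r ^+ L S.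
Proof.
(* The partial sum at [n] stops before index [n], so that it is constant from [L S + 1] on. *)
move=> cS; rewrite -(cvg_shiftn (L S).+1) (_ : (fun n => _) = fun=> r ^+ L S).
  exact: cvg_cst.
apply/funext => n; rewrite /Zseries /series /=.
rewrite (big_cat_nat _ (n := L S)) //=; last by rewrite addnS leqW // leq_addl.
rewrite big_nat big1 => [|k /andP[_ kL]]; last first.
  by rewrite ZcoefE // (ltn_eqF kL) mul0r.
rewrite add0r addnS big_ltn ?ltnS ?leq_addl //.
rewrite ZcoefE // eqxx mul1r big_nat big1 ?addr0 // => k /andP[kL _].
by rewrite ZcoefE // (gtn_eqF kL) mul0r.
Qed.

Lemma growth_partitionE : growth_partition gen r = conf_sum (phi gen R) (fun S => r ^+ L S).
Proof. by apply: conf_sum_eq => S cS; apply/cvg_lim => //; exact: Zseries_cvg. Qed.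

End SimpleAccumulation.
End Coefficients.

(** * Subgraphs of balls *)

Section ArtinBalls.
Local Open Scope nat_scope.
Local Open Scope group_scope.
Variables (G : finType) (M : coxeterMatrix G).
Hypothesis fin : finite_type M.

Local Notation A := (presMonoid (braid_rel M)).
Local Notation a_ := (pres_word (braid_rel M)).
Local Notation r := (pres_gen (braid_rel M)).
Local Notation L := (len r).
Local Notation cls := (conf_of r).
Implicit Types (a b : G) (x y z g h d e : A) (Y Z : {fset A}) (S : conf r).

Definition translate d Y := [fset d * x | x in Y]%fset.

Lemma mem_translate d Y x : (d * x \in translate d Y) = (x \in Y).
Proof.
apply/imfsetP/idP => [[y /= yY /(artin_mulI fin) ->] //|xY]; by exists x.
Qed.

Lemma translateP d Y z : reflect (exists2 x, x \in Y & z = d * x) (z \in translate d Y).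
Proof. exact: imfsetP. Qed.

Lemma translate_inj d Y Z : translate d Y = translate d Z -> Y = Z.
Proof. by move=> E; apply/fsetP => x; rewrite -(mem_translate d Y) -(mem_translate d Z) E. Qed.

Lemma translate_class d Y : cls (translate d Y) = cls Y.
Proof.
apply/esym/conf_ofP; exists (fun x => d * x); split => [x y _ _|//|x y a _ _].
  exact: artin_mulI.
by rewrite -amulA; split=> [->//|/(artin_mulI fin)].
Qed.

Lemma left_gcd_uniq Y d e : is_left_gcd Y d -> is_left_gcd Y e -> d = e.
Proof.
move=> [dY dmax] [eY emax]; apply: left_divides_anti; [exact: emax|exact: dmax].
Qed.

(** [p] divides every translate and therefore their gcd; cancelling it leaves a common divisor of
    [Y]. *)
Lemma left_gcd_translate p d Y : Y != fset0 -> is_left_gcd Y d ->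
  is_left_gcd (translate p Y) (p * d).
Proof.
move=> /fset0Pn[y0 y0Y] [dY dmax]; split=> [_ /translateP[x xY ->]|e eY].
  by apply/(left_divides_mul2l fin)/dY.
have [|e' e'Y e'max] := @left_gcd_exists _ M fin (fun x => x \in translate p Y).
  by exists (p * y0); rewrite mem_translate.
have [f E] : left_divides p e'.
  by apply: e'max => _ /translateP[x _ ->]; exists x.
apply: left_divides_trans (e'max _ eY) _; rewrite E; apply/(left_divides_mul2l fin).
apply: dmax => u uY; apply/(left_divides_mul2l fin p); rewrite -E; apply: e'Y.
by rewrite mem_translate.
Qed.

Lemma based_exists Y : Y != fset0 ->
  exists d Z, Y = translate d Z /\ is_left_gcd Z 1.
Proof.
move=> /fset0Pn[y0 y0Y].
have [|d dY dmax] := @left_gcd_exists _ M fin (fun x => x \in Y); first by exists y0.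
pose q x := xget 1 [set v | x = d * v].
have qE x : x \in Y -> x = d * q x.
  by move=> /dY[v xE]; rewrite /q; case: xgetP => [w _ //|/(_ v)].
exists d, [fset q x | x in Y]%fset; split.
  apply/fsetP => x; apply/idP/translateP => [xY|[_ /imfsetP[y /= yY ->] ->]]; last by rewrite -qE.
  by exists (q x); [apply/imfsetP; exists x|exact: qE].
split=> [u _|e eY]; first by exists u; rewrite amul1g.
apply/(left_divides_mul2l fin d); rewrite amulg1; apply: dmax => y yY.
rewrite (qE y yY); apply/(left_divides_mul2l fin)/eY.
by apply/imfsetP; exists y.
Qed.

(* A common left multiple [p x0 = q (f x0)] of two corresponding vertices
   propagates along the edges by cancellation, so that [p Y = q Z]. *)
Lemma based_uniq Y Z : cls Y = cls Z -> conf0 r (cls Y) ->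
  is_left_gcd Y 1 -> is_left_gcd Z 1 -> Y = Z.
Proof.
move=> YZ /connected_conf0[/eqP+ conn]; rewrite conf_of0 => Y0 gY gZ.
have Z0 : Z != fset0 by rewrite -(conf_of0 r) -YZ conf_of0.
have /conf_ofP[f [finj ZE fiso]] := YZ.
have /fset0Pn[x0 x0Y] := Y0.
have [p [q E0]] := left_common_multiple fin x0 (f x0).
pose P x := p * x == q * f x.
have YE : Y = ([fset x in Y | P x] `|` [fset x in Y | ~~ P x])%fset.
  by apply/fsetP => x; rewrite !inE; case: (P x); rewrite ?andbT ?andbF ?orbF.
have sep : detached r [fset x in Y | P x]%fset [fset x in Y | ~~ P x]%fset.
  split; first by apply/fdisjointP => z; rewrite !inE => /andP[-> ->].
  move=> x y; rewrite !inE => /andP[xY /eqP Px] /andP[yY]; rewrite -negb_or; apply: contra.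
  case/orP=> /existsP[a /eqP E]; apply/eqP.
    have /(fiso _ _ a xY yY) <- := E; by rewrite -E !amulA Px.
  have /(fiso _ _ a yY xY) E' := E; apply: (artin_Imul fin (g := r a)).
  by rewrite -!amulA E E' Px.
have Pall x : x \in Y -> P x.
  move=> xY; have [|E|E] := conn (cls [fset x in Y | P x]%fset) (cls [fset x in Y | ~~ P x]%fset).
  - by apply/conf_prodP; do 2 eexists; split; last exact: YE.
  - move/eqP: E; rewrite conf_of0 => /eqP/fsetP/(_ x0).
    by rewrite !inE x0Y /P E0 eqxx.
  - move/eqP: E; rewrite conf_of0 => /eqP/fsetP/(_ x).
    by rewrite !inE xY; case: (P x).
have T : translate p Y = translate q Z.
  apply/fsetP => z; apply/translateP/translateP => -[x].
    move=> xY ->; exists (f x); last exact/eqP/Pall.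
    by rewrite ZE; apply/imfsetP; exists x.
  by rewrite ZE => /imfsetP[y /= yY ->] ->; exists y => //; exact/esym/eqP/Pall.
have pq : p * 1 = q * 1.
  apply: (@left_gcd_uniq (translate p Y)); first exact: left_gcd_translate.
  by rewrite T; exact: left_gcd_translate.
by move: T; rewrite !amulg1 in pq; rewrite pq => /translate_inj.
Qed.

Lemma based_reprP S : conf0 r S -> cls (based_repr S) = S /\ is_left_gcd (based_repr S) 1.
Proof.
move=> /connected_conf0[/eqP+ _]; rewrite -{1}(conf_of_repr S) conf_of0 => S0.
have [d [Z [E gZ]]] := based_exists S0.
apply: (@xgetPex _ fset0 [set Y | cls Y = S /\ is_left_gcd Y 1]).
by exists Z; split=> //; rewrite -(translate_class d) -E conf_of_repr.
Qed.

Lemma finite_ball n : finite_set [set g : A | L g <= n].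
Proof.
have memq g : (g \in flatten [seq alist M i | i <- iota 0 n.+1]) = (L g <= n).
  apply/flatten_mapP/idP => [[i]|gn].
    by rewrite mem_iota mem_alist => /andP[_ +] /eqP->.
  by exists (L g); rewrite ?mem_iota ?mem_alist.
apply/finite_seqP; exists (flatten [seq alist M i | i <- iota 0 n.+1]).
by apply/seteqP; split=> g; rewrite /mkset memq.
Qed.

Local Notation ball n := (cayley_ball r n).

Lemma mem_ball n g : (g \in ball n) = (L g <= n).
Proof.
rewrite in_fset_set; last exact: finite_ball.
by apply/idP/idP => [/set_mem|/mem_set].
Qed.

Lemma card_ball n : #|` ball n| = \sum_(i < n.+1) acnt M [set: G]%SET i.
Proof.
transitivity (count xpredT (ball n)); first by rewrite count_predT.
rewrite (@count_partition _ _ (ball n) xpredT L (iota 0 n.+1)) ?iota_uniq //; last first.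
  by move=> g; rewrite mem_ball mem_iota.
rewrite -(big_mkord xpredT (fun i => acnt M [set: G]%SET i)) /index_iota subn0.
rewrite big_seq [RHS]big_seq; apply: eq_bigr => i; rewrite mem_iota /= => ilt.
have -> : acnt M [set: G]%SET i = size (alist M i).
  by rewrite /acnt /acount -[RHS]count_predT; apply: eq_count => x; rewrite gsuppT.
rewrite -size_filter; apply: perm_size; apply: uniq_perm; rewrite ?filter_uniq ?fset_uniq //.
  exact: undup_uniq.
move=> x; rewrite mem_filter mem_alist mem_ball.
by case: eqP => //= ->; lia.
Qed.

Lemma LinvE S : Linv S = \max_(u <- based_repr S) L u.
Proof. by []. Qed.

Lemma translate_ball S d n : conf0 r S ->
  (translate d (based_repr S) `<=` ball n)%fset = (L d + Linv S <= n).
Proof.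
move=> cS; have [clsE gS] := based_reprP cS.
have S0 : based_repr S != fset0.
  by rewrite -(conf_of0 r) clsE; apply/eqP; case/connected_conf0: cS.
apply/fsubsetP/idP => [H|H _ /translateP[x xY ->]]; last first.
  rewrite mem_ball len_aM; apply: leq_trans H; rewrite leq_add2l LinvE.
  by rewrite (big_rem x) //= leq_maxl.
have [x xY xmax] : exists2 x, x \in based_repr S & L x = Linv S.
  have max_mem (q : seq A) : 0 < size q -> exists2 x, x \in q & L x = \max_(u <- q) L u.
    elim: q => // x q IH _; rewrite big_cons.
    have [xq|qx] := leqP (\max_(u <- q) L u) (L x); first by exists x; rewrite ?inE ?eqxx.
    case: q IH qx => [|y q] IH qx; first by rewrite big_nil in qx.
    by have [//|z zq zE] := IH; exists z; rewrite ?zE // inE zq orbT.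
  by apply: max_mem; rewrite lt0n -/(#|` based_repr S|) cardfs_eq0.
by rewrite -xmax -len_aM -mem_ball; apply: H; rewrite mem_translate.
Qed.

Lemma subgraph_count_ball S n : conf0 r S ->
  subgraph_count S (cls (ball n)) = if Linv S <= n then #|` ball (n - Linv S)| else 0%N.
Proof.
move=> cS; have [clsE gS] := based_reprP cS.
have S0 : based_repr S != fset0.
  by rewrite -(conf_of0 r) clsE; apply/eqP; case/connected_conf0: cS.
have H Z : cls Z = S -> exists d, Z = translate d (based_repr S).
  move=> ZS; have Z0 : Z != fset0 by rewrite -(conf_of0 r) ZS -clsE conf_of0.
  have [d [Z' [ZE gZ']]] := based_exists Z0.
  exists d; rewrite ZE; congr translate; apply: based_uniq => //.
    by rewrite clsE -ZS ZE translate_class.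
  by rewrite -(translate_class d) -ZE ZS.
rewrite subgraph_countE; case: leqP => Sn; last first.
  apply: big1_seq => Z /=; rewrite fpowersetE => Zn; apply/eqP; rewrite eqb0; apply/eqP => /H[d E].
  by move: Zn; rewrite E translate_ball //; lia.
transitivity (size [seq Z <- fpowerset (ball n) | cls Z == S]).
  by rewrite size_filter -sum1_count [RHS]big_mkcond; apply: eq_bigr => Z _; case: eqP.
(* The copies of [S] in the ball are the translates by elements of length at most [n - Linv S], and
   the gcd of a copy recovers the translating element. *)
rewrite -(size_map (fun g => translate g (based_repr S)) (ball (n - Linv S))).
apply: perm_size; apply: uniq_perm; first by rewrite filter_uniq ?fset_uniq.
  rewrite map_inj_in_uniq ?fset_uniq // => g h _ _ E.
  rewrite -[g]amulg1 -[h]amulg1.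
  apply: left_gcd_uniq (left_gcd_translate g S0 gS) _; rewrite E.
  exact: left_gcd_translate.
move=> Z; rewrite mem_filter fpowersetE; apply/andP/mapP => [[/eqP/H[d ->]]|[d dn ->]].
  rewrite translate_ball // => dn; exists d => //; rewrite mem_ball; lia.
by rewrite translate_class clsE eqxx translate_ball //; move: dn; rewrite mem_ball; lia.
Qed.

Lemma card_ball0 : #|` ball 0| = 1%N.
Proof.
have -> : ball 0 = [fset 1]%fset.
  apply/fsetP => x; rewrite mem_ball inE leqn0; apply/eqP/eqP => [/len0|->] //.
  exact: len1.
exact: cardfs1.
Qed.

(** * Ratios of cardinalities of balls *)

Section BallRatio.
Variables (R : realType) (q : R).
Hypotheses (G0 : 0 < #|G|) (q01 : (0 < q <= 1)%R)
  (q_ratio : has_ratio (acnt M [set: G]%SET) q)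
  (q_big : forall n, (1 <= (acnt M [set: G]%SET n)%:R * q ^+ n)%R).

(** Ball cardinalities are the convolution of the sphere cardinalities with the constant sequence 1,
    whose ratio limit 1 is at least [q]. *)
Lemma ball_ratio k :
  (fun n => ball_card r R n / ball_card r R (n + k)%N)%R @ \oo --> (q ^+ k)%R.
Proof.
have [a _] : exists a : G, a \in G by apply/card_gt0P.
have aT : a \in [set: G]%SET by rewrite finset.in_setT.
have [q0 q1] := andP q01.
pose p n : R := (acnt M [set: G]%SET n)%:R%R.
have p0 n : (0 < p n)%R by rewrite ltr0n; apply: acnt_gt0 aT.
have pE n : ball_card r R n = cauchy_prod p (fun=> 1%R) n.
  rewrite /ball_card card_ball natr_sum; apply: eq_bigr => i _.
  by rewrite mulr1.
rewrite (_ : (fun n => _) = fun n => (cauchy_prod p (fun=> 1) n / cauchy_prod p (fun=> 1) (n + k)%N)%R);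
  last by apply/funext => n; rewrite !pE.
apply: ratio_pow => [n|]; first exact: cauchy_prod_gt0.
apply: (@cauchy_prod_limit R p (fun=> 1%R) q 1%R 1%R 0) => // [n||i _].
- by rewrite ler_nat; apply: acnt_le aT.
- rewrite (_ : (fun n => _) = fun=> 1%R); first exact: cvg_cst.
  by apply/funext => n; rewrite divr1.
- apply: le_trans (q_big i) _; rewrite expr1n mulr1.
  by rewrite ler_piMr ?ler0n // exprn_ile1 // ltW.
Qed.

End BallRatio.
End ArtinBalls.

(** * Parabolic subgroups and the growth polynomial *)

Section Restriction.
Local Open Scope nat_scope.
Local Open Scope group_scope.
Variables (G : finType) (M : coxeterMatrix G) (J : {set G}).

Local Notation H := {x : G | x \in J}.
Local Notation MJ := (cox_sub M J).
Local Notation W := (presMonoid (cox_rel M)).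
Local Notation c_ := (pres_word (cox_rel M)).
Local Notation s := (pres_gen (cox_rel M)).
Local Notation l := (len s).
Local Notation WJ := (presMonoid (cox_rel MJ)).
Local Notation cJ := (pres_word (cox_rel MJ)).
Local Notation sJ := (pres_gen (cox_rel MJ)).
Local Notation lJ := (len sJ).
Implicit Types (a b : G) (u v : seq G) (p q : seq H).

Lemma map_alternating (c d : H) n :
  map val (alternating c d n) = alternating (val c) (val d) n.
Proof. by rewrite /Defs.alternating -map_comp; apply: eq_map => i /=; case: ifP. Qed.

Lemma map_val_cox p q : cJ p = cJ q -> c_ (map val p) = c_ (map val q).
Proof.
move=> /pres_wordP pq; apply/pres_wordP; elim: pq => {p q}.
- move=> u v [[c [d [n [cd m -> ->]]]]|[c [-> ->]]]; apply: pres_rel.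
    left; exists (val c), (val d), n.
    by rewrite !map_alternating (inj_eq val_inj).
  by right; exists (val c).
- by move=> u; exact: pres_refl.
- by move=> u v _ IH; exact: pres_sym.
- by move=> u v w _ IH1 _ IH2; exact: pres_trans IH1 IH2.
- by move=> u u' v v' _ IH1 _ IH2; rewrite !map_cat; exact: pres_cat.
Qed.

Lemma restrict_val p : pmap insub (map val p) = p.
Proof. exact: (map_pK valK). Qed.

Lemma val_restrict u : all (mem J) u -> map val (pmap insub u : seq H) = u.
Proof. by elim: u => //= a u IH /andP[aJ uJ]; rewrite insubT /= IH. Qed.

Lemma all_val p : all (mem J) (map val p).
Proof. by apply/allP => _ /mapP[c _ ->]; exact: (valP c). Qed.

(** Braid moves introduce no new letters, so that a derivation between words in [J] stays in [J]. *)
Lemma restrict_braid u v : pres_eq (braid_rel M) u v -> all (mem J) u ->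
  pres_eq (braid_rel MJ) (pmap insub u) (pmap insub v).
Proof.
elim=> {u v}.
- move=> u v [a [b [n [ab m -> ->]]]]; have := cox_ge2 ab m.
  case: n m => // -[//|n] m _ aJb.
  have aJ : a \in J by move: aJb; rewrite alternatingS /= => /andP[].
  have bJ : b \in J by move: aJb; rewrite !alternatingS /= => /and3P[].
  rewrite -(map_alternating (Sub a aJ) (Sub b bJ)) -(map_alternating (Sub b bJ) (Sub a aJ)).
  rewrite !restrict_val; apply: pres_rel.
  by exists (Sub a aJ), (Sub b bJ), n.+2; rewrite -(inj_eq val_inj).
- by move=> u _; exact: pres_refl.
- move=> u v uv IH vJ; apply/pres_sym/IH; rewrite (eq_all_r (braid_eq_mem uv)).
  exact: vJ.
- move=> u v w uv IH1 _ IH2 uJ; apply: pres_trans (IH1 uJ) _; apply: IH2.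
  by rewrite -(eq_all_r (braid_eq_mem uv)).
- move=> u u' v v' _ IH1 _ IH2; rewrite all_cat => /andP[uJ vJ].
  by rewrite !pmap_cat; apply: pres_cat; [exact: IH1|exact: IH2].
Qed.

Lemma val_braid_inj p q : pres_eq (braid_rel M) (map val p) (map val q) -> cJ p = cJ q.
Proof.
move=> /restrict_braid/(_ (all_val p)); rewrite !restrict_val; exact: braid_cox.
Qed.

(** If [c] were a descent of [p] in the large group, a reduced word for it beginning with [c] would
    again have its letters in [J]. By Matsumoto's theorem and restriction of the braid moves, [c]
    would be a descent of [p] in the small group as well. *)
Lemma reduced_val p : reduced MJ p -> reduced M (map val p).
Proof.
elim: p => [|c p IH] red /=; first by rewrite /reduced len1.
have rp := reduced_cons red; have rvp := IH rp.
apply: (@reduced_cat _ M [:: val c]) => //; first by rewrite /reduced (len_s M).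
rewrite redp_gen; apply/negP => /wleP[x E cx].
have Jx : wsupp J x.
  have := wsupp_word J rvp; rewrite all_val => /esym/esym; rewrite E wsupp_mul //.
  by move=> /andP[].
have [q qE] : exists q, map val q = rword x.
  by exists (pmap insub (rword x)); rewrite val_restrict.
have rq : reduced M (val c :: map val q).
  rewrite qE; apply: (@reduced_cat _ M [:: val c]); rewrite ?rwordK ?reduced_rword //.
  by rewrite /reduced (len_s M).
have Epq : c_ (map val p) = c_ (map val (c :: q)).
  by rewrite E /= pres_word_cons qE rwordK.
have Ec : cJ p = cJ (c :: q) by apply/val_braid_inj/reduced_braid.
have szE : size p = (size q).+1.
  by have /eqP := rvp; rewrite Epq (eqP rq) /= !size_map.
have := red; rewrite /reduced pres_word_cons Ec pres_word_cons gen_mulKg /= => /eqP lq.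
by have := len_word_le (cox_rel MJ) q; rewrite lq szE ltnNge leqnSn.
Qed.

Definition winj (x : WJ) : W := c_ (map val (rword x)).

Lemma winj_word p : winj (cJ p) = c_ (map val p).
Proof. by apply: map_val_cox; rewrite rwordK. Qed.

Lemma len_winj x : l (winj x) = lJ x.
Proof.
have /reduced_val/eqP := reduced_rword x; rewrite /winj => ->.
by rewrite size_map size_rword.
Qed.

Lemma wsupp_winj x : wsupp J (winj x).
Proof. by rewrite /winj wsupp_word ?all_val //; apply/reduced_val/reduced_rword. Qed.

Lemma winj_inj : injective winj.
Proof.
move=> x y E; rewrite -[x]rwordK -[y]rwordK; apply: val_braid_inj.
by apply: reduced_braid E; apply/reduced_val/reduced_rword.
Qed.

Lemma winj_surj w : wsupp J w -> exists x, winj x = w.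
Proof.
move=> Jw; exists (cJ (pmap insub (rword w))).
by rewrite winj_word val_restrict // rwordK.
Qed.

Hypothesis fin : finite_type M.

Lemma finite_type_sub : finite_type MJ.
Proof.
have := @finite_preimage WJ W [set: W]%classic winj (in2W winj_inj) fin.
by rewrite preimage_setT.
Qed.

Lemma longest_length_sub : longest_length MJ = l (wJ M J).
Proof.
rewrite /longest_length fsbig_finite; last exact: finite_type_sub.
have [Jw wmax] := wJP fin J.
apply/eqP; rewrite eqn_leq; apply/andP; split.
  apply/bigmax_leqP_seq => x _ _.
  change (lJ x <= l (wJ M J)); rewrite -len_winj; apply: wmax; exact: wsupp_winj.
have [x xE] := winj_surj Jw; rewrite -xE len_winj.
have xin : x \in fset_set [set: coxeter_group MJ].
  by rewrite in_fset_set ?inE //; exact: finite_type_sub.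
by rewrite (big_rem x) //=; exact: leq_maxl.
Qed.

End Restriction.

(** All submatrices of a matrix of finite type are of finite type, so that every subset [J]
    contributes to [N_M]. *)
Lemma Npoly_growth_poly (R : realType) (G : finType) (M : coxeterMatrix G) (t : R) :
  finite_type M -> (Npoly R M).[t]%R = growth_poly M t.
Proof.
move=> fin; rewrite /Npoly horner_sum /growth_poly.
rewrite (eq_bigl xpredT) => [|J]; last by apply/asboolP; exact: finite_type_sub.
apply: eq_bigr => J _; rewrite hornerZ hornerXn longest_length_sub //.
Qed.

Lemma growth_root_ratio (R : realType) (G : finType) (M : coxeterMatrix G) (r : R) :
  (0 < #|G|)%N -> finite_type M -> 0 < r <= 1 -> has_ratio (acnt M [set: G]%SET) r ->
  growth_root M r.
Proof.
move=> G0 fin /andP[r0 r1] Hr.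
have [a _] : exists a : G, a \in G by apply/card_gt0P.
have aT : a \in [set: G]%SET by rewrite finset.in_setT.
have p0 n : (0 < acnt M [set: G]%SET n)%N by apply: acnt_gt0 aT.
have [comm|ncomm] := pselect (all_commuting M); [right|left]; split=> //.
  apply: (acnt_ratio_commuting fin comm _ Hr).
  by apply/set0Pn; exists a.
have rlt1 : r < 1.
  have [b [c [bc mbc]]] : exists b c, b != c /\ M b c <> Some 2%N.
    apply: contrapT => H; apply: ncomm => b c bc; apply: contrapT => mbc.
    by apply: H; exists b, c.
  apply: (@acnt_ratio_lt1 R G M fin [set: G]%SET r b c _ _ bc _ Hr); rewrite ?finset.in_setT //.
  exact/eqP.
split; first by rewrite r0 rlt1.
  by rewrite rootE Npoly_growth_poly // (growth_poly_root fin p0 Hr).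
move=> t /andP[t0 _]; rewrite rootE Npoly_growth_poly //.
by apply: contraTT; rewrite -ltNge => tr; apply: (growth_poly_neq0 fin p0 Hr); rewrite t0.
Qed.

Theorem mainTheorem2 :
  exists E : set abd_type,
    finite_set E /\ (forall t, E t -> abd_valid t) /\
    forall (R : realType) (G : finType) (M : coxeterMatrix G),
      (0 < #|G|)%N -> finite_type M ->
      (forall t, E t -> ~ has_type M t) ->
      exists (r : R) (omega : confAlg (artin_gen M) R),
        [/\ growth_root M r,
            Omega (artin_gen M) R = [set omega],
            forall S, conf0 (artin_gen M) S -> cvgn (Zseries S r),
            omega = growth_partition (artin_gen M) r &
            omega = conf_sum (phi (artin_gen M) R) (fun S => r ^+ Linv S)].
Proof.
exists set0; split; first exact: finite_set0.
split=> // R G M G0 fin _.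
have [a _] : exists a : G, a \in G by apply/card_gt0P.
have T0 : [set: G]%SET != finset.set0 by apply/set0Pn; exists a; rewrite finset.in_setT.
have [r [r01 Hr r_big]] := @acnt_ratio R G M fin [set: G]%SET T0.
pose L := @Linv _ _ (artin_gen M).
have count S n : conf0 (artin_gen M) S ->
    (subgraph_count S (conf_of _ (cayley_ball (artin_gen M) n)))%:R =
    if (L S <= n)%N then ball_card (artin_gen M) R (n - L S) else 0.
  by move=> cS; rewrite (subgraph_count_ball fin n cS) /L; case: ifP.
have p0 : ball_card (artin_gen M) R 0 = 1 by rewrite /ball_card (card_ball0 M).
have pr k := @ball_ratio G M fin R r G0 r01 Hr r_big k.
exists r, (conf_sum (phi (artin_gen M) R) (fun S => r ^+ L S)); split=> //.
- exact: growth_root_ratio.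
- exact: (Omega_singleton count pr).
- move=> S cS; apply/cvg_ex; exists (r ^+ L S); exact: (Zseries_cvg count p0).
- exact: esym (growth_partitionE r count p0).
Qed.
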